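(* Let $d,\alpha\in\mathbb{N}$, let $\rho(\boldsymbol{x})=\prod_{k=1}^d\rho_k(x_k)$ with $\rho_k\in\mathcal{S}_+^{\rm mon}$ for $k=1,\dots,d$, let $f\in W^{\alpha,2}_{\rho,\otimes}(\mathbb{R}^d)$, and define $$g(\boldsymbol{\theta})=f(\phi_{\boldsymbol{c}}(\boldsymbol{\theta}))\,\rho(\phi_{\boldsymbol{c}}(\boldsymbol{\theta}))\prod_{k=1}^d c_k\,\phi'(\theta_k),\qquad\boldsymbol{\theta}\in(0,2\pi)^d.$$ Then $g\in W^{\alpha,2}_{\otimes}(\mathbb{T}^d)$.
   Context: $\mathbb{N}=\{1,2,\dots\}$, $\mathbb{N}_0=\mathbb{N}\cup\{0\}$. Monotonic Schwartz weights: $\mathcal{S}$ is the Schwartz space of $\omega\in C^\infty(\mathbb{R})$ with $\sup_{x\in\mathbb{R}}|x^a\omega^{(b)}(x)|<\infty$ for all $a,b\in\mathbb{N}_0$. $\mathcal{S}_+^{\rm mon}$ is the set of real-valued $\omega\in\mathcal{S}$ with $\omega(x)>0$ for all $x\in\mathbb{R}$ for which there exists $K>0$ such that $x\,\omega'(x)\le 0$ for all $x\in\mathbb{R}\setminus[-K,K]$. One-dimensional spaces: for a weight $\rho_j$, $W^{\alpha,2}_{\rho_j}(\mathbb{R})$ is the Hilbert space of functions $f:\mathbb{R}\to\mathbb{C}$ with weak derivatives up to order $\alpha$ and $\|f\|^2=\sum_{\tau=0}^\alpha\int_{\mathbb{R}}|f^{(\tau)}(x)|^2\rho_j(x)\,dx<\infty$.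 With $\mathbb{T}$ the torus ($[0,2\pi]$ with endpoints identified), $W^{\alpha,2}(\mathbb{T})$ is the Hilbert space of $f\in L^2(\mathbb{T})$ with weak derivatives on $\mathbb{T}$ (defined by integration by parts against smooth $2\pi$-periodic test functions) and $\|f\|^2=\sum_{\tau=0}^\alpha\int_{\mathbb{T}}|f^{(\tau)}(x)|^2\,dx<\infty$. Tensor products: $W^{\alpha,2}_{\rho,\otimes}(\mathbb{R}^d)=\bigotimes_{j=1}^dW^{\alpha,2}_{\rho_j}(\mathbb{R})$ and $W^{\alpha,2}_\otimes(\mathbb{T}^d)=\bigotimes_{j=1}^dW^{\alpha,2}(\mathbb{T})$ are the (completed) Hilbert space tensor products, whose elements are identified with functions on $\mathbb{R}^d$ and $\mathbb{T}^d$, respectively; functions on $\mathbb{T}^d$ are identified with functions on $(0,2\pi)^d$. Componentwise Möbius transformation: for $\boldsymbol{c}=(c_1,\dots,c_d)$ with $c_k>0$, $\phi_{\boldsymbol{c}}:(0,2\pi)^d\to\mathbb{R}^d$, $\phi_{\boldsymbol{c}}(\boldsymbol{\theta})=\big(c_1\cot(\theta_1/2),\dots,c_d\cot(\theta_d/2)\big)$, and $\phi'(\theta)=\frac{1}{2\sin^2(\theta/2)}$ is the derivative of $\phi(\theta)=-\cot(\theta/2)$. *)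

(* Defs.v *)
From HB Require Import structures.
From mathcomp Require Import all_boot all_order all_algebra.
From mathcomp Require Import all_classical all_reals all_analysis.
From mathcomp Require Import complex.

Set Implicit Arguments.
Unset Strict Implicit.
Unset Printing Implicit Defensive.

Import Order.TTheory GRing.Theory Num.Theory.
Import numFieldNormedType.Exports.

Local Open Scope ring_scope.
Local Open Scope classical_set_scope.
Local Open Scope complex_scope.

Section ComplexFunctions.
Context {dsp : measure_display} {T : measurableType dsp} {R : realType}.

(* Functions are understood up to null sets, so membership in a function space
   only asks for agreement almost everywhere on [A] with a measurable function;
   for the Lebesgue measure this is exactly Lebesgue measurability on [A]. *)
Definition ae_measurable (mu : {measure set T -> \bar R}) (A : set T)
    (f : T -> R[i]) : Prop :=
  exists h : T -> R[i],
    [/\ measurable_fun A (fun x => complex.Re (h x)),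
        measurable_fun A (fun x => complex.Im (h x)) &
        {ae mu, forall x, A x -> f x = h x}].

Definition cintegral (mu : {measure set T -> \bar R}) (A : set T)
    (f : T -> R[i]) : R[i] :=
  Rintegral mu A (fun x => complex.Re (f x)) +i*
  Rintegral mu A (fun x => complex.Im (f x)).

Definition sqnorm (z : R[i]) : R := complex.Re z ^+ 2 + complex.Im z ^+ 2.

End ComplexFunctions.

Section MonotonicSchwartz.
Context {R : realType}.

Definition smooth (w : R -> R) : Prop :=
  forall (n : nat) (x : R), derivable (derive1n n w) x 1.

Definition schwartz (w : R -> R) : Prop :=
  smooth w /\
  forall a b : nat, exists M : R, forall x : R, `|x ^+ a * derive1n b w x| <= M.

Definition schwartz_mon_pos (w : R -> R) : Prop :=
  [/\ schwartz w,
      forall x, 0 < w x &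
      exists2 K : R, 0 < K &
        forall x, x \notin `[- K, K] -> x * derive1 w x <= 0].

End MonotonicSchwartz.

Section Sobolev.
Context {R : realType}.

Local Notation leb := (@lebesgue_measure R).

Definition test_fun (p : R -> R) : Prop :=
  smooth p /\ exists M : R, forall x, M < `|x| -> p x = 0.

Definition periodic_test_fun (p : R -> R) : Prop :=
  smooth p /\ forall x, p (x + 2 * pi) = p x.

Definition loc_integrable (f : R -> R[i]) : Prop :=
  ae_measurable leb setT f /\
  forall K : set R, compact K ->
    (\int[leb]_(x in K) (Num.sqrt (sqnorm (f x)))%:E < +oo)%E.

(* the torus is represented by the open interval (0, 2 pi), as its one missing
   point is negligible *)
Definition torus : set R := `]0, 2 * pi[.

Definition torus_integrable (f : R -> R[i]) : Prop :=
  ae_measurable leb torus f /\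
  (\int[leb]_(x in torus) (Num.sqrt (sqnorm (f x)))%:E < +oo)%E.

(* the set of (representatives of) the weak derivatives of order k of f *)
Definition weak_derivs_line (k : nat) (f : R -> R[i]) : set (R -> R[i]) :=
  [set g | [/\ loc_integrable f, loc_integrable g &
    forall p, test_fun p ->
      cintegral leb setT (fun x => f x * (derive1n k p x)%:C) =
      (-1) ^+ k * cintegral leb setT (fun x => g x * (p x)%:C)]].

Definition weak_derivs_torus (k : nat) (f : R -> R[i]) : set (R -> R[i]) :=
  [set g | [/\ torus_integrable f, torus_integrable g &
    forall p, periodic_test_fun p ->
      cintegral leb torus (fun x => f x * (derive1n k p x)%:C) =
      (-1) ^+ k * cintegral leb torus (fun x => g x * (p x)%:C)]].

(* The line and the torus are treated at once: [A] is the domain, [w] the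
   weight, [wd] one of the two notions of weak derivative. *)
Section Generic.
Variables (A : set R) (w : R -> R).
Variable wd : nat -> (R -> R[i]) -> set (R -> R[i]).

(* a representative of the weak derivative (0 if there is none) *)
Definition weak_deriv (k : nat) (f : R -> R[i]) : R -> R[i] :=
  xget (fun=> 0) (wd k f).

Definition sobolev (alpha : nat) : set (R -> R[i]) :=
  [set f | (forall k, (k <= alpha)%N -> wd k f !=set0) /\
    (\sum_(k < alpha.+1)
       \int[leb]_(x in A) (sqnorm (weak_deriv k f x) * w x)%:E < +oo)%E].

Definition sobolev_inner (alpha : nat) (f g : R -> R[i]) : R[i] :=
  \sum_(k < alpha.+1)
    cintegral leb A
      (fun x => weak_deriv k f x * (weak_deriv k g x)^* * (w x)%:C).

End Generic.
End Sobolev.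

Section LebesgueTuple.
Context {R : realType}.

Definition cons_pair (n : nat) (p : R * n.-tuple R) : n.+1.-tuple R :=
  [tuple of p.1 :: p.2].

Lemma measurable_cons_pair (n : nat) :
  measurable_fun [set: R * n.-tuple R] (@cons_pair n).
Proof. exact: measurable_cons. Qed.

Section Cons.
Variables (n : nat) (mu : {measure set (n.-tuple R) -> \bar R}).

Definition lebesgue_cons : set (n.+1.-tuple R) -> \bar R :=
  pushforward (@lebesgue_measure R \x^ mu)%E (@cons_pair n).

Let mf := @measurable_cons_pair n.

Let lebesgue_cons0 : lebesgue_cons set0 = 0%E.
Proof. exact: measure0. Qed.

Let lebesgue_cons_ge0 A : (0 <= lebesgue_cons A)%E.
Proof. exact: measure_ge0. Qed.

Let lebesgue_cons_sigma_additive : semi_sigma_additive lebesgue_cons.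
Proof. exact: measure_semi_sigma_additive. Qed.

HB.instance Definition _ := isMeasure.Build _ _ _ lebesgue_cons
  lebesgue_cons0 lebesgue_cons_ge0 lebesgue_cons_sigma_additive.

End Cons.

Fixpoint lebesgue_tuple (n : nat) : {measure set (n.-tuple R) -> \bar R} :=
  match n return {measure set (n.-tuple R) -> \bar R} with
  | 0 => \d_([tuple] : 0.-tuple R)
  | m.+1 => lebesgue_cons (lebesgue_tuple m)
  end.

End LebesgueTuple.

Section HilbertTensor.
Context {R : realType} (d : nat).

(* The factors are spaces [H j] of functions of one variable, with inner
   products [ip j]. An element of their algebraic tensor product is a finite
   sum of elementary tensors, given by the list of these tensors (scalars can
   be absorbed in a factor since d > 0). *)
Definition tensor_sum : Type := seq ('I_d -> R -> R[i]).

Definition in_alg_tensor (H : 'I_d -> set (R -> R[i])) (F : tensor_sum) : Prop :=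
  forall s, s \in F -> forall j, H j (s j).

Definition tensor_fun (F : tensor_sum) (x : d.-tuple R) : R[i] :=
  \sum_(s <- F) \prod_(j < d) s j (tnth x j).

Definition tensor_inner (ip : 'I_d -> (R -> R[i]) -> (R -> R[i]) -> R[i])
    (F G : tensor_sum) : R[i] :=
  \sum_(s <- F) \sum_(t <- G) \prod_(j < d) ip j (s j) (t j).

(* || F - G ||^2 *)
Definition tensor_dist2 (ip : 'I_d -> (R -> R[i]) -> (R -> R[i]) -> R[i])
    (F G : tensor_sum) : R :=
  complex.Re (tensor_inner ip F F - tensor_inner ip F G
              - tensor_inner ip G F + tensor_inner ip G G).

Definition tensor_cauchy (ip : 'I_d -> (R -> R[i]) -> (R -> R[i]) -> R[i])
    (F : nat -> tensor_sum) : Prop :=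
  forall e : R, 0 < e -> exists N : nat, forall m n : nat,
    (N <= m)%N -> (N <= n)%N -> tensor_dist2 ip (F m) (F n) < e.

(* The completion of the algebraic tensor product, i.e. the Cauchy sequences
   for the tensor norm, whose elements are identified with functions on the
   product domain [D]: every factor is continuously embedded in a weighted L^2
   space, hence so is the completion in the L^2 space of the product domain
   with the product weight [w]; the function of a Cauchy sequence is its limit
   there. *)
Definition hilbert_tensor (H : 'I_d -> set (R -> R[i]))
    (ip : 'I_d -> (R -> R[i]) -> (R -> R[i]) -> R[i])
    (D : set (d.-tuple R)) (w : d.-tuple R -> R) : set (d.-tuple R -> R[i]) :=
  [set f | ae_measurable (lebesgue_tuple d) D f /\
    exists F : nat -> tensor_sum,
      [/\ forall n, in_alg_tensor H (F n),
          tensor_cauchy ip F &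
          (fun n => \int[lebesgue_tuple d]_(x in D)
             (sqnorm (f x - tensor_fun (F n) x) * w x)%:E)%E
            @ \oo --> (0 : \bar R)]].

Definition prod_weight (rho : 'I_d -> R -> R) (x : d.-tuple R) : R :=
  \prod_(k < d) rho k (tnth x k).

Definition sobolev_tensor_line (alpha : nat) (rho : 'I_d -> R -> R) :
    set (d.-tuple R -> R[i]) :=
  hilbert_tensor
    (fun j => sobolev setT (rho j) weak_derivs_line alpha)
    (fun j => sobolev_inner setT (rho j) weak_derivs_line alpha)
    setT (prod_weight rho).

Definition torus_box : set (d.-tuple R) :=
  [set t | forall k, torus (tnth t k)].

(* only the values on (0, 2 pi)^d matter *)
Definition sobolev_tensor_torus (alpha : nat) : set (d.-tuple R -> R[i]) :=
  hilbert_tensor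
    (fun=> sobolev torus (fun=> 1) weak_derivs_torus alpha)
    (fun=> sobolev_inner torus (fun=> 1) weak_derivs_torus alpha)
    torus_box (fun=> 1).

Definition moebius (c : 'I_d -> R) (t : d.-tuple R) : d.-tuple R :=
  [tuple c k * (cos (tnth t k / 2) / sin (tnth t k / 2)) | k < d].

End HilbertTensor.

(* the derivative of t |-> - cot (t / 2) *)
Definition dphi {R : realType} (t : R) : R := 1 / (2 * sin (t / 2) ^+ 2).

(* Main.v *)
Require Import Defs.
From HB Require Import structures.
From mathcomp Require Import all_boot all_order all_algebra.
From mathcomp Require Import all_classical all_reals all_analysis.
From mathcomp Require Import measurable_realfun complex ring lra.

(** In one variable, let [x = c cot (t / 2)], so that [dx / dt = - q(x)] with the
    polynomial [q(x) = (c ^ 2 + x ^ 2) / (2 c)] ([quad]). The transform sends a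
    function [u] on the line to [t |-> (u rho q)(x)] on the torus. Every
    derivative in [t] is [- q] times a derivative in [x], so the derivative of
    order [tau] of the transform is a sum of terms [(u^(k) A q)(x)] with [k <= tau],
    where the coefficients [A] arise from [rho] by derivations and
    multiplications by polynomials ([coef]). As [dt = dx / q], the square of such
    a term has the integral [int |u^(k)| ^ 2 A ^ 2 q dx], which the energy of [u]
    controls if [A ^ 2 q <= C rho] ([admissible_bound]). So all derivatives of
    [rho], times polynomials, have to be of the size of [sqrt rho]
    ([admissible_weight]). Rapid decrease would not give this; monotonicity does:
    where [rho] decreases, the supremum of [rho] beyond [x] is [rho x], and
    interpolating between this and bounds for high derivatives bounds the
    squares of all derivatives by [rho ^ (3/2)]
    ([decreasing_derive1n_bound]), while [sqrt rho] beats every polynomial.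

    These formal derivatives are the weak ones ([torus_weak_derivative]): a
    periodic test function becomes a function on the line without compact
    support, but the decay of the coefficients permits integration by parts
    through cutoffs ([weak_integration_by_parts]). Since energies are defined
    through arbitrary representatives of the weak derivatives, the uniqueness of
    weak derivatives is also used, on the line and on the torus
    ([line_uniqueness], [torus_uniqueness]). So the transform is a bounded
    operator between the one-dimensional spaces.

    A tensor product of bounded operators is bounded. Here the norms are given
    by Gram matrices, and for each factor the bound says that [C] times the Gram
    matrix of some functions minus the Gram matrix of their transforms is
    positive semidefinite ([transform_gram_bound]). Hadamard products with Gram
    matrices preserve positivity, so these bounds multiply ([psd_prod_sub]). Hence
    the transform turns a Cauchy sequence of sums of elementary tensors into a
    Cauchy sequence ([tensor_transform_bound]). Its limit is the function [g]: as
    [rho q] is bounded in each variable, the change of variables bounds the [L^2]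
    distance on the torus by the weighted one ([tensor_transform_cvg]). *)

Set Implicit Arguments.
Unset Strict Implicit.
Unset Printing Implicit Defensive.

Import Order.TTheory GRing.Theory Num.Theory.
Import numFieldNormedType.Exports.

Local Open Scope ring_scope.
Local Open Scope classical_set_scope.

Local Notation "f ^` ()" := (derive1 f) : ring_scope.

(** * Smooth functions of one real variable *)

Section SmoothFunctions.
Context {R : realType}.
Implicit Types (f g : R -> R) (x k : R).

Lemma derive1_eq f x l : is_derive x 1 f l -> f^`() x = l.
Proof. by move=> fl; rewrite derive1E derive_val. Qed.

Lemma is_derive1_derive1 f x : derivable f x 1 -> is_derive x 1 f (f^`() x).
Proof. by move=> df; rewrite derive1E; exact: derivableP. Qed.

Lemma derivable_of_is_derive f x l : is_derive x 1 f l -> derivable f x 1.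
Proof. by case. Qed.

Lemma is_derive_add f g x a b : is_derive x 1 f a -> is_derive x 1 g b ->
  is_derive x 1 (fun y => f y + g y) (a + b).
Proof. by move=> fa gb; exact: is_deriveD. Qed.

Lemma is_derive_mul f g x a b : is_derive x 1 f a -> is_derive x 1 g b ->
  is_derive x 1 (fun y => f y * g y) (a * g x + f x * b).
Proof.
move=> fa gb; have := is_deriveM fa gb.
by move=> H; apply: is_derive_eq H _; rewrite /GRing.scale/=; ring.
Qed.

Lemma is_derive_comp f g x a b : is_derive (g x) 1 f a -> is_derive x 1 g b ->
  is_derive x 1 (fun y => f (g y)) (a * b).
Proof. by move=> fa gb; exact: is_derive1_comp. Qed.

Lemma is_derive_inv f x a : f x != 0 -> is_derive x 1 f a ->
  is_derive x 1 (fun y => (f y)^-1) (- (a * (f x)^-1 * (f x)^-1)).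
Proof.
move=> f0 fa; have := is_deriveV f0 fa.
move=> H; apply: is_derive_eq H _; rewrite /GRing.scale/=.
by field.
Qed.

Lemma is_derive_const (k x : R) : is_derive x 1 (fun=> k) 0.
Proof. exact: is_derive_cst. Qed.

(** The derivative of order [n.+1] of [f] is that of order [n] of [f^`()]: in
    this form of differentiability the closure under products, composites and
    inverses follows by induction on the order, for all functions at once. *)
Fixpoint ndiff (n : nat) f : Prop :=
  if n is m.+1 then (forall x, derivable f x 1) /\ ndiff m f^`() else True.

Lemma smooth_ndiff f : smooth f <-> forall n, ndiff n f.
Proof.
split.
  move=> sf n; elim: n f sf => //= n IH f sf; split; first exact: (sf 0%N).
  by apply: IH => m x; have := sf m.+1 x; rewrite /derive1n iterSr.
move=> H n; elim: n f H => [|n IH] f H x; first exact: (H 1%N).1.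
rewrite /derive1n iterSr; apply: IH => m.
exact: (H m.+1).2.
Qed.

Lemma ndiffW n f : ndiff n.+1 f -> ndiff n f.
Proof. by elim: n f => //= n IH f [? ?]; split => //; apply: IH. Qed.

Lemma ndiff_cst n k : ndiff n (fun=> k : R).
Proof.
elim: n k => //= n IH k; split; first by move=> x; exact: derivable_cst.
by rewrite (_ : derive1 _ = fun=> 0) //; apply/funext => x; exact: derive1_cst.
Qed.

Lemma ndiffD n f g : ndiff n f -> ndiff n g -> ndiff n (fun x => f x + g x).
Proof.
elim: n f g => //= n IH f g [df nf] [dg ng].
have D x : is_derive x 1 (fun x => f x + g x) (f^`() x + g^`() x).
  by apply: is_derive_add; exact: is_derive1_derive1.
split; first by move=> x; exact: derivable_of_is_derive (D x).
by rewrite (_ : derive1 _ = fun x => f^`() x + g^`() x);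
  [exact: IH | apply/funext => x; exact: derive1_eq].
Qed.

Lemma ndiffM n f g : ndiff n f -> ndiff n g -> ndiff n (fun x => f x * g x).
Proof.
elim: n f g => // n IH f g nf ng.
have [df nf'] := nf; have [dg ng'] := ng.
have D x : is_derive x 1 (fun x => f x * g x) (f^`() x * g x + f x * g^`() x).
  by apply: is_derive_mul; exact: is_derive1_derive1.
split; first by move=> x; exact: derivable_of_is_derive (D x).
rewrite (_ : derive1 _ = fun x => f^`() x * g x + f x * g^`() x).
  by apply: ndiffD; apply: IH => //; exact: ndiffW.
by apply/funext => x; exact: derive1_eq.
Qed.

Lemma ndiff_comp n f g : ndiff n f -> ndiff n g -> ndiff n (fun x => f (g x)).
Proof.
elim: n f g => // n IH f g nf ng.
have [df nf'] := nf; have [dg ng'] := ng.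
have D x : is_derive x 1 (fun x => f (g x)) (f^`() (g x) * g^`() x).
  by apply: is_derive_comp; exact: is_derive1_derive1.
split; first by move=> x; exact: derivable_of_is_derive (D x).
rewrite (_ : derive1 _ = fun x => f^`() (g x) * g^`() x).
  by apply: ndiffM => //; apply: IH => //; exact: ndiffW.
by apply/funext => x; exact: derive1_eq.
Qed.

Lemma ndiffV n f : (forall x, f x != 0) -> ndiff n f ->
  ndiff n (fun x => (f x)^-1).
Proof.
move=> f0; elim: n => // n IH nf.
have [df nf'] := nf.
have D x : is_derive x 1 (fun x => (f x)^-1)
    (-1 * (f^`() x * (f x)^-1 * (f x)^-1)).
  rewrite mulN1r; apply: is_derive_inv => //.
  exact: is_derive1_derive1.
split; first by move=> x; exact: derivable_of_is_derive (D x).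
rewrite (_ : derive1 _ = fun x => -1 * (f^`() x * (f x)^-1 * (f x)^-1)).
  have fV := IH (ndiffW nf).
  apply: ndiffM; first exact: ndiff_cst.
  by apply: ndiffM => //; apply: ndiffM.
by apply/funext => x; exact: derive1_eq.
Qed.

Lemma smooth_cst (k : R) : smooth (fun=> k : R).
Proof. by apply/smooth_ndiff => n; exact: ndiff_cst. Qed.

Lemma smoothD f g : smooth f -> smooth g -> smooth (fun x => f x + g x).
Proof.
by move=> /smooth_ndiff sf /smooth_ndiff sg; apply/smooth_ndiff => n;
  exact: ndiffD.
Qed.

Lemma smoothM f g : smooth f -> smooth g -> smooth (fun x => f x * g x).
Proof.
by move=> /smooth_ndiff sf /smooth_ndiff sg; apply/smooth_ndiff => n;
  exact: ndiffM.
Qed.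

Lemma smooth_comp f g : smooth f -> smooth g -> smooth (fun x => f (g x)).
Proof.
by move=> /smooth_ndiff sf /smooth_ndiff sg; apply/smooth_ndiff => n;
  exact: ndiff_comp.
Qed.

Lemma smoothV f : (forall x, f x != 0) -> smooth f -> smooth (fun x => (f x)^-1).
Proof.
by move=> f0 /smooth_ndiff sf; apply/smooth_ndiff => n; exact: ndiffV.
Qed.

Lemma smoothP f : smooth f <-> (forall x, derivable f x 1) /\ smooth f^`().
Proof.
split; first move=> sf.
  split; first exact: (sf 0%N).
  by move=> n x; have := sf n.+1 x; rewrite /derive1n iterSr.
move=> [df sf] [|n] x; first exact: df.
by rewrite /derive1n iterSr; exact: sf.
Qed.

Lemma smooth_derivable f x : smooth f -> derivable f x 1.
Proof. by case/smoothP => + _; apply. Qed.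

Lemma smooth_is_derive f x : smooth f -> is_derive x 1 f (f^`() x).
Proof. by move=> sf; exact/is_derive1_derive1/smooth_derivable. Qed.

Lemma smooth_derive1 f : smooth f -> smooth f^`().
Proof. by case/smoothP. Qed.

Lemma smooth_derive1n n f : smooth f -> smooth (derive1n n f).
Proof.
elim: n => [|n IH] sf; first exact: sf.
by rewrite derive1nS; apply: smooth_derive1; exact: IH.
Qed.

Lemma smooth_of_is_derive f g : (forall x, is_derive x 1 f (g x)) ->
  smooth g -> smooth f.
Proof.
move=> D sg; apply/smoothP; split.
  by move=> x; exact: derivable_of_is_derive (D x).
by rewrite (_ : f^`() = g) //; apply/funext => x; exact: derive1_eq.
Qed.

(** Used when the derivatives of all orders share a parametrized form but have
    no convenient closed formula. *)
Lemma smooth_stable (P : (R -> R) -> Prop) :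
  (forall f, P f -> (forall x, derivable f x 1) /\ P f^`()) ->
  forall f, P f -> smooth f.
Proof.
move=> HP f Pf n; suff: P (derive1n n f) by move/HP => [].
by elim: n => //= n /HP[].
Qed.

Lemma smooth_id : smooth (fun x : R => x).
Proof.
by apply: (@smooth_of_is_derive _ (fun=> 1)); exact: smooth_cst.
Qed.

Lemma smoothZ (k : R) f : smooth f -> smooth (fun x => k * f x).
Proof. by move=> sf; exact: (smoothM (@smooth_cst k) sf). Qed.

Lemma smoothN f : smooth f -> smooth (fun x => - f x).
Proof.
move=> sf; have := @smoothZ (-1) f sf.
by under eq_fun do rewrite mulN1r.
Qed.

Lemma smoothB f g : smooth f -> smooth g -> smooth (fun x => f x - g x).
Proof. by move=> sf sg; exact: (smoothD sf (smoothN sg)). Qed.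

Lemma smooth_sin : smooth (@sin R).
Proof.
pose P := fun f : R -> R => exists a b : R, f = fun x => a * cos x + b * sin x.
apply: (@smooth_stable P); last by exists 0, 1; apply/funext => x; ring.
move=> _ [a [b ->]].
have D (x : R) : is_derive x 1 (fun x => a * cos x + b * sin x)
    (b * cos x + - a * sin x).
  have := is_derive_add (is_derive_mul (is_derive_const a x) (is_derive_cos x))
    (is_derive_mul (is_derive_const b x) (is_derive_sin x)).
  by move/is_derive_eq; apply; ring.
split; first by move=> x; exact: derivable_of_is_derive (D x).
by exists b, (- a); apply/funext => x; exact: derive1_eq.
Qed.

Lemma smooth_atan : smooth (@atan R).
Proof.
apply: (@smooth_of_is_derive _ (fun x => (1 + x ^+ 2)^-1)).
apply: smoothV.
  by move=> x; rewrite gt_eqF // ltr_pwDl // sqr_ge0.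
apply: smoothD; first exact: smooth_cst.
by apply: (smoothM smooth_id smooth_id).
Qed.

Lemma smooth_continuous f : smooth f -> continuous f.
Proof.
move=> sf x; apply: differentiable_continuous.
by apply/derivable1_diffP; exact: smooth_derivable.
Qed.

Lemma smooth_measurable f D : smooth f -> measurable_fun D f.
Proof.
move=> sf; apply: measurable_funTS; apply: continuous_measurable_fun.
exact: smooth_continuous.
Qed.

Lemma derive1_add f g : smooth f -> smooth g ->
  (fun x => f x + g x)^`() = fun x => f^`() x + g^`() x.
Proof.
move=> sf sg; apply/funext => x; apply: derive1_eq.
by apply: is_derive_add; exact: smooth_is_derive.
Qed.

Lemma derive1_mul f g : smooth f -> smooth g ->
  (fun x => f x * g x)^`() = fun x => f^`() x * g x + f x * g^`() x.
Proof.
move=> sf sg; apply/funext => x; apply: derive1_eq.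
by apply: is_derive_mul; exact: smooth_is_derive.
Qed.

Lemma derive1_comp_fun f g : smooth f -> smooth g ->
  (fun x => f (g x))^`() = fun x => f^`() (g x) * g^`() x.
Proof.
move=> sf sg; apply/funext => x; apply: derive1_eq.
by apply: is_derive_comp; exact: smooth_is_derive.
Qed.

Lemma derive1_id : (fun x : R => x)^`() = fun=> 1.
Proof. by apply/funext => x; apply: derive1_eq; exact: is_derive_id. Qed.

Lemma derive1_const (k : R) : (fun _ : R => k)^`() = fun=> 0.
Proof. by apply/funext => x; exact: derive1_cst. Qed.

End SmoothFunctions.

Arguments smooth_cst {R} k.
Arguments smoothZ {R} k [f].
Arguments smooth_derive1n {R} n [f].
Arguments smooth_is_derive {R} [f] x.

(** * A smooth function that vanishes to infinite order *)

Section FlatFunction.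
Context {R : realType}.

(** At the junction of the two cases in the definition of [flat] the derivative
    has to be taken from the difference quotient. *)
Lemma is_derive_quadratic (f : R -> R) (C : R) :
  (forall h, `|f h| <= C * h ^+ 2) -> is_derive (0 : R) 1 f 0.
Proof.
move=> fC.
have f0 : f 0 = 0.
  by apply/eqP; rewrite -normr_le0 (le_trans (fC 0)) // expr0n mulr0.
suff L : (h^-1 *: ((f \o shift 0) (h *: (1 : R)) - f 0)) @[h --> (0 : R)^'] --> (0 : R).
  apply: DeriveDef; last exact: cvg_lim L.
  by apply/cvg_ex; exists 0.
have cv (k : R) : (k * `|h|) @[h --> (0 : R)^'] --> (0 : R).
  have L0 : (k * `|h|) @[h --> (0 : R)] --> k * `|0 : R|.
    by apply: cvgMl_tmp; apply: cvg_norm; exact: cvg_id.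
  rewrite normr0 mulr0 in L0.
  by apply: cvg_trans L0; apply: cvg_app; exact: nbhs_dnbhs.
apply: (@squeeze_cvgr _ _ _ _ (fun h => - C * `|h|) (fun h => C * `|h|)) => //.
near=> h.
have h0 : h != 0 by near: h; exact: nbhs_dnbhs_neq.
rewrite /= f0 subr0 addr0 /GRing.scale /= mulr1 mulNr -ler_norml.
rewrite normrM normfV ler_pdivrMl ?normr_gt0 //.
by rewrite (le_trans (fC h)) // -real_normK ?num_real // expr2; lra.
Unshelve. all: by end_near. Qed.

(** Applied at [y = x^-1], where the right-hand side is quadratic in [x]. The
    induction on [p] is for all exponents of an additional factor [y ^+ n]. *)
Lemma expR_beats_poly (p : {poly R}) :
  exists C : R, forall y, 0 < y -> `|p.[y]| * expR (- y) <= C / y ^+ 2.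
Proof.
have mono n : exists C : R, forall y : R, 0 < y -> y ^+ n * expR (- y) <= C / y ^+ 2.
  exists (n.+2)`!%:R => y y0.
  rewrite ler_pdivlMr ?exprn_gt0 // expRN mulrAC -exprD addn2.
  rewrite ler_pdivrMr ?expR_gt0 // mulrC -ler_pdivrMr ?ltr0n ?fact_gt0 //.
  by apply: le_trans (expR_ge1Dxn n.+1 (ltW y0)); rewrite lerDr.
suff H : forall n, exists C : R, forall y, 0 < y ->
    `|p.[y]| * y ^+ n * expR (- y) <= C / y ^+ 2.
  have [C HC] := H 0%N; exists C => y /HC.
  by rewrite expr0 mulr1.
elim/poly_ind: p => [|p b IH] n.
  by exists 0 => y y0; rewrite horner0 normr0 !mul0r.
have [C HC] := IH n.+1; have [D HD] := mono n.
exists (C + `|b| * D) => y y0.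
rewrite hornerMXaddC.
have H2 := HC y y0; have H1 := HD y y0.
have H3 : `|b| * (y ^+ n * expR (- y)) <= `|b| * (D / y ^+ 2) by rewrite ler_wpM2l.
rewrite [leRHS](_ : _ = C / y ^+ 2 + `|b| * (D / y ^+ 2)); last by ring.
apply: le_trans (lerD H2 H3).
rewrite [leRHS](_ : _ = (`|p.[y]| * y + `|b|) * (y ^+ n * expR (- y))); last first.
  by rewrite exprS; ring.
rewrite -mulrA.
rewrite ler_wpM2r ?mulr_ge0 ?exprn_ge0 ?expR_ge0 ?(ltW y0) //.
by rewrite (le_trans (ler_normD _ _)) // normrM (gtr0_norm y0).
Qed.

(** All the cutoff functions below are built from [flat]. *)
Definition flat (x : R) : R := if 0 < x then expR (- x^-1) else 0.

Lemma smooth_flat : smooth flat.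
Proof.
pose F (p : {poly R}) (x : R) := if 0 < x then p.[x^-1] * expR (- x^-1) else 0.
pose P := fun f : R -> R => exists p, f = F p.
apply: (@smooth_stable _ P); last first.
  by exists 1; apply/funext => x; rewrite /flat /F hornerC mul1r.
move=> _ [p ->].
(* the derivative of [p.[x^-1] * expR (- x^-1)] is [p'.[x^-1] * expR (- x^-1)] *)
pose p' := ('X^2 * (p - deriv p)).
suff D (x : R) : is_derive x 1 (F p) (F p' x).
  split; first by move=> x; exact: derivable_of_is_derive (D x).
  by exists p'; apply/funext => x; exact: derive1_eq.
have [x0|x0|->] := ltgtP x 0.
- rewrite {2}/F ltNge ltW //=.
  refine (near_eq_is_derive _ (is_derive_const 0 x)).
  near=> y; rewrite /F ltNge ltW //.
  by near: y; exact: lt_nbhsl.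
- rewrite {2}/F x0.
  have xV : is_derive x 1 (fun y : R => y^-1) (- (1 * x^-1 * x^-1)).
    by apply: is_derive_inv; rewrite ?gt_eqF.
  have pV := @is_derive_comp _ (horner p) (fun y => y^-1) x _ _
    (is_derive_poly p x^-1) xV.
  have eV := @is_derive_comp _ expR (fun y => - y^-1) x _ _
    (is_derive_expR _) (is_deriveN xV).
  have D := is_derive_mul pV eV.
  apply: (@is_derive_eq _ _ _ _ _ _ _ _ (near_eq_is_derive _ D)).
    near=> y; rewrite /F ifT //.
    by near: y; exact: lt_nbhsr.
  rewrite /p' hornerM hornerXn hornerD hornerN; field.
  by rewrite gt_eqF.
- rewrite {2}/F ltxx.
  have [C HC] := expR_beats_poly p.
  apply: (@is_derive_quadratic _ `|C|) => h; rewrite /F.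
  case: ifPn => [h0|_]; last by rewrite normr0 mulr_ge0 // sqr_ge0.
  rewrite normrM (ger0_norm (expR_ge0 _)).
  have hV : 0 < h^-1 by rewrite invr_gt0.
  rewrite (le_trans (HC _ hV)) // exprVn invrK ler_wpM2r ?sqr_ge0 //.
  exact: ler_norm.
Unshelve. all: by end_near. Qed.

Lemma flat_ge0 x : 0 <= flat x.
Proof. by rewrite /flat; case: ifP => // _; exact: expR_ge0. Qed.

Lemma flat_le1 x : flat x <= 1.
Proof.
rewrite /flat; case: ifP => // x0.
by rewrite -[leRHS]expR0 ler_expR oppr_le0 invr_ge0 ltW.
Qed.

Lemma flat_gt0 x : 0 < x -> 0 < flat x.
Proof. by rewrite /flat => ->; exact: expR_gt0. Qed.

Lemma flat_le0 x : x <= 0 -> flat x = 0.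
Proof. by rewrite /flat ltNge => ->. Qed.

Lemma flat_cvg1 x : 0 < x -> flat (n.+1%:R * x) @[n --> \oo] --> (1 : R).
Proof.
move=> x0.
rewrite (_ : (fun n => _) = (fun n => expR (- (harmonic n * x^-1)))); last first.
  apply/funext => n; rewrite /flat mulr_gt0 // ?ltr0n //.
  by rewrite invfM.
rewrite -[X in _ --> X]expR0 -oppr0 -(mul0r x^-1).
apply: continuous_cvg; first exact: continuous_expR.
by apply: cvgN; apply: cvgMr_tmp; exact: cvg_harmonic.
Qed.

End FlatFunction.

(** * Derivatives of a decreasing function *)

Section Interpolation.
Context {R : realType}.

(** If every term of a finite sequence is controlled by its two neighbours with
    an arbitrarily small weight on the later one, all terms are controlled by
    the first and the last one. *)
Lemma interpolation_step (n : nat) : exists2 C : R, 1 <= C &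
  forall T : nat -> R, (forall j, 0 <= T j) ->
  (forall e j, 0 < e -> T j.+1 <= 2 / e * T j + e * T j.+2) ->
  forall j, (j <= n)%N -> T j <= C * (T 0%N + T n).
Proof.
elim: n => [|n [C C1 HC]].
  exists 1 => // T T0 _ j; rewrite leqn0 => /eqP ->.
  by rewrite mul1r lerDl.
case: n HC => [_|n HC].
  exists 1 => // T T0 _ [|[|//]] _; rewrite mul1r ?lerDl ?lerDr; exact: T0.
exists (8 * C ^+ 2 + 2 * C + 8 * C) => [|T T0 HT j jn]; first by nra.
have Cp : 0 < C by lra.
(* with the weight [4 * C] the term in [T n] gives back at most half of
   [T n.+1], which is absorbed *)
have Tn : T n.+1 <= T 0%N + 8 * C * T n.+2.
  have H1 := HC T T0 HT n (leqnSn n).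
  have H2 := HT (4 * C) n; rewrite mulr_gt0 // in H2; move/(_ isT) in H2.
  have H3 : 2 / (4 * C) * T n <= 2^-1 * (T 0%N + T n.+1).
    rewrite (_ : 2 / (4 * C) = 2^-1 * C^-1); last by field; rewrite gt_eqF.
    rewrite -mulrA ler_wpM2l ?invr_ge0 // ler_pdivrMl //.
  by lra.
have T0' := T0 0%N; have Tn' := T0 n.+2; have C2 := sqr_ge0 C.
have [->|jn'] := eqVneq j n.+2; first by nra.
have {}jn' : (j <= n.+1)%N by rewrite -ltnS ltn_neqAle jn'.
have H := HC T T0 HT j jn'.
have : C * (T 0%N + T n.+1) <= C * (T 0%N + (T 0%N + 8 * C * T n.+2)).
  by apply: ler_wpM2l; lra.
have : C * (T 0%N + (T 0%N + 8 * C * T n.+2)) <=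
  (8 * C ^+ 2 + 2 * C + 8 * C) * (T 0%N + T n.+2) by nra.
lra.
Qed.

Lemma mvt_smooth (f : R -> R) (a b : R) : smooth f -> a < b ->
  exists2 c, a < c < b & f b - f a = f^`() c * (b - a).
Proof.
move=> sf ab.
have [|c] := @MVT _ f f^`() a b ab (fun x _ => smooth_is_derive x sf).
  by apply: continuous_subspaceT; exact: smooth_continuous.
by rewrite in_itv /= => cab E; exists c.
Qed.

(** Landau's argument: by the mean value theorem the derivative of order [j.+1]
    is at most [2 / h * S j] at some point of [[y, y + h]], and going back to
    [y] costs at most [h * S j.+2]. *)
Lemma derivative_interpolation (f : R -> R) (S : nat -> R) (x h : R) :
  smooth f -> (forall j y, x <= y -> `|derive1n j f y| <= S j) ->
  0 < h -> forall j y, x <= y ->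
  `|derive1n j.+1 f y| <= 2 / h * S j + h * S j.+2.
Proof.
move=> sf HS h0 j y xy.
have yh : y < y + h by rewrite ltrDl.
have [c /andP[yc ch] Ec] := mvt_smooth (smooth_derive1n j sf) yh.
have [c' /andP[yc' c'c] Ec'] := mvt_smooth (smooth_derive1n j.+1 sf) yc.
rewrite -!derive1nS in Ec Ec'.
have -> : derive1n j.+1 f y = derive1n j.+1 f c - derive1n j.+2 f c' * (c - y).
  by rewrite -Ec'; ring.
have xc' : x <= c' by rewrite (le_trans xy) // ltW.
have xyh : x <= y + h by rewrite (le_trans xy) // ltW.
rewrite (le_trans (ler_normB _ _)) // lerD //.
  rewrite mulrAC ler_pdivlMr // -[h in _ * h]gtr0_norm // -normrM.
  rewrite (_ : h = y + h - y) -?Ec; last by ring.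
  rewrite (le_trans (ler_normB _ _)) // mulrC mulr_natr mulr2n.
  by rewrite lerD // HS.
rewrite normrM mulrC ler_pM // ?HS //.
by rewrite gtr0_norm ?subr_gt0 //; lra.
Qed.

(** Along a half-line where [f] decreases, its supremum over a further half-line
    is its value at the end point; interpolating between this value and bounds
    for high derivatives, every derivative is almost as small as [f]. Instead
    of the exponent 2 that holds for [f] itself the exponent 3/2 is enough: the
    factor [Num.sqrt (f x)] is to absorb polynomials. *)
Lemma decreasing_derive1n_bound (f : R -> R) (a : R) :
  smooth f -> (forall j, exists M, forall x, `|derive1n j f x| <= M) ->
  (forall x, 0 < f x) -> (forall x y, a <= x -> x <= y -> f y <= f x) ->
  forall j, exists M, forall x, a <= x ->
    derive1n j f x ^+ 2 <= M * (f x * Num.sqrt (f x)).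
Proof.
move=> sf bf f0 df [|j].
  have [M HM] := bf 0%N; exists (Num.sqrt M) => x ax; rewrite derive1n0.
  rewrite expr2 mulrCA ler_wpM2l ?(ltW (f0 x)) //.
  rewrite -{1}[f x]sqr_sqrtr ?(ltW (f0 x)) // expr2 ler_wpM2r ?sqrtr_ge0 //.
  by apply: ler_wsqrtr; exact: le_trans (ler_norm _) (HM x).
(* this order makes the loss [h ^- (2 * j.+1)] below equal to [f x ^- (1/2)] *)
set n := (4 * j.+1)%N.
have [C C1 HC] := interpolation_step n.
have [M HM] := bf n.
exists ((C * (1 + M)) ^+ 2) => x ax.
have fx := f0 x.
pose s k := [set `|derive1n k f y| | y in [set y | x <= y]].
have ubs k : has_sup (s k).
  split; first by exists `|derive1n k f x|; exists x => //=.
  by have [B HB] := bf k; exists B => _ [y _ <-].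
pose S k := sup (s k).
have HS k y : x <= y -> `|derive1n k f y| <= S k.
  by move=> xy; apply: (ub_le_sup (ubs k).2); exists y.
have SM k B : (forall y, x <= y -> `|derive1n k f y| <= B) -> S k <= B.
  move=> H; apply: ge_sup; first exact: (ubs k).1.
  by move=> _ [y xy <-]; exact: H.
have S0 : S 0%N <= f x.
  by apply: SM => y xy; rewrite derive1n0 gtr0_norm //; exact: df.
have Sn : S n <= M by apply: SM => y _.
have Sge k : 0 <= S k by apply: le_trans (HS k x (lexx x)).
(* the scale at which the two ends of the interpolation balance: [h ^+ n = f x] *)
pose h := expR (ln (f x) / n%:R).
have h0 : 0 < h by exact: expR_gt0.
have hn : h ^+ n = f x.
  rewrite /h -expRM_natl mulrC divfK ?lnK ?posrE //.
  by rewrite pnatr_eq0.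
have H : h ^+ j.+1 * S j.+1 <= C * (S 0%N + h ^+ n * S n).
  have := HC (fun k => h ^+ k * S k); rewrite expr0 mul1r; apply.
  - by move=> k; rewrite mulr_ge0 // exprn_ge0 // ltW.
  - move=> e k e0.
    have eh : 0 < e * h by rewrite mulr_gt0.
    have := SM _ _ (fun y => @derivative_interpolation f S x _ sf HS eh k y).
    rewrite -(ler_pM2l (exprn_gt0 k.+1 h0)) => /le_trans; apply.
    rewrite le_eqVlt; apply/orP; left; apply/eqP; rewrite !exprS.
    by field; rewrite !gt_eqF.
  - by rewrite leq_pmull.
have {}H : h ^+ j.+1 * `|derive1n j.+1 f x| <= C * (1 + M) * f x.
  apply: (le_trans (ler_wpM2l (exprn_ge0 _ (ltW h0)) (HS _ x (lexx x)))).
  apply: le_trans H _; rewrite hn -mulrA ler_wpM2l //; first lra.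
  have : f x * S n <= f x * M by rewrite ler_wpM2l // ltW.
  by lra.
have q : h ^+ (2 * j.+1) = Num.sqrt (f x).
  rewrite -hn (_ : n = (2 * j.+1 * 2)%N); last by rewrite mulnAC.
  by rewrite [in RHS]exprM sqrtr_sqr ger0_norm // exprn_ge0 // ltW.
have q0 : 0 < Num.sqrt (f x) by rewrite sqrtr_gt0.
rewrite -(ler_pM2l q0) -{1}q (mulnC 2) exprM -(real_normK (num_real (derive1n j.+1 f x))).
rewrite -exprMn.
have H0 : 0 <= h ^+ j.+1 * `|derive1n j.+1 f x|.
  by rewrite mulr_ge0 // exprn_ge0 // ltW.
apply: (@le_trans _ _ ((C * (1 + M) * f x) ^+ 2)).
  by rewrite ler_pXn2r ?nnegrE //; exact: le_trans H0 H.
rewrite le_eqVlt; apply/orP; left; apply/eqP.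
rewrite [RHS]mulrCA [X in _ = _ * X]mulrCA -expr2 sqr_sqrtr ?ltW //.
by rewrite exprMn expr2.
Qed.

End Interpolation.

(** * Coefficients dominated by the square root of the weight *)

Section AdmissibleCoefficients.
Context {R : realType}.
Variable rho : R -> R.

(** The smooth functions whose derivatives, with any polynomial factor, are
    bounded by a multiple of [sqrt rho]. Multiplication by such a function maps
    the weighted [L^2] space into the unweighted one. The class is stable under
    derivation and multiplication by polynomials, so that it contains all the
    coefficients that arise when the transformed function is differentiated. *)
Definition admissible (A : R -> R) : Prop :=
  smooth A /\ forall a b : nat, exists M : R, forall x : R,
    (x ^+ a * derive1n b A x) ^+ 2 <= M * rho x.

Lemma admissibleD A B : admissible A -> admissible B ->
  admissible (fun x => A x + B x).
Proof.
move=> [sA HA] [sB HB]; split; first exact: smoothD.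
move=> a b; have [M HM] := HA a b; have [N HN] := HB a b.
exists (2 * M + 2 * N) => x.
suff -> : derive1n b (fun x => A x + B x) x = derive1n b A x + derive1n b B x.
  have := HM x; have := HN x; set u := x ^+ a; set v := derive1n _ _ _.
  set w := derive1n _ _ _ => H1 H2.
  have := sqr_ge0 (u * w - u * v); nra.
elim: b x {M N HM HN} => // b IH x.
rewrite !derive1nS (_ : derive1n b (fun x => A x + B x) =
  fun x => derive1n b A x + derive1n b B x); last exact/funext.
by rewrite (derive1_add (smooth_derive1n b sA) (smooth_derive1n b sB)).
Qed.

Lemma derive1nZ (b : nat) (k : R) (A : R -> R) : smooth A ->
  derive1n b (fun x => k * A x) = fun x => k * derive1n b A x.
Proof.
move=> sA; elim: b => // b IH.
rewrite !derive1nS IH (derive1_mul (smooth_cst k) (smooth_derive1n b sA)).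
by apply/funext => x; rewrite derive1_const mul0r add0r.
Qed.

Lemma admissibleZ k A : admissible A -> admissible (fun x => k * A x).
Proof.
move=> [sA HA]; split; first exact: smoothZ.
move=> a b; have [M HM] := HA a b; exists (k ^+ 2 * M) => x.
rewrite derive1nZ // mulrCA exprMn -mulrA.
by rewrite ler_wpM2l ?sqr_ge0.
Qed.

Lemma admissible_derive1 A : admissible A -> admissible A^`().
Proof.
move=> [sA HA]; split; first exact: smooth_derive1.
by move=> a b; have := HA a b.+1; rewrite /derive1n iterSr.
Qed.

Lemma derive1n_mulx (b : nat) (A : R -> R) : smooth A ->
  derive1n b (fun x => x * A x) =
  fun x => x * derive1n b A x + b%:R * derive1n b.-1 A x.
Proof.
move=> sA; elim: b => [|b IH].
  by apply/funext => x; rewrite mul0r addr0.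
have sn n := smooth_derive1n n sA.
rewrite derive1nS IH.
rewrite (derive1_add (smoothM smooth_id (sn b)) (smoothZ b%:R (sn b.-1))).
rewrite (derive1_mul smooth_id (sn b)) derive1_id.
rewrite (derive1_mul (smooth_cst _) (sn b.-1)) derive1_const.
apply/funext => x; rewrite -derive1nS mul0r add0r mul1r.
case: b {IH} => [|b]; first by rewrite mul0r addr0 mul1r addrC.
by rewrite -derive1nS -[b.+2%:R]natr1 /=; ring.
Qed.

Lemma admissible_mulx A : (forall x, 0 <= rho x) ->
  admissible A -> admissible (fun x => x * A x).
Proof.
move=> rho0 [sA HA]; split; first exact: smoothM smooth_id sA.
move=> a b; have [M HM] := HA a.+1 b; have [N HN] := HA a b.-1.
exists (2 * M + 2 * b%:R ^+ 2 * N) => x; rewrite derive1n_mulx //.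
have H1 := HM x; have H2 := HN x.
have H3 : b%:R ^+ 2 * (x ^+ a * derive1n b.-1 A x) ^+ 2 <= b%:R ^+ 2 * (N * rho x).
  by rewrite ler_wpM2l ?sqr_ge0.
move: H1 H3; rewrite (exprS x a); set u := x ^+ a; set v := derive1n b A x.
set w := derive1n b.-1 A x; set k := b%:R => H1 H3.
have H4 := sqr_ge0 (x * u * v - k * (u * w)).
rewrite [leLHS](_ : _ = 2 * (x * u * v) ^+ 2 + 2 * (k ^+ 2 * (u * w) ^+ 2) -
  (x * u * v - k * (u * w)) ^+ 2); last by ring.
by lra.
Qed.

End AdmissibleCoefficients.

Section AdmissibleWeight.
Context {R : realType}.
Variable rho : R -> R.
Hypothesis rhoS : schwartz_mon_pos rho.

Lemma schwartz_bound a b : exists2 M : R, 0 <= M &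
  forall x : R, `|x ^+ a * derive1n b rho x| <= M.
Proof.
have [[_ /(_ a b)[M HM]] _ _] := rhoS; exists M => //.
exact: le_trans (HM 0).
Qed.

Lemma derive1n_oppr (f : R -> R) n : smooth f ->
  derive1n n (fun x => f (- x)) = fun x => (-1) ^+ n * derive1n n f (- x).
Proof.
move=> sf; elim: n => [|n IH]; first by apply/funext => x; rewrite mul1r.
have so : smooth (fun x : R => - x) by exact/smoothN/smooth_id.
have sn := smooth_derive1n n sf.
rewrite derive1nS IH (derive1_mul (smooth_cst _) (smooth_comp sn so)).
rewrite derive1_const (derive1_comp_fun sn so).
apply/funext => x; rewrite mul0r add0r.
rewrite (_ : (fun x : R => - x)^`() = fun=> -1).
  by rewrite exprS derive1nS; ring.
apply/funext => y; apply: derive1_eq; apply: is_deriveN.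
Qed.

(** The only place where the monotonicity of the weight enters. Away from the
    origin [rho] decreases along both half-lines, hence the squares of its
    derivatives are at most of the size [rho * sqrt rho], and [sqrt rho] beats
    every polynomial; near the origin [rho] is bounded below. *)
Lemma admissible_weight : admissible rho rho.
Proof.
have [[sr _] r0 [K K0 HK]] := rhoS; split=> // a b.
have bd j : exists M, forall x, `|derive1n j rho x| <= M.
  have [M _ HM] := schwartz_bound 0 j; exists M => x.
  by have := HM x; rewrite mul1r.
have [M1 H1] : exists M, forall x, K + 1 <= x ->
    derive1n b rho x ^+ 2 <= M * (rho x * Num.sqrt (rho x)).
  apply: decreasing_derive1n_bound => // x y Kx.
  rewrite le_eqVlt => /predU1P[->//|xy].
  have [c /andP[xc cy] E] := mvt_smooth sr xy.
  have c0 : 0 < c by lra.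
  have /HK : c \notin `[- K, K].
    by rewrite notin_setE /= in_itv /= => /andP[_]; lra.
  rewrite pmulr_rle0 // => H.
  by rewrite -subr_le0 E mulr_le0_ge0 // subr_ge0 ltW.
have [M2 H2] : exists M, forall x, K + 1 <= x ->
    derive1n b (fun y => rho (- y)) x ^+ 2
      <= M * (rho (- x) * Num.sqrt (rho (- x))).
  apply: (@decreasing_derive1n_bound _ (fun y => rho (- y))).
  - exact/smooth_comp/smoothN/smooth_id.
  - move=> j; have [M HM] := bd j; exists M => x.
    by rewrite derive1n_oppr // normrM normrX normrN1 expr1n mul1r.
  - by [].
  - move=> x y Kx; rewrite le_eqVlt => /predU1P[->//|xy].
    have yx : - y < - x by rewrite ltrN2.
    have [c /andP[xc cy] E] := mvt_smooth sr yx.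
    have c0 : c < 0 by lra.
    have /HK : c \notin `[- K, K].
      by rewrite notin_setE /= in_itv /= => /andP[]; lra.
    rewrite nmulr_rle0 // => H.
    by rewrite -subr_ge0 E mulr_ge0 // subr_ge0 ltW.
have [N N0 HN] := schwartz_bound (4 * a) 0.
have [B B0 HB] := schwartz_bound a b.
have KK : - (K + 1) <= K + 1 by lra.
have [c cK Hc] := EVT_min KK (continuous_subspaceT (smooth_continuous sr)).
exists (Num.max (B ^+ 2 / rho c) (Num.max (`|M1| * Num.sqrt N) (`|M2| * Num.sqrt N))).
move=> x.
have sq : x ^+ (2 * a) * Num.sqrt (rho x) <= Num.sqrt N.
  rewrite -[x ^+ (2 * a)]ger0_norm; last by rewrite exprM exprn_ge0 // sqr_ge0.
  rewrite -sqrtr_sqr -sqrtrM ?sqr_ge0 //; apply: ler_wsqrtr.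
  rewrite -exprM mulnAC.
  exact: le_trans (ler_norm _) (HN x).
have far M : derive1n b rho x ^+ 2 <= M * (rho x * Num.sqrt (rho x)) ->
    (x ^+ a * derive1n b rho x) ^+ 2 <= `|M| * Num.sqrt N * rho x.
  move=> H; rewrite exprMn -exprM mulnC.
  have x2 : 0 <= x ^+ (2 * a) by rewrite exprM exprn_ge0 // sqr_ge0.
  apply: (le_trans (ler_wpM2l x2 H)).
  rewrite [leLHS](_ : _ = M * (rho x * (x ^+ (2 * a) * Num.sqrt (rho x)))); last by ring.
  rewrite -mulrA [Num.sqrt N * _]mulrC.
  apply: le_trans (_ : `|M| * (rho x * (x ^+ (2 * a) * Num.sqrt (rho x))) <= _).
    rewrite ler_wpM2r ?ler_norm // !mulr_ge0 ?sqrtr_ge0 //; exact: ltW.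
  by rewrite !ler_wpM2l // ltW.
have [Kx|xK] := lerP (K + 1) x.
  apply: (le_trans (far _ (H1 _ Kx))); rewrite ler_wpM2r ?(ltW (r0 x)) //.
  by rewrite !le_max lexx !orbT.
have [Kx|xK'] := lerP (K + 1) (- x).
  have := H2 _ Kx; rewrite derive1n_oppr // opprK exprMn sqrr_sign mul1r => H.
  apply: (le_trans (far _ H)); rewrite ler_wpM2r ?(ltW (r0 x)) //.
  by rewrite !le_max lexx !orbT.
apply: (@le_trans _ _ (B ^+ 2 / rho c * rho x)); last first.
  by rewrite ler_wpM2r ?(ltW (r0 x)) // le_max lexx.
apply: (@le_trans _ _ (B ^+ 2)).
  by rewrite -real_normK ?num_real // ler_pXn2r ?nnegrE.
rewrite -mulrA ler_peMr ?sqr_ge0 // mulrC ler_pdivlMr // mul1r.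
by apply: Hc; rewrite in_itv /=; apply/andP; split; lra.
Qed.

End AdmissibleWeight.

(** * Integrals of functions that may fail to be measurable *)

Section AlmostEverywhere.
Context d (T : measurableType d) (R : realType).
Variable mu : {measure set T -> \bar R}.

Lemma ae_mono (P Q : T -> Prop) : (forall x, P x -> Q x) ->
  {ae mu, forall x, P x} -> {ae mu, forall x, Q x}.
Proof.
move=> PQ [N [mN N0 sN]]; exists N; split => // x /= nQ.
by apply: sN => /PQ.
Qed.

Lemma ae_mono2 (P Q S : T -> Prop) : (forall x, P x -> Q x -> S x) ->
  {ae mu, forall x, P x} -> {ae mu, forall x, Q x} -> {ae mu, forall x, S x}.
Proof.
move=> PQS aP aQ; apply: negligibleS (negligibleU aP aQ) => x /= nS.
by have [Px|nP] := pselect (P x); [right => /(PQS _ Px)|left].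
Qed.

End AlmostEverywhere.

Section LowerIntegral.
Context d (T : measurableType d) (R : realType).
Variable mu : {measure set T -> \bar R}.
Implicit Types (f g : T -> \bar R) (h : T -> R).
Local Open Scope ereal_scope.
Import HBNNSimple.

(** The integral of a nonnegative function is a supremum over the simple
    functions below it, whether or not the function is measurable. The elements
    of the function spaces and the representatives of their weak derivatives
    agree only almost everywhere with measurable functions, so that comparisons
    of their integrals go through this supremum. *)
Lemma lower_integral_le f (X : \bar R) : (forall x, 0 <= f x) ->
  (forall h, measurable_fun setT h -> (forall x, 0 <= h x)%R ->
    (forall x, (h x)%:E <= f x) -> \int[mu]_x (h x)%:E <= X) ->
  \int[mu]_x f x <= X.
Proof.
move=> f0 H; rewrite ge0_integralTE //.
apply: ge_ereal_sup => _ [h /= hf <-].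
by rewrite -integralT_nnsfun; exact: H.
Qed.

Lemma le_lower_integral f g : (forall x, 0 <= f x) ->
  (forall x, f x <= g x) -> \int[mu]_x f x <= \int[mu]_x g x.
Proof.
move=> f0 fg; rewrite !ge0_integralTE //; last first.
  by move=> x; exact: le_trans (fg x).
apply: le_ereal_sup => _ [h /= hf <-]; exists h => //= x.
exact: le_trans (fg x).
Qed.

(** A simple function loses nothing when it is set to 0 on a null set. *)
Lemma ae_le_lower_integral f g : (forall x, 0 <= f x) -> (forall x, 0 <= g x) ->
  {ae mu, forall x, f x <= g x} -> \int[mu]_x f x <= \int[mu]_x g x.
Proof.
move=> f0 g0 [N [mN N0 sN]].
apply: lower_integral_le => // h mh h0 hf.
pose h' x := (h x * \1_(~` N) x)%R.
have -> : \int[mu]_x (h x)%:E = \int[mu]_x (h' x)%:E.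
  apply: ge0_ae_eq_integral => //.
  - exact/measurable_EFinP.
  - apply/measurable_EFinP; apply: measurable_funM => //.
    exact/measurable_indic/measurableC.
  - by move=> x _; rewrite lee_fin.
  - by move=> x _; rewrite lee_fin mulr_ge0.
  exists N; split => // x /= Hx; apply: contrapT => Nx; apply: Hx => _.
  by rewrite /h' indicE mem_set ?mulr1.
apply: le_lower_integral => x; first by rewrite lee_fin mulr_ge0.
have [Nx|Nx] := pselect (N x).
  by rewrite /h' indicE memNset ?mulr0 //; exact: (@contrapT _).
apply: (@le_trans _ _ (f x)); last first.
  by apply: contrapT => H; apply: Nx; exact: sN.
apply: le_trans (hf x); rewrite lee_fin /h' indicE.
by rewrite mem_set ?mulr1.
Qed.

Lemma ae_eq_lower_integral (D : set T) f g :
  {ae mu, forall x, D x -> f x = g x} ->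
  \int[mu]_(x in D) f x = \int[mu]_(x in D) g x.
Proof.
move=> fg; rewrite !(integral_mkcond D) integralE [RHS]integralE.
have P : {ae mu, forall x, (f \_ D) x = (g \_ D) x}.
  apply: filterS fg => x H; rewrite !patchE; case: ifPn => // /set_mem.
  exact: H.
congr (_ - _); apply/eqP; rewrite eq_le; apply/andP; split.
- by apply: ae_le_lower_integral => //; apply: filterS P => x E; rewrite !funeposE E.
- by apply: ae_le_lower_integral => //; apply: filterS P => x E; rewrite !funeposE E.
- by apply: ae_le_lower_integral => //; apply: filterS P => x E; rewrite !funenegE E.
- by apply: ae_le_lower_integral => //; apply: filterS P => x E; rewrite !funenegE E.
Qed.

Lemma lower_integralZl (k : R) f : (0 < k)%R -> (forall x, 0 <= f x) ->
  \int[mu]_x (k%:E * f x) <= k%:E * \int[mu]_x f x.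
Proof.
move=> k0 f0; apply: lower_integral_le.
  by move=> x; rewrite mule_ge0 // lee_fin ltW.
move=> h mh h0 hf.
have -> : \int[mu]_x (h x)%:E = k%:E * \int[mu]_x (k^-1 * h x)%:E.
  rewrite -ge0_integralZl //.
  - by apply: eq_integral => x _; rewrite -EFinM mulrA mulfV ?mul1r // gt_eqF.
  - by apply/measurable_EFinP; apply: measurable_funM.
  - by move=> x _; rewrite lee_fin mulr_ge0 // invr_ge0 ltW.
  - by rewrite lee_fin ltW.
rewrite lee_pmul2l //; apply: le_lower_integral => x.
  by rewrite lee_fin mulr_ge0 // invr_ge0 ltW.
by rewrite EFinM lee_pdivrMl.
Qed.

End LowerIntegral.

(** * Change of variables *)

Section Density.
Context d1 d2 (X : measurableType d1) (Y : measurableType d2) (R : realType).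
Variables (mu : {measure set X -> \bar R}) (phi : X -> Y) (k : X -> R).
Hypotheses (mphi : measurable_fun setT phi) (mk : measurable_fun setT k).
Hypothesis k0 : forall x, 0 <= k x.
Local Open Scope ereal_scope.

Lemma measurable_preimageT (S : set Y) : measurable S -> measurable (phi @^-1` S).
Proof. by move=> mS; rewrite -[X in measurable X]setTI; exact: mphi. Qed.

Definition image_density (S : set Y) : \bar R :=
  \int[mu]_(x in phi @^-1` S) (k x)%:E.

Let image_density0 : image_density set0 = 0.
Proof. by rewrite /image_density preimage_set0 integral_set0. Qed.

Let image_density_ge0 S : 0 <= image_density S.
Proof. by apply: integral_ge0 => x _; rewrite lee_fin. Qed.

Let image_density_sigma_additive : semi_sigma_additive image_density.
Proof.
move=> F mF tF mUF.
have -> : image_density (\bigcup_n F n) = \sum_(i <oo) image_density (F i).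
  rewrite /image_density preimage_bigcup ge0_integral_bigcup //.
  - by move=> i; exact: measurable_preimageT.
  - by apply/measurable_EFinP; exact: measurable_funTS.
  - by move=> x _; rewrite lee_fin.
  - apply/trivIsetP => i j _ _ ij.
    by move/trivIsetP: tF => tF; rewrite -preimage_setI tF // preimage_set0.
apply: is_cvg_nneseries => n _ _; exact: image_density_ge0.
Qed.

HB.instance Definition _ := isMeasure.Build _ _ _ image_density
  image_density0 image_density_ge0 image_density_sigma_additive.

Definition image_density_measure : {measure set Y -> \bar R} := image_density.

Import HBNNSimple.

(** By linearity for simple functions, then by monotone convergence. *)
Lemma integral_change_of_variables (nu : {measure set Y -> \bar R}) :
  (forall S, measurable S -> nu S = image_density S) ->
  forall F : Y -> \bar R, measurable_fun setT F -> (forall y, 0 <= F y) ->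
  \int[nu]_y F y = \int[mu]_x (F (phi x) * (k x)%:E).
Proof.
move=> HS F mF F0.
have mkE : measurable_fun setT (EFin \o k) by exact/measurable_EFinP.
pose f_ := nnsfun_approx measurableT mF.
have mf n : measurable_fun setT (fun y => (f_ n y)%:E).
  exact/measurable_EFinP/measurable_funP.
have simple n : \int[nu]_y (f_ n y)%:E = \int[mu]_x ((f_ n (phi x))%:E * (k x)%:E).
  under eq_integral do rewrite fimfunE -fsumEFin//.
  rewrite ge0_integral_fsum//; last 2 first.
  - by move=> y; exact/measurable_EFinP/measurable_funM.
  - by move=> y x _; rewrite nnfun_muleindic_ge0.
  transitivity (\sum_(r \in range (f_ n)) \int[mu]_x
      ((r * \1_(f_ n @^-1` [set r]) (phi x))%:E * (k x)%:E)).
    apply: eq_fsbigr => r /set_mem[y _ ry].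
    have r0 : (0 <= r)%R by rewrite -ry.
    rewrite integralZl_indic_nnsfun // integral_indic // setIT HS //.
    rewrite /image_density [X in _ * X]integral_mkcond -ge0_integralZl //.
    - apply: eq_integral => x _; rewrite patchE indicE EFinM -muleA; congr (_ * _).
      rewrite (_ : (phi x \in _) = (x \in phi @^-1` (f_ n @^-1` [set r]))); last first.
        by apply/idP/idP => /set_mem H; apply/mem_set.
      by case: ifP => _; rewrite ?mul1e ?mul0e.
    - apply/(measurable_restrictT _ _).1 => //; first exact: measurable_preimageT.
      exact: measurable_funTS.
    - by move=> x _; rewrite patchE; case: ifP => // _; rewrite lee_fin.
  rewrite -ge0_integral_fsum//.
  - apply: eq_integral => x _; rewrite [in RHS]fimfunE -fsumEFin //.
    rewrite [RHS]muleC ge0_mule_fsumr; last by move=> r; rewrite nnfun_muleindic_ge0.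
    by apply: eq_fsbigr => r _; rewrite muleC.
  - move=> r; apply: emeasurable_funM => //; apply/measurable_EFinP.
    apply: measurable_funM => //; apply: (measurableT_comp (measurable_indic _)) => //.
  - move=> r x _; apply: mule_ge0; last by rewrite lee_fin.
    by rewrite EFinM nnfun_muleindic_ge0.
transitivity (limn (fun n => \int[nu]_y (f_ n y)%:E)).
  rewrite -monotone_convergence//.
  - apply: eq_integral => y _; apply/esym/cvg_lim => //.
    by apply: cvg_nnsfun_approx=> // *; apply: F0.
  - by move=> n y _; rewrite lee_fin.
  - by move=> y _ m n mn; rewrite lee_fin; exact/lefP/nd_nnsfun_approx.
under eq_fun do rewrite simple.
rewrite -monotone_convergence//.
- apply: eq_integral => x _; apply: cvg_lim => //.
  have H := cvg_nnsfun_approx measurableT mF (fun y _ => F0 y) (I : setT (phi x)).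
  rewrite muleC; under eq_fun do rewrite muleC.
  exact: cvgeZl.
- move=> n; apply: emeasurable_funM => //.
  exact: (measurableT_comp (mf n)).
- by move=> n x _; rewrite mule_ge0 // lee_fin.
- move=> x _ m n mn; rewrite lee_wpmul2r ?lee_fin //.
  exact/lefP/nd_nnsfun_approx.
Qed.

End Density.

(** * The cotangent substitution *)

Section Cotangent.
Context {R : realType}.
Implicit Types c t x : R.

Definition mob c t : R := c * (cos (t / 2) / sin (t / 2)).

(** The inverse of [mob c], with values in the open interval (0, 2 pi). *)
Definition ang c x : R := pi - 2 * atan (x / c).

(** The density [- mob'] expressed in the variable [x = mob c t]. That it is a
    polynomial in [x] is what makes the class of admissible coefficients fit
    the substitution. *)
Definition quad c x : R := (c ^+ 2 + x ^+ 2) / (2 * c).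

Lemma torusE t : torus t <-> 0 < t < 2 * pi.
Proof. by rewrite /torus /= in_itv. Qed.

Lemma measurable_torus : measurable (@torus R).
Proof. exact: measurable_itv. Qed.

Lemma sin_half_gt0 t : torus t -> 0 < sin (t / 2).
Proof.
move=> /torusE /andP[t0 tpi]; apply: sin_gt0_pi.
by rewrite divr_gt0 //= ltr_pdivrMr // mulrC.
Qed.

Lemma mob_tan c t : mob c t = c * tan (pi / 2 - t / 2).
Proof.
rewrite /mob /tan -(opprB (t / 2)) cosN sinN cosBpihalf sinBpihalf.
by rewrite opprK.
Qed.

Lemma ang_torus c x : torus (ang c x).
Proof.
apply/torusE; have := atan_gtNpi2 (x / c); have := atan_ltpi2 (x / c).
by rewrite /ang; set y := atan _ => H1 H2; apply/andP; split; lra.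
Qed.

Lemma angK c x : 0 < c -> mob c (ang c x) = x.
Proof.
move=> c0; rewrite mob_tan (_ : pi / 2 - ang c x / 2 = atan (x / c)).
  by rewrite atanK mulrC divfK // gt_eqF.
by rewrite /ang; field.
Qed.

Lemma mobK c t : 0 < c -> torus t -> ang c (mob c t) = t.
Proof.
move=> c0 /torusE /andP[t0 tpi]; rewrite /ang mob_tan mulrAC mulfV ?gt_eqF //.
rewrite mul1r tanK; first by field.
by rewrite in_itv /=; apply/andP; split; lra.
Qed.

Lemma quad_gt0 c x : 0 < c -> 0 < quad c x.
Proof.
move=> c0; rewrite /quad divr_gt0 ?mulr_gt0 //.
by rewrite ltr_wpDr ?sqr_ge0 // exprn_gt0.
Qed.

Lemma quad_mob c t : 0 < c -> torus t -> quad c (mob c t) = c * dphi t.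
Proof.
move=> c0 /sin_half_gt0 s0; rewrite /quad /mob /dphi.
rewrite exprMn -[X in X + _]mulr1 -mulrDr exprMn exprVn.
rewrite (_ : 1 + _ = (sin (t / 2)) ^- 2); last first.
  rewrite -[X in X + _](@mulfV _ (sin (t / 2) ^+ 2)) ?expf_neq0 ?gt_eqF //.
  by rewrite -mulrDl addrC cos2Dsin2 mul1r.
by field; rewrite !gt_eqF.
Qed.

Lemma is_derive_mob c t : torus t -> is_derive t 1 (mob c) (- (c * dphi t)).
Proof.
move=> /sin_half_gt0 s0.
have h : is_derive t 1 (fun u : R => u / 2) (1 * 2^-1 + t * 0).
  by apply: is_derive_mul; exact: is_derive_const.
have dc := @is_derive_comp _ cos (fun u : R => u / 2) t _ _ (is_derive_cos _) h.
have ds := @is_derive_comp _ sin (fun u : R => u / 2) t _ _ (is_derive_sin _) h.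
have dv := @is_derive_inv _ (fun u : R => sin (u / 2)) t _ (lt0r_neq0 s0) ds.
have := is_derive_mul (is_derive_const c t) (is_derive_mul dc dv).
move=> H; apply: is_derive_eq H _; rewrite /dphi mulr0 addr0 !mul1r mul0r add0r.
rewrite [X in c * X](_ : _ = - (cos (t / 2) ^+ 2 + sin (t / 2) ^+ 2) *
  (2 * sin (t / 2) ^+ 2)^-1); last by field; rewrite gt_eqF.
by rewrite cos2Dsin2; field; rewrite gt_eqF.
Qed.

Lemma smooth_ang c : smooth (ang c).
Proof.
apply: smoothB (smooth_cst _) (smoothZ _ _).
apply: smooth_comp smooth_atan _.
exact: smoothM smooth_id (smooth_cst _).
Qed.

Lemma is_derive_ang c x : 0 < c -> is_derive x 1 (ang c) (- (quad c x)^-1).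
Proof.
move=> c0.
have h : is_derive x 1 (fun u : R => u / c) (1 * c^-1 + x * 0).
  by apply: is_derive_mul; exact: is_derive_const.
have da := @is_derive_comp _ atan (fun u : R => u / c) x _ _ (is_derive1_atan _) h.
have db := is_derive_mul (is_derive_const 2 x) da.
have := is_derive_add (is_derive_const pi x) (is_deriveN db).
move=> H; apply: is_derive_eq H _; rewrite /quad.
have H : c ^+ 2 + x ^+ 2 != 0.
  by rewrite gt_eqF // ltr_wpDr ?sqr_ge0 // exprn_gt0.
by field; rewrite gt_eqF // addrC.
Qed.

Lemma lt_ang c x y : 0 < c -> x < y -> ang c y < ang c x.
Proof.
move=> c0 xy; rewrite /ang ltrD2l ltrN2 ltr_pM2l //.
by apply: lt_atan; rewrite ltr_pM2r ?invr_gt0.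
Qed.

Lemma measurable_inv : measurable_fun [set: R] (@GRing.inv R).
Proof.
have -> : [set: R] = [set 0] `|` [set x | x != 0].
  apply/seteqP; split=> // x _ /=.
  by have [->|?] := eqVneq x 0; [left|right].
have o : open [set x : R | x != 0].
  rewrite (_ : [set x : R | x != 0] = ~` [set 0]).
    by apply: closed_openC; exact: closed_eq.
  by apply/seteqP; split => x /= /eqP.
apply/measurable_funU => //; first exact: open_measurable.
split; first exact: measurable_fun_set1.
apply: open_continuous_measurable_fun => // x /set_mem /= x0.
exact: inv_continuous.
Qed.

Lemma measurable_mob c D : measurable_fun D (mob c).
Proof.
apply: measurable_funTS; apply: measurable_funM => //.
have mh : measurable_fun [set: R] (fun t : R => t / 2).
  by apply: measurable_funM.
apply: measurable_funM.
  apply: (measurableT_comp _ mh); apply: continuous_measurable_fun.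
  exact: continuous_cos.
apply: (measurableT_comp measurable_inv).
apply: (measurableT_comp _ mh); apply: continuous_measurable_fun.
exact: continuous_sin.
Qed.

(** The density on the whole line of the measure that [mob c] transports to
    the Lebesgue measure. *)
Definition mobdens c t : R := \1_(@torus R) t * quad c (mob c t).

Lemma mobdens_ge0 c t : 0 < c -> 0 <= mobdens c t.
Proof. by move=> c0; rewrite mulr_ge0 // ltW // quad_gt0. Qed.

Lemma mobdens_gt0 c t : 0 < c -> torus t -> 0 < mobdens c t.
Proof. by move=> c0 tt; rewrite /mobdens indicE mem_set // mul1r quad_gt0. Qed.

Lemma mobdensE c t : 0 < c -> torus t -> mobdens c t = c * dphi t.
Proof. by move=> c0 tt; rewrite /mobdens indicE mem_set // mul1r quad_mob. Qed.

Lemma mobdens_out c t : ~ torus t -> mobdens c t = 0.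
Proof. by move=> tt; rewrite /mobdens indicE memNset // mul0r. Qed.

Lemma smooth_quad c : smooth (quad c).
Proof.
apply: smoothM (smooth_cst _); apply: smoothD (smooth_cst _) _.
by apply: (smoothM smooth_id smooth_id).
Qed.

Lemma measurable_mobdens c D : measurable_fun D (mobdens c).
Proof.
apply: measurable_funTS; apply: measurable_funM.
  exact: measurable_indic measurable_torus.
have mq : measurable_fun [set: R] (quad c) by exact: (smooth_measurable (@smooth_quad c)).
exact: (measurableT_comp mq (@measurable_mob c setT)).
Qed.

Local Notation leb := (@lebesgue_measure R).

(** By the uniqueness of the Lebesgue measure only intervals are to be checked.
    Their preimages are intervals, over which the density is integrated by the
    fundamental theorem of calculus. *)
Lemma lebesgue_mob c (S : set R) : 0 < c -> measurable S ->
  leb S = @image_density _ _ _ _ R leb (mob c) (mobdens c) S.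
Proof.
move=> c0 mS.
have mm : @measurable_fun _ _ (measurableTypeR R) (measurableTypeR R) setT (mob c).
  exact: measurable_mob.
pose nu := image_density_measure leb mm
  (@measurable_mobdens c setT) (fun t => @mobdens_ge0 c t c0).
apply: (@lebesgue_measure_unique _ nu) => // _ [[a b] /= _ <-].
rewrite lebesgue_measure_itv /= lte_fin /nu /= /image_density.
case: ifPn => [ab|]; last first.
  by rewrite -leNgt => ba; rewrite set_itv_ge ?preimage_set0 ?integral_set0 // bnd_simp -leNgt.
have lt := lt_ang c0 ab.
have sub t : t \in `[ang c b, ang c a]%R -> torus t.
  rewrite in_itv /= => /andP[H1 H2]; apply/torusE.
  have /torusE/andP[H3 _] := ang_torus c b.
  have /torusE/andP[_ H4] := ang_torus c a.
  by rewrite (lt_le_trans H3 H1) (le_lt_trans H2 H4).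
have Hpre t : torus t -> (mob c @^-1` `]a, b]%classic) t <-> t \in `[ang c b, ang c a[%R.
  move=> tt; rewrite /= !in_itv /=; set y := mob c t.
  rewrite -[t](mobK c0 tt) -/y.
  have lel x z : (ang c x <= ang c z) = (z <= x).
    have [xy|yx] := ltP x z; first by rewrite leNgt lt_ang // leNgt xy.
    by move: yx; rewrite le_eqVlt => /predU1P[->|yx]; rewrite ?lexx // ltW // lt_ang.
  by rewrite lel !ltNge lel andbC.
rewrite integral_mkcond.
transitivity (\int[leb]_(t in `[ang c b, ang c a[) (quad c (mob c t))%:E)%E; last first.
  rewrite [LHS]integral_mkcond; apply: eq_integral => t _; rewrite !patchE.
  have [tt|nt] := pselect (torus t); last first.
    rewrite mobdens_out // [in LHS]ifF; first by case: ifP.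
    apply/negP => /set_mem /= H; apply: nt; apply: sub.
    by move: H; rewrite !in_itv /= => /andP[-> /ltW].
  rewrite mobdensE // quad_mob //; congr (if _ then _ else _).
  by apply/idP/idP => /set_mem /(Hpre _ tt) H; apply/mem_set.
have D t : t \in `[ang c b, ang c a]%R -> is_derive t 1 (fun u => - mob c u) (quad c (mob c t)).
  by move=> /sub tt; have := is_deriveN (is_derive_mob c tt); rewrite opprK quad_mob.
have cont t : t \in `[ang c b, ang c a]%R -> {for t, continuous (fun u => - mob c u)}.
  move=> ht; apply: differentiable_continuous; apply/derivable1_diffP.
  exact: derivable_of_is_derive (D t ht).
rewrite integral_itv_bndo_bndc; last first.
  apply/measurable_EFinP; apply: (eq_measurable_fun (mobdens c)).
    move=> t /set_mem /=; rewrite in_itv /= => /andP[H1 H2].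
    have tt : torus t by apply: sub; rewrite in_itv /= H1 ltW.
    by rewrite mobdensE // quad_mob.
  exact: measurable_mobdens.
rewrite (@continuous_FTC2 _ _ (fun u => - mob c u)) //.
- by rewrite !angK // -!EFinB; congr EFin; ring.
- apply: continuous_in_subspaceT => t /set_mem /= /sub tt.
  apply: (@continuous_comp _ _ _ (mob c) (quad c)).
    apply: differentiable_continuous; apply/derivable1_diffP.
    exact: derivable_of_is_derive (is_derive_mob c tt).
  exact: (@smooth_continuous _ (quad c) (@smooth_quad c) _).
- split.
  + by move=> t ht; apply: derivable_of_is_derive (D t _); exact: subset_itv_oo_cc.
  + by apply: cvg_at_right_filter; apply: cont; rewrite in_itv /= lexx ltW.
  + by apply: cvg_at_left_filter; apply: cont; rewrite in_itv /= lexx ltW.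
- by move=> t ht; apply: derive1_eq; apply: D; exact: subset_itv_oo_cc.
Qed.

End Cotangent.

(** * The substitution in several variables *)

Section TupleIntegral.
Context {R : realType}.
Local Open Scope ereal_scope.
Local Notation leb := (@lebesgue_measure R).

(** Tonelli's theorem for a measure whose sigma-finiteness is a hypothesis
    instead of a structure, as is the case for the Lebesgue measure on tuples. *)
Lemma ge0_integral_product_measure2 d1 d2 (T1 : measurableType d1)
    (T2 : measurableType d2) (m1 : {sigma_finite_measure set T1 -> \bar R})
    (m2 : {measure set T2 -> \bar R}) (f : T1 * T2 -> \bar R) :
  sigma_finite setT m2 -> measurable_fun setT f -> (forall z, 0 <= f z) ->
  \int[(m1 \x^ m2)]_z f z = \int[m2]_y \int[m1]_x f (x, y).
Proof.
move=> sf mf f0.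
pose H1 := isSFinite.Build _ _ _ _ (sfinite_measure_sigma_finite sf).
pose H2 := isSigmaFinite.Build _ _ _ _ sf.
pose m2' := HB.pack_for (SigmaFiniteMeasure.type T2 R) (Measure.sort m2) H1 H2.
rewrite -[RHS](@fubini_tonelli2 _ _ _ _ _ m1 m2' f) //.
apply: eq_measure_integral => A mA _; apply/esym.
by apply: product_measure_unique => // B C mB mC /=; rewrite product_measure2E.
Qed.

Lemma measurable_fun_integral1 d1 d2 (T1 : measurableType d1)
    (T2 : measurableType d2) (m1 : {sigma_finite_measure set T1 -> \bar R})
    (f : T1 * T2 -> \bar R) :
  measurable_fun setT f -> (forall z, 0 <= f z) ->
  measurable_fun setT (fun y => \int[m1]_x f (x, y)).
Proof. by move=> mf f0; exact: measurable_fun_fubini_tonelli_G. Qed.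

Lemma sigma_finite_lebesgue_tuple n : sigma_finite setT (@lebesgue_tuple R n).
Proof.
elim: n => [|n /sigma_finiteP[F [FT _ mF]]].
  exists (fun=> setT); first by rewrite bigcup_const.
  by move=> _; split => //=; rewrite diracT ltry.
have /sigma_finiteP[G [GT ndG mG]] : sigma_finite setT leb by exact: sigma_finiteT.
have /sigma_finiteP[F' [F'T ndF mF']] : sigma_finite setT (@lebesgue_tuple R n).
  by exists F.
pose box i : set (n.+1.-tuple R) :=
  [set t | G i (thead t) /\ F' i [tuple of behead t]].
exists box.
  apply/seteqP; split => // t _.
  have : setT (thead t) by [].
  rewrite GT => -[i _ Gi].
  have : setT [tuple of behead t] by [].
  rewrite F'T => -[j _ Fj].
  exists (maxn i j) => //; split.
    by have /subsetPset := ndG _ _ (leq_maxl i j); apply.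
  by have /subsetPset := ndF _ _ (leq_maxr i j); apply.
move=> i; have [mGi Gi] := mG i; have [mFi Fi] := mF' i; split.
  rewrite (_ : box i = ((fun t => tnth t ord0) @^-1` G i) `&`
    ((fun t : n.+1.-tuple R => [tuple of behead t]) @^-1` F' i)) //.
  apply: measurableI.
    by rewrite -[X in measurable X]setTI; exact: measurable_tnth.
  by rewrite -[X in measurable X]setTI; exact: measurable_behead.
rewrite /= /lebesgue_cons /pushforward.
rewrite (_ : _ @^-1` _ = G i `*` F' i).
  by rewrite product_measure2E // lte_mul_pinfty // ge0_fin_numE.
apply/seteqP; split=> -[x t] /=; rewrite /cons_pair /box /= theadE.
  by move=> [? H]; split => //; move: H; congr F'; exact/val_inj.
by move=> [? H]; split => //; move: H; congr F'; exact/val_inj.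
Qed.

Lemma ge0_integral_lebesgue_tupleS n (F : n.+1.-tuple R -> \bar R) :
  measurable_fun setT F -> (forall t, 0 <= F t) ->
  \int[lebesgue_tuple n.+1]_t F t =
  \int[lebesgue_tuple n]_t \int[leb]_x F (cons_pair (x, t)).
Proof.
move=> mF F0; rewrite [LHS]ge0_integral_pushforward //; last first.
  exact: measurable_cons_pair.
rewrite preimage_setT ge0_integral_product_measure2 //.
- exact: sigma_finite_lebesgue_tuple.
- by apply: measurableT_comp => //; exact: measurable_cons_pair.
- by move=> z; exact: F0.
Qed.

Section CotangentTuple.
Local Open Scope ring_scope.

Definition tuple_dens n (c : 'I_n -> R) (t : n.-tuple R) : R :=
  \prod_(k < n) mobdens (c k) (tnth t k).

Lemma measurable_moebius n (c : 'I_n -> R) : measurable_fun setT (moebius c).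
Proof.
apply/measurable_fun_tnthP => i.
rewrite (_ : _ \o _ = fun t => mob (c i) (tnth t i)).
  exact: (measurableT_comp (@measurable_mob _ (c i) setT) (measurable_tnth i)).
by apply/funext => t /=; rewrite tnth_mktuple.
Qed.

Lemma measurable_tuple_dens n (c : 'I_n -> R) : measurable_fun setT (tuple_dens c).
Proof.
apply: measurable_prod => i _.
exact: (measurableT_comp (@measurable_mobdens _ (c i) setT) (measurable_tnth i)).
Qed.

Lemma tuple_dens_ge0 n (c : 'I_n -> R) t : (forall k, 0 < c k) -> 0 <= tuple_dens c t.
Proof. by move=> c0; apply: prodr_ge0 => i _; exact: mobdens_ge0. Qed.

Lemma ge0_integral_mob (c : R) (F : R -> \bar R) : 0 < c ->
  measurable_fun setT F -> (forall x, 0 <= F x)%E ->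
  (\int[leb]_x F x = \int[leb]_t (F (mob c t) * (mobdens c t)%:E))%E.
Proof.
move=> c0 mF F0.
apply: (@integral_change_of_variables _ _ (measurableTypeR R) (measurableTypeR R)) => //.
- exact: measurable_mob.
- exact: measurable_mobdens.
- by move=> t; exact: mobdens_ge0.
- by move=> S mS; exact: lebesgue_mob.
Qed.

(** Tonelli's theorem splits off the first variable, in which the
    one-dimensional substitution applies. *)
Lemma ge0_integral_moebius n (c : 'I_n -> R) (F : n.-tuple R -> \bar R) :
  (forall k, 0 < c k) -> measurable_fun setT F -> (forall t, 0 <= F t)%E ->
  (\int[lebesgue_tuple n]_t F t =
   \int[lebesgue_tuple n]_t (F (moebius c t) * (tuple_dens c t)%:E))%E.
Proof.
elim: n c F => [|n IH] c F c0 mF F0.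
  rewrite /= !integral_dirac //; last first.
    apply: emeasurable_funM; last by apply/measurable_EFinP; exact: measurable_tuple_dens.
    exact: (measurableT_comp mF (measurable_moebius c)).
  rewrite /tuple_dens big_ord0 mule1; congr (_ * F _)%E.
  by rewrite [moebius _ _]tuple0.
pose c' (k : 'I_n) := c (lift ord0 k).
have c'0 k : 0 < c' k by exact: c0.
pose G (z : R * n.-tuple R) : \bar R :=
  (F (cons_pair (mob (c ord0) z.1, z.2)) * (mobdens (c ord0) z.1)%:E)%E.
have mcons : measurable_fun setT (fun z : R * n.-tuple R =>
    cons_pair (mob (c ord0) z.1, z.2)).
  apply: measurable_cons; last exact: measurable_snd.
  exact: (measurableT_comp (@measurable_mob _ (c ord0) setT) measurable_fst).
have mG : measurable_fun setT G.
  apply: emeasurable_funM.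
    exact: (measurableT_comp mF mcons).
  apply/measurable_EFinP.
  exact: (measurableT_comp (@measurable_mobdens _ (c ord0) setT) measurable_fst).
have G0 z : (0 <= G z)%E by rewrite mule_ge0 // lee_fin mobdens_ge0.
rewrite ge0_integral_lebesgue_tupleS //.
transitivity (\int[lebesgue_tuple n]_t \int[leb]_x G (x, t))%E.
  apply: eq_integral => t _; rewrite (ge0_integral_mob (c0 ord0)) //.
  apply: (measurableT_comp mF).
  by apply: measurable_cons; [exact: measurable_id|exact: measurable_cst].
have mH : measurable_fun setT (fun t => \int[leb]_x G (x, t))%E.
  exact: (@measurable_fun_integral1 _ _ (measurableTypeR R) _ leb G).
rewrite (IH c' (fun t => \int[leb]_x G (x, t))%E c'0 mH); last first.
  by move=> t; apply: integral_ge0.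
rewrite ge0_integral_lebesgue_tupleS //; last 2 first.
- apply: emeasurable_funM; last by apply/measurable_EFinP; exact: measurable_tuple_dens.
  exact: (measurableT_comp mF (measurable_moebius c)).
- by move=> t; rewrite mule_ge0 // lee_fin tuple_dens_ge0.
apply: eq_integral => t _; rewrite -ge0_integralZr //; last 2 first.
- exact: (measurableT_comp mG (pair2_measurable _)).
- by rewrite lee_fin tuple_dens_ge0.
apply: eq_integral => x _; rewrite /G /= -muleA -EFinM.
rewrite (_ : cons_pair (mob (c ord0) x, moebius c' t) =
  moebius c (cons_pair (x, t))); last first.
  apply/val_inj; rewrite /= enum_ordSl /= -map_comp.
  by congr (_ :: _); apply: eq_map => i /=; rewrite tnthS.
rewrite /tuple_dens big_ord_recl; congr (_ * (_ * _)%:E)%E.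
by apply: eq_bigr => i _; rewrite tnthS.
Qed.

End CotangentTuple.
End TupleIntegral.

(** * Transport of null sets and integrals *)

Section Transport.
Context d1 d2 (X : measurableType d1) (Y : measurableType d2) (R : realType).
Variables (mu : {measure set X -> \bar R}) (nu : {measure set Y -> \bar R}).
Variables (phi : X -> Y) (k : X -> R).
Hypotheses (mphi : measurable_fun setT phi) (mk : measurable_fun setT k).
Hypothesis k0 : forall x, 0 <= k x.
Local Open Scope ereal_scope.
Hypothesis cov : forall F : Y -> \bar R, measurable_fun setT F ->
  (forall y, 0 <= F y) -> \int[nu]_y F y = \int[mu]_x (F (phi x) * (k x)%:E).

(** The density integrates to 0 over the preimage of a null set, so that it
    vanishes almost everywhere there. *)
Lemma transport_ae (D : set X) (P : Y -> Prop) : (forall x, D x -> 0 < k x)%R ->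
  {ae nu, forall y, P y} -> {ae mu, forall x, D x -> P (phi x)}.
Proof.
move=> kD [N [mN N0 sN]].
have mI : measurable_fun setT (fun y => (\1_N y)%:E : \bar R).
  exact/measurable_EFinP/measurable_indic.
have mF : measurable_fun setT (fun x => (\1_N (phi x))%:E * (k x)%:E).
  apply: emeasurable_funM; last exact/measurable_EFinP.
  exact: (measurableT_comp mI mphi).
have : \int[mu]_x `|(\1_N (phi x))%:E * (k x)%:E| = 0.
  rewrite -[RHS]N0 -[in RHS](setIT N) -integral_indic // cov //.
  by apply: eq_integral => x _; rewrite gee0_abs // mule_ge0 // lee_fin.
move=> /(ae_eq_integral_abs mu measurableT mF).
apply: filterS => x /(_ I) /= H Dx; apply: contrapT => nP.
move: H; rewrite indicE mem_set; last exact: sN.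
by rewrite mul1e => /eqP; rewrite eqe gt_eqF // kD.
Qed.

(** A measurable function below the integrand on the left is, through the
    inverse map, the pull-back of a measurable function below [Phi]. This
    covers the limit in [L^2], where [Phi] may fail to be measurable. *)
Lemma transport_lower_integral (D : set X) (inv : Y -> X) (Phi : Y -> \bar R) :
  measurable_fun setT inv -> (forall x, D x -> inv (phi x) = x) ->
  (forall y, phi (inv y) = y) ->
  (forall x, D x -> 0 < k x)%R -> (forall x, ~ D x -> k x = 0)%R ->
  (forall y, D (inv y)) -> (forall y, 0 <= Phi y) ->
  \int[mu]_x (Phi (phi x) * (k x)%:E) <= \int[nu]_y Phi y.
Proof.
move=> minv invK phiK kD knD Dinv Phi0.
apply: lower_integral_le => [x|h mh h0 hPhi].
  by rewrite mule_ge0 // lee_fin.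
pose s y := (h (inv y) / k (inv y))%R.
have ms : measurable_fun setT s.
  apply: measurable_funM; first exact: (measurableT_comp mh minv).
  apply: (measurableT_comp (@measurable_inv R)).
  exact: (measurableT_comp mk minv).
have s0 y : (0 <= s y)%R by rewrite divr_ge0.
have -> : \int[mu]_x (h x)%:E = \int[nu]_y (s y)%:E.
  rewrite cov //; last exact/measurable_EFinP.
  apply: eq_integral => x _; have [Dx|nDx] := pselect (D x).
    by rewrite /s invK // -EFinM divfK // gt_eqF // kD.
  have := hPhi x; rewrite knD // !mule0 lee_fin => hx.
  by congr EFin; apply/eqP; rewrite eq_le hx h0.
apply: le_lower_integral => y; first by rewrite lee_fin.
have := hPhi (inv y); rewrite phiK /s EFinM.
have ky : (0 < k (inv y))%R by exact: kD.
by rewrite lee_pdivrMr.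
Qed.

End Transport.

Section CotangentIntegral.
Context {R : realType}.
Local Notation leb := (@lebesgue_measure R).
Variable c : R.
Hypothesis c0 : 0 < c.

Lemma mob_ae (P : R -> Prop) :
  {ae leb, forall x, P x} -> {ae leb, forall t, torus t -> P (mob c t)}.
Proof.
apply: (@transport_ae _ _ (measurableTypeR R) (measurableTypeR R) R leb leb
  (mob c) (mobdens c)).
- exact: measurable_mob.
- exact: measurable_mobdens.
- by move=> t; exact: mobdens_ge0.
- by move=> F mF F0; exact: ge0_integral_mob.
- by move=> t; exact: mobdens_gt0.
Qed.

(** The factor is the one for which the integral of [F] over the line is that of
    [pull F] over the torus. *)
Definition pull (F : R -> R) (t : R) : R := F (mob c t) * quad c (mob c t).

Lemma measurable_pull (F : R -> R) D :
  measurable_fun setT F -> measurable_fun D (pull F).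
Proof.
move=> mF; apply: measurable_funTS; apply: measurable_funM.
  exact: (measurableT_comp mF (@measurable_mob _ c setT)).
have mq : measurable_fun [set: R] (quad c) by exact: (smooth_measurable (@smooth_quad _ c)).
exact: (measurableT_comp mq (@measurable_mob _ c setT)).
Qed.

Lemma ge0_integral_pull (F : R -> R) : measurable_fun setT F ->
  (forall x, 0 <= F x) ->
  (\int[leb]_x (F x)%:E = \int[leb]_(t in torus) (pull F t)%:E)%E.
Proof.
move=> mF F0; rewrite (ge0_integral_mob c0) //; last exact/measurable_EFinP.
rewrite [RHS]integral_mkcond; apply: eq_integral => t _.
rewrite patchE; case: ifPn => [/set_mem tt|/negP nt].
  by rewrite -EFinM /mobdens indicE mem_set // mul1r.
by rewrite mobdens_out ?mule0 // => tt; apply: nt; apply/mem_set.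
Qed.

Lemma integral_pull (F : R -> R) : measurable_fun setT F ->
  (\int[leb]_x (F x)%:E = \int[leb]_(t in torus) (pull F t)%:E)%E.
Proof.
move=> mF; rewrite [LHS]integralE [RHS]integralE.
have q0 t : 0 < quad c (mob c t) by exact: quad_gt0.
have pos t : Num.max (pull F t) 0 = pull (fun x => Num.max (F x) 0) t.
  by rewrite /pull maxr_pMl ?(ltW (q0 t)) // mul0r.
have neg t : Num.max (- pull F t) 0 = pull (fun x => Num.max (- F x) 0) t.
  by rewrite /pull maxr_pMl ?(ltW (q0 t)) // mul0r mulNr.
congr (_ - _)%E.
- under eq_integral do rewrite funeposE /= -EFin_max.
  under [RHS]eq_integral do rewrite funeposE /= -EFin_max pos.
  apply: ge0_integral_pull; first by apply: measurable_maxr.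
  by move=> x; rewrite le_max lexx orbT.
- under eq_integral do rewrite funenegE /= -EFin_max.
  under [RHS]eq_integral do rewrite funenegE /= -EFin_max neg.
  apply: ge0_integral_pull.
    by apply: measurable_maxr => //; apply: measurableT_comp.
  by move=> x; rewrite le_max lexx orbT.
Qed.

Lemma integrable_pull (F : R -> R) : leb.-integrable setT (EFin \o F) ->
  leb.-integrable torus (EFin \o pull F).
Proof.
move=> /integrableP[/measurable_EFinP mF iF]; apply/integrableP; split.
  by apply/measurable_EFinP; exact: measurable_pull.
apply: le_lt_trans iF; rewrite (@ge0_integral_pull (fun x => `|F x|)) //.
  rewrite le_eqVlt; apply/orP; left; apply/eqP; apply: eq_integral => t _ /=.
  by rewrite /pull normrM (gtr0_norm (quad_gt0 _ c0)).
exact: measurableT_comp.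
Qed.

End CotangentIntegral.

(** * Uniqueness of weak derivatives *)

Lemma real_cvg_unique (R : realType) (u : nat -> R) (a b : R) :
  u @ \oo --> a -> u @ \oo --> b -> a = b.
Proof.
by move=> ua ub; rewrite -(cvg_lim (@Rhausdorff R) ua) -(cvg_lim (@Rhausdorff R) ub).
Qed.

Section DominatedConvergence.
Context d (T : measurableType d) (R : realType).
Variable mu : {measure set T -> \bar R}.

Lemma Rintegral_dominated_cvg (D : set T) (f_ : nat -> T -> R) (f g : T -> R) :
  measurable D -> (forall n, measurable_fun D (f_ n)) -> measurable_fun D f ->
  (forall x, D x -> f_ ^~ x @ \oo --> f x) ->
  mu.-integrable D (EFin \o g) -> (forall n x, D x -> `|f_ n x| <= g x) ->
  (fun n => Rintegral mu D (f_ n)) @ \oo --> Rintegral mu D f.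
Proof.
move=> mD mf_ mf ff ig fg.
have [|||||int_f _ H] := @dominated_convergence _ _ _ mu D mD
  (fun n => EFin \o f_ n) (EFin \o f) (EFin \o g).
- by move=> n; exact/measurable_EFinP.
- exact/measurable_EFinP.
- apply: aeW => x Dx; apply: cvg_EFin; last exact: ff.
  by apply: nearW.
- exact: ig.
- by apply: aeW => x n Dx; rewrite /= lee_fin; exact: fg.
apply: fine_cvg; rewrite fineK; last exact: integrable_fin_num.
exact: H.
Qed.

End DominatedConvergence.

Section Uniqueness.
Context {R : realType}.
Local Notation leb := (@lebesgue_measure R).
Implicit Types u : R -> R.

(** Almost everywhere, [u] is the derivative of its indefinite integral. *)
Lemma ae_zero_of_initial_integrals u (A B : R) : measurable_fun setT u ->
  leb.-integrable `]A, B[ (EFin \o u) ->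
  (forall x, A < x <= B -> Rintegral leb `]A, x[ u = 0) ->
  {ae leb, forall x, `]A, B[%classic x -> u x = 0}.
Proof.
move=> mu iu u0; pose f := u \_ `]A, B[.
have mAB : @measurable _ (measurableTypeR R) `]A, B[%classic.
  exact: measurable_itv.
have mf : measurable_fun setT f.
  apply/(measurable_restrictT _ _).1; first exact: measurable_itv.
  exact: measurable_funTS.
have if_ : leb.-integrable setT (EFin \o f).
  have := (@integrable_mkcond _ (measurableTypeR R) _ leb _ (EFin \o u) mAB).1 iu.
  rewrite (_ : _ \_ _ = EFin \o f) //; apply/funext => x.
  by rewrite /f /= !patchE; case: ifP.
have F0 x : Rintegral leb `]-oo, x] f = 0.
  rewrite /f -Rintegral_mkcondr.
  have [xA|Ax] := leP x A.
    rewrite (_ : _ `&` _ = set0) ?Rintegral_set0 //.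
    apply/seteqP; split => // t [/=]; rewrite !in_itv /= => tx /andP[At _]; lra.
  have [xB|Bx] := ltP x B.
    rewrite (_ : _ `&` _ = `]A, x]%classic).
      rewrite -Rintegral_itv_bndo_bndc; last first.
        apply: (integrableS mAB) => //; apply: subset_itvl.
        by rewrite bnd_simp ltW.
      by apply: u0; rewrite Ax ltW.
    apply/seteqP; split => t /=; rewrite !in_itv /=.
      by move=> [-> /andP[-> _]].
    by move=> /andP[At tx]; rewrite At tx /=; split => //; lra.
  rewrite (_ : _ `&` _ = `]A, B[%classic).
    have [AB|BA] := ltP A B; first by apply: u0; rewrite AB lexx.
    by rewrite set_itv_ge ?Rintegral_set0 // bnd_simp -leNgt.
  apply/seteqP; split => t /=; rewrite !in_itv /=; first by case.
  by move=> /andP[At tB]; split; [lra|exact/andP].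
have H : {ae leb, forall x : R,
    derivable (fun y : R => Rintegral leb `]-oo, y] f) x 1 /\
    (fun y : R => Rintegral leb `]-oo, y] f)^`() x = f x}.
  apply: FTC1Ny; first by move=> y; apply: integrableS if_.
  by apply: integrable_locally => //; exact: openT.
apply: ae_mono H => x [_ E] ABx; move: E; rewrite /f patchE mem_set //.
rewrite (_ : (fun y => _) = fun=> 0); last exact/funext.
by rewrite derive1_const.
Qed.

(** Dominated convergence, the functions [p n] approximating the indicator
    function of [E]. *)
Lemma integral_zero_of_cutoffs u (D E : set R) (p : nat -> R -> R) :
  measurable D -> measurable E -> E `<=` D -> measurable_fun setT u ->
  leb.-integrable E (EFin \o u) -> (forall n, measurable_fun setT (p n)) ->
  (forall n x, 0 <= p n x <= 1) ->
  (forall n x, D x -> ~ E x -> p n x = 0) ->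
  (forall x, E x -> p ^~ x @ \oo --> (1 : R)) ->
  (forall n, Rintegral leb D (fun x => u x * p n x) = 0) ->
  Rintegral leb E u = 0.
Proof.
move=> mD mE ED mu iu mp p01 pout p1 u0.
have mup n S : measurable_fun S (fun x => u x * p n x).
  by apply: measurable_funTS; exact: measurable_funM.
have upE n : Rintegral leb E (fun x => u x * p n x) = 0.
  rewrite -[RHS](u0 n) Rintegral_mkcond [RHS]Rintegral_mkcond.
  apply: eq_Rintegral => x _; rewrite !patchE.
  have [Ex|nE] := pselect (E x); first by rewrite !mem_set //; exact: ED.
  rewrite (memNset nE); case: ifPn => // /set_mem Dx.
  by rewrite (pout _ _ Dx nE) mulr0.
have : (fun n => Rintegral leb E (fun x => u x * p n x)) @ \oo --> Rintegral leb E u.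
  apply: (@Rintegral_dominated_cvg _ _ _ leb E _ u (fun x => `|u x|)) => //.
  - by move=> n; exact: mup.
  - exact: measurable_funTS.
  - by move=> x Ex; rewrite -[X in _ --> X]mulr1; apply: cvgMl_tmp; exact: p1.
  - exact: integrable_norm.
  - move=> n x _; rewrite normrM ler_piMr //.
    by have /andP[? ?] := p01 n x; rewrite ger0_norm.
under eq_fun do rewrite upE.
by move=> H; apply: (real_cvg_unique H); exact: cvg_cst.
Qed.

Lemma scaled_flat_cutoff (g : R -> R) n : smooth g ->
  smooth (fun x => flat (n.+1%:R * g x)).
Proof.
move=> sg; have sf : smooth (@flat R) by exact: smooth_flat.
exact: (smooth_comp sf (smoothZ n.+1%:R sg)).
Qed.

(** The indicator function of [`]- N, x[] is the limit of products of two scaled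
    copies of [flat], each of which vanishes beyond one end of the interval. *)
Lemma line_uniqueness u : measurable_fun setT u ->
  (forall A B, leb.-integrable `]A, B[ (EFin \o u)) ->
  (forall p, test_fun p -> Rintegral leb setT (fun x => u x * p x) = 0) ->
  {ae leb, forall x, u x = 0}.
Proof.
move=> mu iu u0.
have H (N : nat) : {ae leb, forall x, `]- N%:R, N%:R[%classic x -> u x = 0}.
  apply: ae_zero_of_initial_integrals => // x /andP[Ax _].
  pose p n y := flat (n.+1%:R * (y + N%:R)) * flat (n.+1%:R * (x - y)).
  have sp n : smooth (p n).
    apply: smoothM; apply: scaled_flat_cutoff.
      exact: smoothD smooth_id (smooth_cst _).
    exact: smoothB (smooth_cst _) smooth_id.
  have pout n y : ~ `]- N%:R, x[%classic y -> p n y = 0.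
    move=> yE; rewrite /p; have [yN|Ny] := leP y (- N%:R).
      rewrite [flat (_ * (y + _))]flat_le0 ?mul0r //.
      by rewrite pmulr_rle0 ?ltr0n //; lra.
    rewrite [flat (_ * (x - y))]flat_le0 ?mulr0 //.
    rewrite pmulr_rle0 ?ltr0n // subr_le0 leNgt; apply/negP => yx.
    by apply: yE; rewrite /= in_itv /= Ny yx.
  apply: (@integral_zero_of_cutoffs u setT _ p) => //.
  - by move=> n; exact: smooth_measurable.
  - move=> n y; rewrite mulr_ge0 ?flat_ge0 //= mulr_ile1 ?flat_ge0 //; exact: flat_le1.
  - by move=> n y _; exact: pout.
  - move=> y /=; rewrite in_itv /= => /andP[Ny yx].
    rewrite -[X in _ --> X]mulr1; apply: cvgM.
      by apply: flat_cvg1; lra.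
    by apply: flat_cvg1; lra.
  - move=> n; apply: u0; split; first exact: sp.
    exists (N%:R + `|x|) => y; rewrite lter_normr => H; apply: pout.
    rewrite /= in_itv /= => /andP[H1 H2].
    have := ler_norm x; have := ler0n R N; have := normr_ge0 x.
    by case/orP: H => H; lra.
apply: ae_mono (ae_foralln H) => x Hx.
have [N HN] : exists N : nat, `|x| < N%:R.
  by exists (Num.bound `|x|); exact: archi_boundP.
by apply: (Hx N); rewrite /= in_itv /= -ltr_norml.
Qed.

Lemma periodic_test_cutoff (x : R) n :
  periodic_test_fun (fun t => flat (n.+1%:R * (sin (t / 2) * sin ((x - t) / 2)))).
Proof.
have sh : smooth (fun t : R => t / 2) by exact: smoothM smooth_id (smooth_cst _).
have sx : smooth (fun t : R => (x - t) / 2).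
  exact: smoothM (smoothB (smooth_cst _) smooth_id) (smooth_cst _).
split; first by apply: scaled_flat_cutoff; exact: smoothM (smooth_comp smooth_sin sh) (smooth_comp smooth_sin sx).
move=> t; rewrite (_ : (t + 2 * pi) / 2 = t / 2 + pi); last by field.
rewrite (_ : (x - (t + 2 * pi)) / 2 = (x - t) / 2 - pi); last by field.
have E (y : R) : sin (y - pi) = - sin y by rewrite -[in RHS](subrK pi y) sinDpi opprK.
by rewrite sinDpi E mulrNN.
Qed.

(** Under [t |-> t + 2 pi] both sines in the cutoff change their sign, so that
    their product is periodic; on the torus it is positive exactly on
    [`]0, x[]. *)
Lemma torus_uniqueness u : measurable_fun setT u ->
  leb.-integrable torus (EFin \o u) ->
  (forall p, periodic_test_fun p -> Rintegral leb torus (fun t => u t * p t) = 0) ->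
  {ae leb, forall t, torus t -> u t = 0}.
Proof.
move=> mu iu u0.
apply: ae_zero_of_initial_integrals => // x /andP[x0 xpi].
pose p n t : R := flat (n.+1%:R * (sin (t / 2) * sin ((x - t) / 2))).
have sub : (`]0, x[%classic : set R) `<=` torus.
  by apply: subset_itvl; rewrite bnd_simp.
apply: (@integral_zero_of_cutoffs u torus _ p) => //.
- exact: measurable_torus.
- have mt : @measurable _ (measurableTypeR R) torus by exact: measurable_torus.
  have mi : @measurable _ (measurableTypeR R) `]0, x[%classic by exact: measurable_itv.
  exact: (@integrableS _ (measurableTypeR R) _ leb _ _ _ mt mi sub iu).
- by move=> n; apply: smooth_measurable; exact: (periodic_test_cutoff x n).1.
- by move=> n t; rewrite flat_ge0 flat_le1.
- move=> n t tt nt; apply: flat_le0; rewrite pmulr_rle0 ?ltr0n //.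
  rewrite pmulr_rle0 ?sin_half_gt0 //.
  move: tt => /torusE /andP[t0 tpi].
  have xt : x <= t by rewrite leNgt; apply/negP => tx; apply: nt; rewrite /= in_itv /= t0.
  rewrite -oppr_ge0 -sinN; apply: sin_ge0_pi; apply/andP; split; lra.
- move=> t /= tx; apply: flat_cvg1; apply: mulr_gt0.
    by apply: sin_half_gt0; exact: sub.
  move: tx; rewrite in_itv /= => /andP[t0 tx].
  by apply: sin_gt0_pi; apply/andP; split; lra.
- by move=> n; apply: u0; exact: periodic_test_cutoff.
Qed.

End Uniqueness.

(** * Integration by parts without compact support *)

Section Cutoff.
Context {R : realType}.
Local Notation leb := (@lebesgue_measure R).

Definition bump (x : R) : R := flat (1 - x ^+ 2) / flat 1.

Lemma smooth_bump : smooth bump.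
Proof.
apply: smoothM (smooth_cst _); apply: (smooth_comp (@smooth_flat R)).
apply: smoothB (smooth_cst _) _.
exact: (smoothM smooth_id smooth_id).
Qed.

Lemma bump0 : bump 0 = 1.
Proof. by rewrite /bump expr0n subr0 divff // gt_eqF // flat_gt0. Qed.

Lemma bump_out x : 1 <= `|x| -> bump x = 0.
Proof.
move=> x1; rewrite /bump flat_le0 ?mul0r // subr_le0 -real_normK ?num_real //.
by rewrite expr_ge1.
Qed.

Lemma derive1_bump_out x : 1 < `|x| -> bump^`() x = 0.
Proof.
move=> x1; apply: derive1_eq.
refine (near_eq_is_derive _ (is_derive_const 0 x)).
near=> y; rewrite bump_out // ltW //.
near: y; apply: (@cvgr_gt _ _ _ _ (fun y : R => `|y|)) x1.
by apply: cvg_norm; exact: cvg_id.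
Unshelve. all: by end_near. Qed.

Lemma bounded_of_support (f : R -> R) : continuous f ->
  (forall x, 1 < `|x| -> f x = 0) -> exists M, forall x, `|f x| <= M.
Proof.
move=> cf f0; have N11 : -1 <= 1 :> R by lra.
have cnf : continuous (fun x => `|f x|).
  by move=> x; apply: cvg_norm; exact: cf.
have [m mI Hm] := EVT_max N11 (continuous_subspaceT cnf).
exists `|f m| => x; have [x1|x1] := ltP 1 `|x|; first by rewrite f0 // normr0.
by apply: Hm; rewrite in_itv /= -ler_norml.
Qed.

Definition cutoff (n : nat) (x : R) : R := bump (x / n.+1%:R).

Lemma smooth_cutoff n : smooth (cutoff n).
Proof.
apply: (smooth_comp smooth_bump).
exact: smoothM smooth_id (smooth_cst _).
Qed.

Arguments smooth_cutoff : clear implicits.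

Lemma derive1_cutoff n : (cutoff n)^`() = fun x => bump^`() (x / n.+1%:R) / n.+1%:R.
Proof.
have sd : smooth (fun x : R => x / n.+1%:R) by exact: smoothM smooth_id (smooth_cst _).
rewrite (derive1_comp_fun smooth_bump sd); apply/funext => x.
rewrite (derive1_mul smooth_id (smooth_cst _)) derive1_id derive1_const.
by rewrite mul1r mulr0 addr0.
Qed.

Lemma cutoff_out n x : n.+1%:R < `|x| -> cutoff n x = 0.
Proof.
move=> nx; rewrite /cutoff bump_out // normrM normfV [`|n.+1%:R|]ger0_norm //.
by rewrite ler_pdivlMr ?ltr0n // mul1r ltW.
Qed.

Lemma cvg_div_nat (x : R) : (fun n => x / n.+1%:R) @ \oo --> (0 : R).
Proof. by rewrite -[X in _ --> X](mulr0 x); apply: cvgMl_tmp; exact: cvg_harmonic. Qed.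

Lemma cutoff_cvg1 x : cutoff ^~ x @ \oo --> (1 : R).
Proof.
rewrite -bump0.
exact: (cvg_comp _ _ (cvg_div_nat x) (@smooth_continuous _ bump smooth_bump 0)).
Qed.

(** The test functions [cutoff n x * B x] have the derivative
    [(cutoff n)^`() x * B x + cutoff n x * B^`() x], and [(cutoff n)^`()] is of
    the size [1 / n]; dominated convergence does the rest. *)
Lemma weak_integration_by_parts (v v' B : R -> R) :
  measurable_fun setT v -> measurable_fun setT v' ->
  (forall p, test_fun p -> Rintegral leb setT (fun x => v x * p^`() x) =
     - Rintegral leb setT (fun x => v' x * p x)) ->
  smooth B ->
  leb.-integrable setT (EFin \o (fun x => v x * B x)) ->
  leb.-integrable setT (EFin \o (fun x => v' x * B x)) ->
  leb.-integrable setT (EFin \o (fun x => v x * B^`() x)) ->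
  Rintegral leb setT (fun x => v x * B^`() x) =
  - Rintegral leb setT (fun x => v' x * B x).
Proof.
move=> mv mv' weak sB iB i'B iB'.
have sB' := smooth_derive1 sB.
have mB : measurable_fun setT B by exact: smooth_measurable.
have mB' : measurable_fun setT B^`() by exact: smooth_measurable.
have mc n : measurable_fun setT (cutoff n) by apply: smooth_measurable; exact: smooth_cutoff.
have mc' n : measurable_fun setT (cutoff n)^`().
  by apply: smooth_measurable; exact: (smooth_derive1 (smooth_cutoff n)).
have [M HM] : exists M, forall x, `|bump x| <= M.
  apply: bounded_of_support (smooth_continuous smooth_bump) _ => x /ltW.
  exact: bump_out.
have [M' HM'] : exists M', forall x, `|bump^`() x| <= M'.
  exact: bounded_of_support (smooth_continuous (smooth_derive1 smooth_bump)) derive1_bump_out.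
have M0 : 0 <= M by exact: le_trans (HM 0).
have M'0 : 0 <= M' by exact: le_trans (HM' 0).
have E n x : (fun y => cutoff n y * B y)^`() x = (cutoff n)^`() x * B x + cutoff n x * B^`() x.
  by rewrite (derive1_mul (smooth_cutoff n) sB).
have H1 : (fun n => Rintegral leb setT (fun x => v x * (fun y => cutoff n y * B y)^`() x))
    @ \oo --> Rintegral leb setT (fun x => v x * B^`() x).
  apply: (@Rintegral_dominated_cvg _ _ _ leb setT _ _
    (fun x => M' * `|v x * B x| + M * `|v x * B^`() x|)) => //.
  - move=> n; apply: measurable_funM => //.
    rewrite (_ : derive1 _ = fun x => (cutoff n)^`() x * B x + cutoff n x * B^`() x).
      exact: (measurable_funD (measurable_funM (mc' n) mB) (measurable_funM (mc n) mB')).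
    by apply/funext => x; exact: E.
  - exact: measurable_funM.
  - move=> x _; under eq_fun do rewrite E derive1_cutoff.
    apply: cvgMl_tmp.
    rewrite -[X in _ --> X]add0r -[X in _ --> _ + X]mul1r -[X in _ --> X + _](mul0r (B x)).
    apply: cvgD; apply: cvgMr_tmp; last exact: cutoff_cvg1.
    rewrite -[X in _ --> X](mulr0 (bump^`() 0)); apply: cvgM; last exact: cvg_harmonic.
    exact: (cvg_comp _ _ (cvg_div_nat x)
      (@smooth_continuous _ _ (smooth_derive1 smooth_bump) 0)).
  - rewrite (_ : _ \o _ = fun x => ((M' * `|v x * B x|)%:E + (M * `|v x * B^`() x|)%:E)%E).
      apply: integrableD => //.
        exact: (integrableZl _ M' (integrable_norm iB)).
      exact: (integrableZl _ M (integrable_norm iB')).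
    by apply/funext => x /=; rewrite EFinD.
  - move=> n x _; rewrite E mulrDr (le_trans (ler_normD _ _)) // lerD //.
      rewrite mulrCA normrM ler_wpM2r // derive1_cutoff normrM normfV.
      rewrite [`|n.+1%:R|]ger0_norm // -[leRHS]mulr1 ler_pM //.
      by rewrite invf_le1 ?ltr0n // ler1n.
    by rewrite mulrCA normrM ler_wpM2r //; exact: HM.
have H2 : (fun n => Rintegral leb setT (fun x => v' x * (cutoff n x * B x)))
    @ \oo --> Rintegral leb setT (fun x => v' x * B x).
  apply: (@Rintegral_dominated_cvg _ _ _ leb setT _ _
    (fun x => M * `|v' x * B x|)) => //.
  - by move=> n; apply: measurable_funM => //; apply: measurable_funM => //; exact: mc.
  - exact: measurable_funM.
  - move=> x _; apply: cvgMl_tmp.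
    by rewrite -[X in _ --> X]mul1r; apply: cvgMr_tmp; exact: cutoff_cvg1.
  - exact: (integrableZl _ M (integrable_norm i'B)).
  - by move=> n x _; rewrite mulrCA normrM ler_wpM2r //; exact: HM.
apply: (real_cvg_unique H1).
under eq_fun => n.
  rewrite weak; first over.
  split; first exact: smoothM (smooth_cutoff n) sB.
  by exists n.+1%:R => x nx; rewrite cutoff_out ?mul0r.
exact: cvgN.
Qed.

End Cutoff.

Section RealIntegrals.
Context d (T : measurableType d) (R : realType).
Variables (mu : {measure set T -> \bar R}) (D : set T).
Hypothesis mD : measurable D.

Lemma integrable_bigsum (I : Type) (r : seq I) (f : I -> T -> R) :
  (forall i, mu.-integrable D (EFin \o f i)) ->
  mu.-integrable D (EFin \o (fun x => \sum_(i <- r) f i x)).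
Proof.
move=> H; elim: r => [|i r IH].
  rewrite (_ : _ \o _ = cst 0%E); first exact: integrable0.
  by apply/funext => x /=; rewrite big_nil.
rewrite (_ : _ \o _ = ((EFin \o f i) \+ (EFin \o (fun x => (\sum_(i <- r) f i x)%R)))%E).
  by apply: integrableD => //; exact: H.
by apply/funext => x /=; rewrite big_cons EFinD.
Qed.

Lemma Rintegral_bigsum (I : Type) (r : seq I) (f : I -> T -> R) :
  (forall i, mu.-integrable D (EFin \o f i)) ->
  Rintegral mu D (fun x => \sum_(i <- r) f i x) =
  \sum_(i <- r) Rintegral mu D (f i).
Proof.
move=> H; elim: r => [|i r IH].
  rewrite big_nil; under eq_Rintegral do rewrite big_nil.
  by rewrite /Rintegral integral0.
under eq_Rintegral do rewrite big_cons.
by rewrite RintegralD // ?big_cons ?IH //; exact: integrable_bigsum.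
Qed.

Lemma integrable_bounded_mul (f g : T -> R) (M : R) : measurable_fun D g ->
  mu.-integrable D (EFin \o f) -> (forall x, D x -> `|g x| <= M) ->
  mu.-integrable D (EFin \o (fun x => f x * g x)).
Proof.
move=> mg iif gM.
have mf : measurable_fun D f by apply/measurable_EFinP; exact: measurable_int iif.
apply: (le_integrable mD _ _ (integrableZl mD M (integrable_norm iif))).
  by apply/measurable_EFinP; exact: measurable_funM.
move=> x Dx /=; rewrite lee_fin normrM mulrC normrM normr_id.
rewrite ler_wpM2r //; exact: le_trans (gM x Dx) (ler_norm _).
Qed.

End RealIntegrals.

(** * The derivatives of the transformed function *)

Section TransformedDerivatives.
Context {R : realType}.
Local Notation leb := (@lebesgue_measure R).
Variables (c : R) (rho : R -> R).
Hypotheses (c0 : 0 < c) (rhoS : schwartz_mon_pos rho).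

Let rho0 x : 0 < rho x. Proof. by have [_ + _] := rhoS; exact. Qed.

(** [coef tau k] is the factor of the [k]-th derivative of [u] in the [tau]-th
    derivative of [t |-> (u * rho * quad c) (mob c t)], divided by [quad c]:
    since [mob c] has derivative [- quad c (mob c t)], a derivative in [t] is
    [- quad c] times a derivative in [x = mob c t]. *)
Fixpoint coef (tau k : nat) : R -> R :=
  if tau is tau'.+1 then
    fun x => - ((if k is k'.+1 then coef tau' k' x * quad c x else 0) +
                (fun y => coef tau' k y * quad c y)^`() x)
  else if k is 0%N then rho else fun=> 0.

Lemma admissible_zero : admissible rho (fun=> 0).
Proof.
have := admissibleZ 0 (admissible_weight rhoS).
by under eq_fun do rewrite mul0r.
Qed.

Lemma admissible_mul_quad A : admissible rho A ->
  admissible rho (fun x => A x * quad c x).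
Proof.
move=> aA; have r0 x : 0 <= rho x by exact/ltW.
have := admissibleD (admissibleZ (c / 2) aA)
  (admissibleZ (2 * c)^-1 (admissible_mulx r0 (admissible_mulx r0 aA))).
congr admissible; apply/funext => x; rewrite /quad; field.
by rewrite gt_eqF.
Qed.

Lemma coef_admissible tau k : admissible rho (coef tau k).
Proof.
elim: tau k => [[|k]|tau IH k] /=.
- exact: admissible_weight.
- exact: admissible_zero.
have H := admissibleZ (-1) (admissibleD
  (_ : admissible rho (fun x => if k is k'.+1 then coef tau k' x * quad c x else 0))
  (admissible_derive1 (admissible_mul_quad (IH k)))).
have {}H := H _; under eq_fun do rewrite -mulN1r.
apply: H; case: k => [|k]; first exact: admissible_zero.
exact: admissible_mul_quad.
Qed.

Lemma coef_out tau k : (tau < k)%N -> coef tau k = fun=> 0.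
Proof.
elim: tau k => [|tau IH] [|k] //= tk.
rewrite IH // IH; last exact: ltnW.
apply/funext => x; rewrite mul0r add0r.
under eq_fun do rewrite mul0r.
by rewrite derive1_const oppr0.
Qed.

Definition combination (v : nat -> R -> R) tau (x : R) : R :=
  \sum_(k < tau.+1) v k x * coef tau k x.

Definition qcoef tau k (x : R) : R := coef tau k x * quad c x.

Lemma qcoef_admissible tau k : admissible rho (qcoef tau k).
Proof. exact/admissible_mul_quad/coef_admissible. Qed.

(** The product rule, in which the derivative of [v k] is [v k.+1]; in this form
    the terms are ready for integration by parts one by one. *)
Lemma combinationS v tau x : combination v tau.+1 x =
  - \sum_(k < tau.+1) (v k.+1 x * qcoef tau k x + v k x * (qcoef tau k)^`() x).
Proof.
rewrite /combination big_split /= opprD.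
rewrite (eq_bigr (fun k : 'I_tau.+2 =>
  - (v k x * (if val k is k'.+1 then qcoef tau k' x else 0)) +
  - (v k x * (qcoef tau k)^`() x))); last first.
  by move=> [[|k] kt] _ /=; rewrite /qcoef; ring.
rewrite big_split /=; congr (_ + _).
  rewrite big_ord_recl /= mulr0 oppr0 add0r -sumrN.
  by apply: eq_bigr => k _.
rewrite big_ord_recr /= -sumrN [X in _ + X](_ : _ = 0) ?addr0 //.
rewrite /qcoef coef_out //; under eq_fun do rewrite mul0r.
by rewrite derive1_const mulr0 oppr0.
Qed.

Lemma admissible_bound A : admissible rho A -> exists2 M : R, 0 < M &
  forall x, A x ^+ 2 * quad c x <= M * rho x.
Proof.
move=> [_ HA]; have [M HM] := HA 0%N 0%N; have [N HN] := HA 1%N 0%N.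
exists (1 + `|c / 2 * M + (2 * c)^-1 * N|); first by rewrite ltr_wpDr.
move=> x; have := HM x; have := HN x; rewrite derive1n0 mul1r expr1 exprMn => H1 H2.
rewrite (_ : _ * quad c x = c / 2 * A x ^+ 2 + (2 * c)^-1 * (x ^+ 2 * A x ^+ 2)); last first.
  by rewrite /quad; field; rewrite gt_eqF.
have H3 : c / 2 * A x ^+ 2 <= c / 2 * (M * rho x) by rewrite ler_wpM2l // divr_ge0 ?ltW.
have H4 : (2 * c)^-1 * (x ^+ 2 * A x ^+ 2) <= (2 * c)^-1 * (N * rho x).
  by rewrite ler_wpM2l // invr_ge0 mulr_ge0 // ltW.
apply: (le_trans (lerD H3 H4)).
rewrite !mulrA -mulrDl ler_wpM2r ?(ltW (rho0 x)) //.
by rewrite (le_trans (ler_norm _)) // lerDr.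
Qed.

(** The transformed derivative at [t] is [combination v tau x * quad c x] with
    [x = mob c t], and [dt] corresponds to [dx / quad c x]: the left-hand side
    is the density in [x] of its square. *)
Lemma combination_bound tau : exists2 C : R, 0 < C & forall v x,
  combination v tau x ^+ 2 * quad c x <=
  C * \sum_(k < tau.+1) v k x ^+ 2 * rho x.
Proof.
rewrite /combination; elim: tau.+1 => [|n [C C0 HC]].
  by exists 1 => // v x; rewrite !big_ord0 expr0n mul0r mulr0.
have [M M0 HM] := admissible_bound (coef_admissible tau n).
exists (2 * C + 2 * M); first by rewrite addr_gt0 ?mulr_gt0.
move=> v x; rewrite !big_ord_recr /=.
have := HC v x; have := HM x; set s := \sum_(k < n) _; set r := \sum_(k < n) _.
set a := coef tau n x; set q := quad c x => H1 H2.
have q0 : 0 < q by exact: quad_gt0.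
have r0 : 0 <= r.
  by apply: sumr_ge0 => k _; rewrite mulr_ge0 ?sqr_ge0 // ltW.
have H3 : v n x ^+ 2 * (a ^+ 2 * q) <= v n x ^+ 2 * (M * rho x).
  by rewrite ler_wpM2l ?sqr_ge0.
have H4 : 0 <= (s - v n x * a) ^+ 2 * q by rewrite mulr_ge0 ?sqr_ge0 // ltW.
have H5 : 0 <= v n x ^+ 2 * rho x by rewrite mulr_ge0 ?sqr_ge0 // ltW.
have H6 : 0 <= C * (v n x ^+ 2 * rho x) by rewrite mulr_ge0 // ltW.
have H7 : 0 <= M * r by rewrite mulr_ge0 // ltW.
rewrite [leLHS](_ : _ = 2 * (s ^+ 2 * q) + 2 * (v n x ^+ 2 * (a ^+ 2 * q)) -
  (s - v n x * a) ^+ 2 * q); last by ring.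
by lra.
Qed.

(** The integral is the total length of the torus. *)
Lemma integrable_inv_quad : leb.-integrable setT (EFin \o (fun x => (quad c x)^-1)).
Proof.
have mq : measurable_fun [set: R] (fun x => (quad c x)^-1).
  apply: (measurableT_comp (@measurable_inv R)).
  exact: (smooth_measurable (@smooth_quad _ c)).
apply/integrableP; split; first exact/measurable_EFinP.
under eq_integral do rewrite /= ger0_norm ?invr_ge0 ?(ltW (quad_gt0 _ c0)) //.
rewrite (ge0_integral_pull c0) //; last by move=> x; rewrite invr_ge0 ltW // quad_gt0.
rewrite (eq_integral (fun=> 1%E)); last first.
  by move=> t _; rewrite /pull mulVf // gt_eqF // quad_gt0.
rewrite integral_cst; last exact: measurable_torus.
have H : (leb `]0%R, (2 * pi)%R[%classic < +oo)%E.
  by rewrite lebesgue_measure_itv /=; case: ifP => _; rewrite ?ltry // -EFinB ltry.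
by rewrite mul1e; exact: H.
Qed.

(** The product is at most [v ^+ 2 * rho + A ^+ 2 / rho], whose second term is
    at most a multiple of [1 / quad]. *)
Lemma integrable_mul_admissible (v A : R -> R) : measurable_fun setT v ->
  leb.-integrable setT (EFin \o (fun x => v x ^+ 2 * rho x)) ->
  admissible rho A ->
  leb.-integrable setT (EFin \o (fun x => v x * A x)).
Proof.
move=> mv iv aA; have [M M0 HM] := admissible_bound aA.
have mA : measurable_fun setT A by exact: (smooth_measurable aA.1).
have i1 : leb.-integrable setT
    (EFin \o (fun x => v x ^+ 2 * rho x + M * (quad c x)^-1)).
  rewrite (_ : _ \o _ = (EFin \o (fun x => v x ^+ 2 * rho x)%R) \+
    (fun x => M%:E * (EFin \o (fun x => (quad c x)^-1)%R) x))%E //.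
  apply: integrableD => //; apply: integrableZl => //; exact: integrable_inv_quad.
apply: (le_integrable _ _ _ i1) => //.
  by apply/measurable_EFinP; exact: measurable_funM.
move=> x _ /=; rewrite lee_fin.
have q0 := quad_gt0 x c0; have r0 := rho0 x.
rewrite [leRHS]ger0_norm; last first.
  by rewrite addr_ge0 // mulr_ge0 ?sqr_ge0 ?invr_ge0 ?ltW.
have H : A x ^+ 2 / rho x <= M / quad c x.
  by rewrite ler_pdivrMr // mulrAC ler_pdivlMr.
apply: le_trans (_ : v x ^+ 2 * rho x + A x ^+ 2 / rho x <= _); last by rewrite lerD2l.
rewrite normrM -(ler_pM2r r0) mulrDl mulfVK ?gt_eqF //.
rewrite -[v x ^+ 2]real_normK ?num_real // -[A x ^+ 2]real_normK ?num_real //.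
set a := `|v x|; set b := `|A x|; set r := rho x.
have := sqr_ge0 (a * r - b); have : 0 <= a * b * r.
  by rewrite mulr_ge0 ?mulr_ge0 ?normr_ge0 // ltW.
nra.
Qed.

Lemma bounded_on_torus (p : R -> R) : continuous p ->
  exists M, forall t, torus t -> `|p t| <= M.
Proof.
move=> cp; have pi0 : 0 <= 2 * pi :> R by rewrite mulr_ge0 ?pi_ge0.
have cn : continuous (fun x => `|p x|) by move=> x; apply: cvg_norm; exact: cp.
have [m _ Hm] := EVT_max pi0 (continuous_subspaceT cn).
exists `|p m| => t /torusE /andP[t0 tpi]; apply: Hm.
by rewrite in_itv /= !ltW.
Qed.

Section WeakDerivatives.
Variables (alpha : nat) (v : nat -> R -> R).
Hypothesis mv : forall k, (k <= alpha)%N -> measurable_fun setT (v k).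
Hypothesis iv : forall k, (k <= alpha)%N ->
  leb.-integrable setT (EFin \o (fun x => v k x ^+ 2 * rho x)).
Hypothesis weak : forall k, (k < alpha)%N -> forall p, test_fun p ->
  Rintegral leb setT (fun x => v k x * p^`() x) =
  - Rintegral leb setT (fun x => v k.+1 x * p x).

Lemma measurable_combination tau : (tau <= alpha)%N ->
  measurable_fun setT (combination v tau).
Proof.
move=> ta; apply: measurable_sum => k; apply: measurable_funM.
  by apply: mv; rewrite (leq_trans _ ta) // -ltnS.
exact: (smooth_measurable (coef_admissible _ _).1).
Qed.

Lemma integrable_combination tau : (tau <= alpha)%N ->
  leb.-integrable setT (EFin \o combination v tau).
Proof.
move=> ta; apply: (@integrable_bigsum _ _ _ leb setT measurableT 'I_tau.+1 _
  (fun k x => v k x * coef tau k x)) => -[k kt].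
have ka : (k <= alpha)%N by rewrite (leq_trans _ ta) // -ltnS.
by apply: integrable_mul_admissible; [exact: mv|exact: iv|exact: coef_admissible].
Qed.

(** In the variable [x = mob c t] a periodic test function [p] becomes
    [p (ang c x)], which is bounded but has no compact support: it is the decay
    of the coefficients that justifies the integration by parts of each term of
    the combination. *)
Lemma torus_weak_step tau p : (tau < alpha)%N -> periodic_test_fun p ->
  Rintegral leb torus (fun t => pull c (combination v tau) t * p^`() t) =
  - Rintegral leb torus (fun t => pull c (combination v tau.+1) t * p t).
Proof.
move=> ta [sp _].
have sp' := smooth_derive1 sp.
have sang : smooth (ang c) by exact: smooth_ang.
pose psi x := p (ang c x); pose psi1 x := p^`() (ang c x).
have spsi : smooth psi by exact: smooth_comp sp sang.
have spsi1 : smooth psi1 by exact: smooth_comp sp' sang.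
have psi'E x : psi^`() x = - psi1 x / quad c x.
  apply: derive1_eq.
  have := @is_derive_comp _ p (ang c) x _ _ (smooth_is_derive _ sp) (is_derive_ang x c0).
  by move=> H; apply: is_derive_eq H _; rewrite mulrN mulNr.
have [M HM] := bounded_on_torus (smooth_continuous sp).
have [M' HM'] := bounded_on_torus (smooth_continuous sp').
have psiM x : `|psi x| <= M by apply: HM; exact: ang_torus.
have psi1M x : `|psi1 x| <= M' by apply: HM'; exact: ang_torus.
have mpsi : measurable_fun setT psi by exact: smooth_measurable.
have mpsi1 : measurable_fun setT psi1 by exact: smooth_measurable.
have move_line (r : R -> R) G : smooth r -> measurable_fun setT G ->
    Rintegral leb torus (fun t => pull c G t * r t) =
    Rintegral leb setT (fun x => G x * r (ang c x)).
  move=> sr mG; rewrite /Rintegral (integral_pull c0); last first.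
    apply: measurable_funM => //; apply: smooth_measurable.
    exact: smooth_comp sr sang.
  congr fine; apply: eq_integral => t /set_mem tt; congr EFin.
  by rewrite /pull mobK // mulrAC.
rewrite !move_line //; last 2 first.
- exact: measurable_combination.
- by apply: measurable_combination; exact: ltnW.
rewrite -/psi.
have kle k : (k < tau.+1)%N -> (k <= alpha)%N by move=> kt; rewrite (leq_trans _ (ltnW ta)) // -ltnS.
have klt k : (k < tau.+1)%N -> (k < alpha)%N by move=> kt; rewrite (leq_trans kt).
have sE k : smooth (qcoef tau k) by exact: (qcoef_admissible tau k).1.
have iE k l : (k <= alpha)%N -> leb.-integrable setT (EFin \o (fun x => v k x * qcoef tau l x * psi x)).
  move=> ka; apply: (@integrable_bounded_mul _ _ _ leb setT measurableT (fun x => v k x * qcoef tau l x) psi M) => //.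
  apply: integrable_mul_admissible; [exact: mv|exact: iv|exact: qcoef_admissible].
have iE' k : (k <= alpha)%N -> leb.-integrable setT (EFin \o (fun x => v k x * (qcoef tau k)^`() x * psi x)).
  move=> ka; apply: (@integrable_bounded_mul _ _ _ leb setT measurableT (fun x => v k x * (qcoef tau k)^`() x) psi M) => //.
  apply: integrable_mul_admissible; [exact: mv|exact: iv|].
  exact: admissible_derive1 (qcoef_admissible _ _).
have i1 k : (k <= alpha)%N -> leb.-integrable setT (EFin \o (fun x => v k x * coef tau k x * psi1 x)).
  move=> ka; apply: (@integrable_bounded_mul _ _ _ leb setT measurableT (fun x => v k x * coef tau k x) psi1 M') => //.
  apply: integrable_mul_admissible; [exact: mv|exact: iv|exact: coef_admissible].
transitivity (\sum_(k < tau.+1) (Rintegral leb setT (fun x => v k.+1 x * qcoef tau k x * psi x) +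
    Rintegral leb setT (fun x => v k x * (qcoef tau k)^`() x * psi x))).
  rewrite (_ : (fun x => combination v tau x * _) =
    fun x => \sum_(k < tau.+1) v k x * coef tau k x * psi1 x); last first.
    by apply/funext => x; rewrite /combination mulr_suml.
  rewrite (@Rintegral_bigsum _ _ _ leb setT measurableT 'I_tau.+1 _
    (fun k x => v k x * coef tau k x * psi1 x)); last by case=> k kt; exact: (i1 _ (kle _ kt)).
  apply: eq_bigr => -[k kt] _ /=.
  have BE x : (fun y => qcoef tau k y * psi y)^`() x =
      (qcoef tau k)^`() x * psi x - coef tau k x * psi1 x.
    rewrite (derive1_mul (sE k) spsi) psi'E /qcoef.
    by field; rewrite gt_eqF // quad_gt0.
  have H := @weak_integration_by_parts _ (v k) (v k.+1) (fun y => qcoef tau k y * psi y)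
    (mv (kle k kt)) (mv (klt k kt)) (weak (klt k kt)) (smoothM (sE k) spsi).
  rewrite [X in X + _](_ : _ = - Rintegral leb setT (fun x => v k x * (fun y => qcoef tau k y * psi y)^`() x)).
    under [X in - X + _]eq_Rintegral do rewrite BE mulrBr !mulrA.
    rewrite RintegralB //; [by ring|exact: iE' (kle _ kt)|exact: i1 (kle _ kt)].
  rewrite H ?opprK.
  - by apply: eq_Rintegral => x _; rewrite mulrA.
  - by under eq_fun do rewrite mulrA; exact: iE (kle _ kt).
  - by under eq_fun do rewrite mulrA; exact: iE (klt _ kt).
  - under eq_fun do rewrite BE mulrBr !mulrA.
    have := integrableB measurableT (iE' _ (kle _ kt)) (i1 _ (kle _ kt)).
    by [].
rewrite (_ : (fun x => combination v tau.+1 x * _) =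
  fun x => - (\sum_(k < tau.+1) (v k.+1 x * qcoef tau k x * psi x + v k x * (qcoef tau k)^`() x * psi x))); last first.
  apply/funext => x; rewrite combinationS mulNr mulr_suml; congr (- _).
  by apply: eq_bigr => k _; rewrite mulrDl.
have isum (k : 'I_tau.+1) : leb.-integrable setT (EFin \o
    (fun x => v k.+1 x * qcoef tau k x * psi x + v k x * (qcoef tau k)^`() x * psi x)).
  case: k => k kt /=; have := integrableD measurableT (iE k.+1 k (klt _ kt)) (iE' _ (kle _ kt)).
  by [].
rewrite (_ : Rintegral _ _ (fun x => - _) = - Rintegral leb setT
  (fun x => \sum_(k < tau.+1) (v k.+1 x * qcoef tau k x * psi x + v k x * (qcoef tau k)^`() x * psi x))); last first.
  under eq_Rintegral do rewrite -mulN1r.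
  rewrite RintegralZl ?mulN1r //.
  exact: (@integrable_bigsum _ _ _ leb setT measurableT 'I_tau.+1 _ (fun k x =>
    v k.+1 x * qcoef tau k x * psi x + v k x * (qcoef tau k)^`() x * psi x)).
rewrite opprK (@Rintegral_bigsum _ _ _ leb setT measurableT 'I_tau.+1 _ (fun k x =>
    v k.+1 x * qcoef tau k x * psi x + v k x * (qcoef tau k)^`() x * psi x)) //.
apply: eq_bigr => -[k kt] _ /=.
by rewrite RintegralD //; [exact: iE (klt _ kt)|exact: iE' (kle _ kt)].
Qed.

Lemma periodic_test_derive1 (p : R -> R) : periodic_test_fun p -> periodic_test_fun p^`().
Proof.
move=> [sp pp]; split; first exact: smooth_derive1.
move=> x; apply/esym/derive1_eq.
have ds : is_derive x 1 (fun y : R => y + 2 * pi) (1 + 0).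
  by apply: is_derive_add; exact: is_derive_const.
have := @is_derive_comp _ p (fun y => y + 2 * pi) x _ _ (smooth_is_derive _ sp) ds.
rewrite (_ : (fun y => p (y + _)) = p); last exact/funext.
by rewrite addr0 mulr1.
Qed.

Lemma torus_weak_derivative tau p : (tau <= alpha)%N -> periodic_test_fun p ->
  Rintegral leb torus (fun t => pull c (combination v 0) t * derive1n tau p t) =
  (-1) ^+ tau * Rintegral leb torus (fun t => pull c (combination v tau) t * p t).
Proof.
elim: tau p => [|tau IH] p ta pp; first by rewrite expr0 mul1r.
rewrite /derive1n iterSr -/(derive1n tau _) IH; [|exact: ltnW|exact: periodic_test_derive1].
by rewrite torus_weak_step // exprS mulN1r mulNr mulrN.
Qed.

End WeakDerivatives.
End TransformedDerivatives.

(** * Complex-valued functions and their real parts *)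

Local Open Scope complex_scope.

Section ComplexNumbers.
Context {R : realType}.
Implicit Types z w : R[i].

Lemma ReD z w : complex.Re (z + w) = complex.Re z + complex.Re w.
Proof. by case: z; case: w. Qed.

Lemma ImD z w : complex.Im (z + w) = complex.Im z + complex.Im w.
Proof. by case: z; case: w. Qed.

Lemma ReN z : complex.Re (- z) = - complex.Re z.
Proof. by case: z. Qed.

Lemma ReM z w :
  complex.Re (z * w) = complex.Re z * complex.Re w - complex.Im z * complex.Im w.
Proof. by case: z; case: w. Qed.

Lemma ImM z w :
  complex.Im (z * w) = complex.Re z * complex.Im w + complex.Im z * complex.Re w.
Proof. by case: z; case: w. Qed.

Lemma Re_conj z : complex.Re z^* = complex.Re z.
Proof. by case: z. Qed.

Lemma Im_conj z : complex.Im z^* = - complex.Im z.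
Proof. by case: z. Qed.

Lemma Re_sum (I : Type) (r : seq I) (F : I -> R[i]) :
  complex.Re (\sum_(i <- r) F i) = \sum_(i <- r) complex.Re (F i).
Proof. by elim: r => [|i r IH]; rewrite ?big_nil // !big_cons ReD IH. Qed.

Lemma Im_sum (I : Type) (r : seq I) (F : I -> R[i]) :
  complex.Im (\sum_(i <- r) F i) = \sum_(i <- r) complex.Im (F i).
Proof. by elim: r => [|i r IH]; rewrite ?big_nil // !big_cons ImD IH. Qed.

Lemma complex_eta z : z = complex.Re z +i* complex.Im z.
Proof. by case: z. Qed.

Lemma sign_mul_complex (k : nat) (a b : R) :
  (-1) ^+ k * (a +i* b) = ((-1) ^+ k * a) +i* ((-1) ^+ k * b).
Proof.
elim: k => [|k IH]; first by rewrite !expr0 !mul1r.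
by rewrite !exprS -!mulrA IH !mulN1r.
Qed.

Lemma sqnorm_ge0 z : 0 <= sqnorm z.
Proof. by rewrite addr_ge0 ?sqr_ge0. Qed.

Lemma Re_mul_conj z : complex.Re (z * z^*) = sqnorm z.
Proof. by case: z => a b; rewrite /sqnorm /=; ring. Qed.

Lemma sqnormM z w : sqnorm (z * w) = sqnorm z * sqnorm w.
Proof. by case: z => a b; case: w => e f; rewrite /sqnorm /=; ring. Qed.

Lemma sqnorm_real (r : R) : sqnorm r%:C = r ^+ 2.
Proof. by rewrite /sqnorm /=; ring. Qed.

Lemma abs_Re_le z : `|complex.Re z| <= Num.sqrt (sqnorm z).
Proof. by rewrite -sqrtr_sqr; apply: ler_wsqrtr; rewrite lerDl sqr_ge0. Qed.

Lemma abs_Im_le z : `|complex.Im z| <= Num.sqrt (sqnorm z).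
Proof. by rewrite -sqrtr_sqr; apply: ler_wsqrtr; rewrite lerDr sqr_ge0. Qed.

Lemma sqrt_sqnorm_le z : Num.sqrt (sqnorm z) <= `|complex.Re z| + `|complex.Im z|.
Proof.
rewrite -[leRHS]ger0_norm ?addr_ge0 // -sqrtr_sqr; apply: ler_wsqrtr.
rewrite /sqnorm -(real_normK (num_real (complex.Re z))) -(real_normK (num_real (complex.Im z))).
have : 0 <= `|complex.Re z| * `|complex.Im z| by rewrite mulr_ge0.
by nra.
Qed.

End ComplexNumbers.

Section ComplexIntegrals.
Context d (T : measurableType d) (R : realType).
Variable mu : {measure set T -> \bar R}.
Implicit Types (f g : T -> R[i]) (v w p : T -> R).

Lemma ae_eq_cintegral (A : set T) f g :
  {ae mu, forall x, A x -> f x = g x} -> cintegral mu A f = cintegral mu A g.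
Proof.
move=> fg; congr (fine _ +i* fine _); apply: ae_eq_lower_integral;
  by apply: ae_mono fg => x H Ax; rewrite H.
Qed.

Lemma cintegral_mul_real (A : set T) v w p :
  cintegral mu A (fun x => (v x +i* w x) * (p x)%:C) =
  Rintegral mu A (fun x => v x * p x) +i* Rintegral mu A (fun x => w x * p x).
Proof.
congr (_ +i* _); apply: eq_Rintegral => x _ /=; ring.
Qed.

Lemma measurable_sqnorm (A : set T) v w :
  measurable_fun A v -> measurable_fun A w ->
  measurable_fun A (fun x => sqnorm (v x +i* w x)).
Proof. by move=> mv mw; apply: measurable_funD; apply: measurable_funX. Qed.

Lemma measurable_sqrt_sqnorm (A : set T) v w :
  measurable_fun A v -> measurable_fun A w ->
  measurable_fun A (fun x => Num.sqrt (sqnorm (v x +i* w x))).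
Proof.
move=> mv mw.
apply: (measurableT_comp (continuous_measurable_fun (@sqrt_continuous R))).
exact: measurable_sqnorm.
Qed.

Lemma ae_measurable_ae (A : set T) f g :
  {ae mu, forall x, A x -> f x = g x} -> ae_measurable mu A g -> ae_measurable mu A f.
Proof.
move=> fg [h [mr mi gh]]; exists h; split => //.
by apply: ae_mono2 fg gh => x H H' Ax; rewrite H ?H'.
Qed.

Lemma ae_measurable_cpx (A : set T) v w :
  measurable_fun A v -> measurable_fun A w -> ae_measurable mu A (fun x => v x +i* w x).
Proof. by move=> mv mw; exists (fun x => v x +i* w x); split => //; apply: aeW. Qed.

(** Cutting off outside of [A] makes the representatives measurable everywhere. *)
Lemma ae_measurable_rep (A : set T) f : measurable A -> ae_measurable mu A f ->
  exists v w, [/\ measurable_fun setT v, measurable_fun setT w &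
    {ae mu, forall x, A x -> f x = v x +i* w x}].
Proof.
move=> mA [h [mr mi fh]].
exists ((fun x => complex.Re (h x)) \_ A), ((fun x => complex.Im (h x)) \_ A); split.
- exact/(measurable_restrictT _ _).1.
- exact/(measurable_restrictT _ _).1.
- apply: ae_mono fh => x H Ax; rewrite !patchE mem_set //= H //.
  exact: complex_eta.
Qed.

Lemma integrable_parts (A : set T) f v w : measurable A ->
  measurable_fun setT v -> measurable_fun setT w ->
  {ae mu, forall x, A x -> f x = v x +i* w x} ->
  (\int[mu]_(x in A) (Num.sqrt (sqnorm (f x)))%:E < +oo)%E ->
  mu.-integrable A (EFin \o v) /\ mu.-integrable A (EFin \o w).
Proof.
move=> mA mv mw fvw ifin.
have E : (\int[mu]_(x in A) (Num.sqrt (sqnorm (f x)))%:E =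
    \int[mu]_(x in A) (Num.sqrt (sqnorm (v x +i* w x)))%:E)%E.
  by apply: ae_eq_lower_integral; apply: ae_mono fvw => x H Ax; rewrite H.
have ms : measurable_fun A (fun x => Num.sqrt (sqnorm (v x +i* w x))).
  by apply: measurable_sqrt_sqnorm; exact: measurable_funTS.
split; apply/integrableP; split.
- by apply/measurable_EFinP; exact: measurable_funTS.
- apply: le_lt_trans ifin; rewrite E; apply: ge0_le_integral => //.
  + by apply/measurable_EFinP; apply: measurableT_comp => //; exact: measurable_funTS.
  + exact/measurable_EFinP.
  + by move=> x _; rewrite lee_fin; exact: (abs_Re_le (v x +i* w x)).
- by apply/measurable_EFinP; exact: measurable_funTS.
- apply: le_lt_trans ifin; rewrite E; apply: ge0_le_integral => //.
  + by apply/measurable_EFinP; apply: measurableT_comp => //; exact: measurable_funTS.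
  + exact/measurable_EFinP.
  + by move=> x _; rewrite lee_fin; exact: (abs_Im_le (v x +i* w x)).
Qed.

Lemma integral_sqrt_sqnorm_lty (A : set T) f v w : measurable A ->
  measurable_fun setT v -> measurable_fun setT w ->
  {ae mu, forall x, A x -> f x = v x +i* w x} ->
  mu.-integrable A (EFin \o v) -> mu.-integrable A (EFin \o w) ->
  (\int[mu]_(x in A) (Num.sqrt (sqnorm (f x)))%:E < +oo)%E.
Proof.
move=> mA mv mw fvw iv iw.
rewrite (@ae_eq_lower_integral _ _ _ mu A _
  (fun x => (Num.sqrt (sqnorm (v x +i* w x)))%:E)); last first.
  by apply: ae_mono fvw => x H Ax; rewrite H.
have := integrableD mA (integrable_norm iv) (integrable_norm iw).
move=> /integrableP[_]; apply: le_lt_trans; apply: ge0_le_integral => //.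
- apply/measurable_EFinP; apply: measurable_sqrt_sqnorm; exact: measurable_funTS.
- apply: measurableT_comp => //; apply: emeasurable_funD;
    apply/measurable_EFinP; apply: measurableT_comp => //; exact: measurable_funTS.
- move=> x _; rewrite lee_fin /= ger0_norm ?addr_ge0 //.
  exact: (sqrt_sqnorm_le (v x +i* w x)).
Qed.

End ComplexIntegrals.

(** * Real representatives of the weak derivatives *)

Section LineRepresentation.
Context {R : realType}.
Local Notation leb := (@lebesgue_measure R).

Lemma test_fun_derive1 (p : R -> R) : test_fun p -> test_fun p^`().
Proof.
move=> [sp [M HM]]; split; first exact: smooth_derive1.
exists M => x Mx; apply: derive1_eq.
refine (near_eq_is_derive _ (is_derive_const 0 x)).
near=> y; rewrite HM //.
near: y; apply: (@cvgr_gt _ _ _ _ (fun y : R => `|y|)) Mx.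
by apply: cvg_norm; exact: cvg_id.
Unshelve. all: by end_near. Qed.

Lemma integrable_mul_test (u p : R -> R) : measurable_fun setT u ->
  (forall A B, leb.-integrable `]A, B[ (EFin \o u)) -> test_fun p ->
  leb.-integrable setT (EFin \o (fun x => u x * p x)).
Proof.
move=> mu iu [sp [M HM]].
pose N := 1 + `|M|.
have N0 : - N <= N by rewrite /N; have := normr_ge0 M; lra.
have cn : continuous (fun x => `|p x|).
  by move=> x; apply: cvg_norm; exact: (smooth_continuous sp).
have [m _ Hm] := EVT_max N0 (continuous_subspaceT cn).
have pM x : `|p x| <= `|p m|.
  have [xN|Nx] := leP `|x| N; first by apply: Hm; rewrite in_itv /= -ler_norml.
  rewrite HM ?normr0 // (lt_trans _ Nx) // /N.
  by have := ler_norm M; lra.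
have mI : @measurable _ (measurableTypeR R) `](- N), N[%classic by exact: measurable_itv.
have i1 := (@integrable_mkcond _ (measurableTypeR R) _ leb _ (EFin \o u) mI).1 (iu (- N) N).
have E : (fun x => u x * p x) = (fun x => (u \_ `](- N), N[) x * p x).
  apply/funext => x; rewrite patchE; case: ifPn => // /negP H.
  rewrite HM ?mulr0 // ltNge; apply/negP => xM; apply: H; apply/mem_set.
  rewrite /= in_itv /= -ltr_norml /N (le_lt_trans xM) //.
  by have := ler_norm M; lra.
rewrite E.
apply: (@integrable_bounded_mul _ _ _ leb setT measurableT (u \_ `](- N), N[) p `|p m|) => //.
  by apply: measurable_funTS; exact: (smooth_measurable sp).
rewrite (_ : _ \o _ = (EFin \o u) \_ `](- N), N[) //.
by apply/funext => x; rewrite /= !patchE; case: ifP.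
Qed.

(** The real or the imaginary parts of the weak derivatives of an element of the
    weighted Sobolev space. Each function is linked to the next one instead of
    to the first one: this is what integration by parts calls for. *)
Definition sobolev_family (alpha : nat) (rho : R -> R) (v : nat -> R -> R) : Prop :=
  [/\ forall k, measurable_fun setT (v k),
      forall k, (k <= alpha)%N ->
        leb.-integrable setT (EFin \o (fun x => v k x ^+ 2 * rho x)) &
      forall k, (k < alpha)%N -> forall p, test_fun p ->
        Rintegral leb setT (fun x => v k x * p^`() x) =
        - Rintegral leb setT (fun x => v k.+1 x * p x)].

Lemma loc_integrable_parts (f : R -> R[i]) (v w : R -> R) :
  measurable_fun setT v -> measurable_fun setT w ->
  {ae leb, forall x, f x = v x +i* w x} -> loc_integrable f ->
  (forall A B, leb.-integrable `]A, B[ (EFin \o v)) /\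
  (forall A B, leb.-integrable `]A, B[ (EFin \o w)).
Proof.
move=> mv mw fvw [_ fin].
suff H A B : leb.-integrable `]A, B[ (EFin \o v) /\ leb.-integrable `]A, B[ (EFin \o w).
  by split => A B; have [] := H A B.
have mI : @measurable _ (measurableTypeR R) `]A, B[%classic by exact: measurable_itv.
have mC : @measurable _ (measurableTypeR R) `[A, B]%classic by exact: measurable_itv.
have sub : `]A, B[%classic `<=` (`[A, B]%classic : set R) by exact: subset_itv_oo_cc.
have [|iv iw] := @integrable_parts _ (measurableTypeR R) _ leb `[A, B]%classic f v w mC mv mw _ (fin _ (@segment_compact _ A B)).
  by apply: ae_mono fvw => x H _.
by split; [exact: (@integrableS _ (measurableTypeR R) _ leb _ _ _ mC mI sub iv)|
  exact: (@integrableS _ (measurableTypeR R) _ leb _ _ _ mC mI sub iw)].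
Qed.

Lemma weak_derivs_line_parts k (f g : R -> R[i]) (a b v w : R -> R) :
  {ae leb, forall x, f x = a x +i* b x} -> {ae leb, forall x, g x = v x +i* w x} ->
  weak_derivs_line k f g -> forall p, test_fun p ->
  Rintegral leb setT (fun x => a x * derive1n k p x) =
    (-1) ^+ k * Rintegral leb setT (fun x => v x * p x) /\
  Rintegral leb setT (fun x => b x * derive1n k p x) =
    (-1) ^+ k * Rintegral leb setT (fun x => w x * p x).
Proof.
move=> fab gvw [_ _ H] p tp; have := H p tp.
rewrite (@ae_eq_cintegral _ _ _ leb setT _ (fun x => (a x +i* b x) * (derive1n k p x)%:C)); last first.
  by apply: ae_mono fab => x E _; rewrite E.
rewrite (@ae_eq_cintegral _ _ _ leb setT (fun x => g x * (p x)%:C)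
  (fun x => (v x +i* w x) * (p x)%:C)); last first.
  by apply: ae_mono gvw => x E _; rewrite E.
by rewrite !cintegral_mul_real sign_mul_complex => -[-> ->].
Qed.

Lemma weak_deriv_mem (wd : nat -> (R -> R[i]) -> set (R -> R[i])) k f :
  wd k f !=set0 -> wd k f (weak_deriv wd k f).
Proof. by move=> [g wg]; exact: xgetI wg. Qed.

Lemma sum_lty (n : nat) (F : 'I_n -> \bar R) : (forall k, 0 <= F k)%E ->
  (\sum_(k < n) F k < +oo)%E -> forall k, (F k < +oo)%E.
Proof.
move=> F0 + k; apply: le_lt_trans; rewrite (bigD1 k) //=.
by rewrite leeDl // sume_ge0.
Qed.

Variables (alpha : nat) (rho : R -> R).
Hypotheses (rho0 : forall x, 0 < rho x) (mrho : measurable_fun setT rho).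

(** Two consecutive derivatives are linked by testing the definition of the
    first one against [p^`()] and that of the second one against [p]. *)
Lemma sobolev_line_family (s : R -> R[i]) :
  sobolev setT rho weak_derivs_line alpha s ->
  exists v w : nat -> R -> R,
  [/\ sobolev_family alpha rho v, sobolev_family alpha rho w,
      {ae leb, forall x, s x = v 0%N x +i* w 0%N x} &
      forall k, (k <= alpha)%N ->
        {ae leb, forall x, weak_deriv weak_derivs_line k s x = v k x +i* w k x}].
Proof.
move=> [ex fin].
pose D k := weak_deriv weak_derivs_line k s.
have Dwd k : (k <= alpha)%N -> weak_derivs_line k s (D k) by move=> /ex; exact: weak_deriv_mem.
have /choice[vw Hvw] k : exists vw : (R -> R) * (R -> R),
    [/\ measurable_fun setT vw.1, measurable_fun setT vw.2 &
      (k <= alpha)%N -> {ae leb, forall x, D k x = vw.1 x +i* vw.2 x}].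
  have [ka|_] := leqP k alpha; last first.
    by exists (fun=> 0, fun=> 0); split => //=; exact: measurable_cst.
  have [_ [aeD _] _] := Dwd k ka.
  have [v [w [mv mw H]]] := @ae_measurable_rep _ (measurableTypeR R) _ leb setT _ measurableT aeD.
  exists (v, w); split => // _; apply: ae_mono H => x; exact.
pose v k := (vw k).1; pose w k := (vw k).2.
have mv k : measurable_fun setT (v k) by have [] := Hvw k.
have mw k : measurable_fun setT (w k) by have [] := Hvw k.
have DE k : (k <= alpha)%N -> {ae leb, forall x, D k x = v k x +i* w k x}.
  by have [] := Hvw k.
have loc k : (k <= alpha)%N -> (forall A B, leb.-integrable `]A, B[ (EFin \o v k)) /\
    (forall A B, leb.-integrable `]A, B[ (EFin \o w k)).
  move=> ka; have [_ locD _] := Dwd k ka.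
  exact: loc_integrable_parts (mv k) (mw k) (DE k ka) locD.
(* by uniqueness [s] agrees with the representative of its derivative of order 0 *)
have sE : {ae leb, forall x, s x = v 0%N x +i* w 0%N x}.
  have [locs _ _] := Dwd 0%N (leq0n _).
  have [a [b [ma mb sab]]] := @ae_measurable_rep _ (measurableTypeR R) _ leb setT _ measurableT locs.1.
  have {}sab : {ae leb, forall x, s x = a x +i* b x} by apply: ae_mono sab => x; exact.
  have [ia ib] := loc_integrable_parts ma mb sab locs.
  have [iv iw] := loc 0%N (leq0n _).
  have parts := weak_derivs_line_parts sab (DE _ (leq0n _)) (Dwd 0%N (leq0n _)).
  have uniq (f g : R -> R) : measurable_fun setT f -> measurable_fun setT g ->
      (forall A B, leb.-integrable `]A, B[ (EFin \o f)) ->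
      (forall A B, leb.-integrable `]A, B[ (EFin \o g)) ->
      (forall p, test_fun p -> Rintegral leb setT (fun x => f x * p x) =
        Rintegral leb setT (fun x => g x * p x)) -> {ae leb, forall x, f x = g x}.
    move=> mf mg intf intg fg.
    have H : {ae leb, forall x, f x - g x = 0}.
      apply: line_uniqueness => [|A B|p tp].
      - exact: measurable_funB.
      - have mI : @measurable _ (measurableTypeR R) `]A, B[%classic by exact: measurable_itv.
        exact: (@integrableB _ (measurableTypeR R) _ leb _ mI _ _ (intf A B) (intg A B)).
      - under eq_Rintegral do rewrite mulrBl.
        rewrite RintegralB //; [|exact: integrable_mul_test|exact: integrable_mul_test].
        by rewrite fg // subrr.
    by apply: ae_mono H => x /eqP; rewrite subr_eq0 => /eqP.
  have av : {ae leb, forall x, a x = v 0%N x}.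
    apply: uniq => // p tp; have [H _] := parts p tp.
    by move: H; rewrite derive1n0 expr0 mul1r.
  have bw : {ae leb, forall x, b x = w 0%N x}.
    apply: uniq => // p tp; have [_ H] := parts p tp.
    by move: H; rewrite derive1n0 expr0 mul1r.
  have avw : {ae leb, forall x, a x = v 0%N x /\ b x = w 0%N x}.
    by apply: ae_mono2 av bw => x; exact: conj.
  by apply: ae_mono2 sab avw => x -> [-> ->].
have sq k : (k <= alpha)%N ->
    leb.-integrable setT (EFin \o (fun x => v k x ^+ 2 * rho x)) /\
    leb.-integrable setT (EFin \o (fun x => w k x ^+ 2 * rho x)).
  move=> ka.
  have : (\int[leb]_(x in setT) (sqnorm (v k x +i* w k x) * rho x)%:E < +oo)%E.
    have F0 (l : 'I_alpha.+1) : (0 <= \int[leb]_(x in setT) (sqnorm (D l x) * rho x)%:E)%E.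
      by apply: integral_ge0 => x _; rewrite lee_fin mulr_ge0 ?sqnorm_ge0 // ltW.
    have kt : (k < alpha.+1)%N by [].
    have := sum_lty F0 fin (Ordinal kt); apply: le_lt_trans.
    rewrite le_eqVlt; apply/orP; left; apply/eqP; apply: ae_eq_lower_integral.
    by apply: ae_mono (DE k ka) => x H _; rewrite -H.
  have mm : measurable_fun setT (fun x => sqnorm (v k x +i* w k x) * rho x).
    exact: (measurable_funM (measurable_sqnorm (mv k) (mw k)) mrho).
  have mv2 : measurable_fun setT (fun x => v k x ^+ 2 * rho x).
    exact: (measurable_funM (measurable_funX 2 (mv k)) mrho).
  have mw2 : measurable_fun setT (fun x => w k x ^+ 2 * rho x).
    exact: (measurable_funM (measurable_funX 2 (mw k)) mrho).
  move=> H; split; apply/integrableP; split.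
  - exact/measurable_EFinP.
  - apply: le_lt_trans H; apply: ge0_le_integral => //.
    + by apply/measurable_EFinP; apply: measurableT_comp.
    + exact/measurable_EFinP.
    + move=> x _; rewrite lee_fin /= (ger0_norm (mulr_ge0 (sqr_ge0 _) (ltW (rho0 x)))).
      by rewrite (ler_wpM2r (ltW (rho0 x))) // /sqnorm lerDl sqr_ge0.
  - exact/measurable_EFinP.
  - apply: le_lt_trans H; apply: ge0_le_integral => //.
    + by apply/measurable_EFinP; apply: measurableT_comp.
    + exact/measurable_EFinP.
    + move=> x _; rewrite lee_fin /= (ger0_norm (mulr_ge0 (sqr_ge0 _) (ltW (rho0 x)))).
      by rewrite (ler_wpM2r (ltW (rho0 x))) // /sqnorm lerDr sqr_ge0.
have step k p : (k < alpha)%N -> test_fun p ->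
    Rintegral leb setT (fun x => v k x * p^`() x) = - Rintegral leb setT (fun x => v k.+1 x * p x) /\
    Rintegral leb setT (fun x => w k x * p^`() x) = - Rintegral leb setT (fun x => w k.+1 x * p x).
  move=> ka tp.
  have [H1 H2] := weak_derivs_line_parts sE (DE _ (ltnW ka)) (Dwd k (ltnW ka)) (test_fun_derive1 tp).
  have [] := weak_derivs_line_parts sE (DE _ ka) (Dwd k.+1 ka) tp.
  rewrite /derive1n !iterSr -!/(derive1n k _) H1 H2 exprS !mulN1r => E1 E2.
  have sgn : (-1) ^+ k != 0 :> R by rewrite signr_eq0.
  by split; apply: (mulfI sgn); rewrite ?E1 ?E2 mulNr mulrN.
exists v, w; split => //; split => //.
- by move=> k /sq[].
- by move=> k ka p tp; have [] := step k p ka tp.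
- by move=> k /sq[].
- by move=> k ka p tp; have [] := step k p ka tp.
Qed.

End LineRepresentation.

(** * The transform in one variable *)

Section TorusTransform.
Context {R : realType}.
Local Notation leb := (@lebesgue_measure R).
Local Notation mtorus := (measurable_torus : @measurable _ (measurableTypeR R) torus).

Lemma torus_integrable_parts (f : R -> R[i]) (v w : R -> R) :
  measurable_fun setT v -> measurable_fun setT w ->
  {ae leb, forall t, torus t -> f t = v t +i* w t} ->
  torus_integrable f ->
  leb.-integrable torus (EFin \o v) /\ leb.-integrable torus (EFin \o w).
Proof.
move=> mv mw fvw [_ fin].
exact: (@integrable_parts _ (measurableTypeR R) _ leb _ _ _ _ mtorus mv mw fvw fin).
Qed.

Lemma torus_integrable_cpx (f : R -> R[i]) (v w : R -> R) :
  measurable_fun setT v -> measurable_fun setT w ->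
  {ae leb, forall t, torus t -> f t = v t +i* w t} ->
  leb.-integrable torus (EFin \o v) -> leb.-integrable torus (EFin \o w) ->
  torus_integrable f.
Proof.
move=> mv mw fvw iv iw; split; last first.
  exact: (@integral_sqrt_sqnorm_lty _ (measurableTypeR R) _ leb _ _ _ _ mtorus mv mw fvw iv iw).
apply: ae_measurable_ae fvw _; apply: ae_measurable_cpx; exact: measurable_funTS.
Qed.

Lemma integrable_mul_periodic (u p : R -> R) :
  leb.-integrable torus (EFin \o u) -> periodic_test_fun p ->
  leb.-integrable torus (EFin \o (fun t => u t * p t)).
Proof.
move=> iu [sp _]; have [M HM] := bounded_on_torus (smooth_continuous sp).
apply: (@integrable_bounded_mul _ (measurableTypeR R) _ leb _ mtorus u p M) => //.
exact: (smooth_measurable sp).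
Qed.

(** The energy on the torus is that of arbitrarily chosen weak derivatives; by
    uniqueness it may be computed with the explicit ones. *)
Lemma weak_derivs_torus_unique k (f g h : R -> R[i]) :
  weak_derivs_torus k f g -> weak_derivs_torus k f h ->
  {ae leb, forall t, torus t -> g t = h t}.
Proof.
move=> [_ ig Hg] [_ ih Hh].
have [v [w [mv mw gvw]]] := @ae_measurable_rep _ (measurableTypeR R) _ leb _ _ mtorus ig.1.
have [v' [w' [mv' mw' hvw]]] := @ae_measurable_rep _ (measurableTypeR R) _ leb _ _ mtorus ih.1.
have [iv iw] := torus_integrable_parts mv mw gvw ig.
have [iv' iw'] := torus_integrable_parts mv' mw' hvw ih.
have eqs p : periodic_test_fun p ->
    Rintegral leb torus (fun t => v t * p t) = Rintegral leb torus (fun t => v' t * p t) /\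
    Rintegral leb torus (fun t => w t * p t) = Rintegral leb torus (fun t => w' t * p t).
  move=> pp; have := Hh p pp; rewrite (Hg p pp).
  have sgn : (-1) ^+ k != 0 :> R[i] by rewrite signr_eq0.
  move=> /(mulfI sgn).
  rewrite (@ae_eq_cintegral _ _ _ leb torus (fun t => g t * (p t)%:C)
    (fun t => (v t +i* w t) * (p t)%:C)); last first.
    by apply: ae_mono gvw => t H tt; rewrite H.
  rewrite (@ae_eq_cintegral _ _ _ leb torus (fun t => h t * (p t)%:C)
    (fun t => (v' t +i* w' t) * (p t)%:C)); last first.
    by apply: ae_mono hvw => t H tt; rewrite H.
  by rewrite !cintegral_mul_real => -[-> ->].
have uniq (a b : R -> R) : measurable_fun setT a -> measurable_fun setT b ->
    leb.-integrable torus (EFin \o a) -> leb.-integrable torus (EFin \o b) ->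
    (forall p, periodic_test_fun p -> Rintegral leb torus (fun t => a t * p t) =
      Rintegral leb torus (fun t => b t * p t)) ->
    {ae leb, forall t, torus t -> a t = b t}.
  move=> ma mb ia ib ab.
  have H : {ae leb, forall t, torus t -> a t - b t = 0}.
    apply: torus_uniqueness => [||p pp].
    - exact: measurable_funB.
    - exact: (@integrableB _ (measurableTypeR R) _ leb _ mtorus _ _ ia ib).
    - under eq_Rintegral do rewrite mulrBl.
      rewrite (@RintegralB _ (measurableTypeR R) _ leb torus) //; first by rewrite ab // subrr.
      + exact: mtorus.
      + exact: integrable_mul_periodic.
      + exact: integrable_mul_periodic.
  by apply: ae_mono H => t H tt; apply/eqP; rewrite -subr_eq0 H.
have av : {ae leb, forall t, torus t -> v t = v' t}.
  by apply: uniq => // p /eqs[].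
have bw : {ae leb, forall t, torus t -> w t = w' t}.
  by apply: uniq => // p /eqs[].
have avw : {ae leb, forall t, torus t -> v t = v' t /\ w t = w' t}.
  by apply: ae_mono2 av bw => t Hv Hw tt; split; [exact: Hv|exact: Hw].
have gvw' : {ae leb, forall t, torus t -> g t = v' t +i* w' t}.
  by apply: ae_mono2 gvw avw => t Hg' H tt; have [<- <-] := H tt; exact: Hg'.
by apply: ae_mono2 gvw' hvw => t Hg' Hh' tt; rewrite Hg' ?Hh'.
Qed.

Variables (c : R) (rho : R -> R) (alpha : nat).
Hypotheses (c0 : 0 < c) (rhoS : schwartz_mon_pos rho).

Let rho0 x : 0 < rho x. Proof. by have [_ + _] := rhoS; exact. Qed.
Let mrho : measurable_fun setT rho.
Proof. by have [[sr _] _ _] := rhoS; exact: smooth_measurable. Qed.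

Definition transform (s : R -> R[i]) (t : R) : R[i] :=
  s (mob c t) * (rho (mob c t) * (c * dphi t))%:C.

Definition transform_deriv (v w : nat -> R -> R) (tau : nat) (t : R) : R[i] :=
  pull c (combination c rho v tau) t +i* pull c (combination c rho w tau) t.

Lemma transform_deriv0 (s : R -> R[i]) (v w : nat -> R -> R) :
  {ae leb, forall x, s x = v 0%N x +i* w 0%N x} ->
  {ae leb, forall t, torus t -> transform s t = transform_deriv v w 0 t}.
Proof.
move=> /(mob_ae c0); apply: ae_mono => t H tt.
rewrite /transform H // -quad_mob // /transform_deriv /pull /combination !big_ord1 /=.
set a := v _ _; set b := w _ _; set r := rho _; set q := quad _ _.
by apply/eqP; rewrite eq_complex /=; apply/andP; split; apply/eqP; ring.
Qed.

Lemma measurable_family_pull (v : nat -> R -> R) tau : (tau <= alpha)%N ->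
  sobolev_family alpha rho v -> measurable_fun setT (pull c (combination c rho v tau)).
Proof.
move=> ta [mv _ _]; apply: measurable_pull.
by apply: (@measurable_combination _ c rho c0 rhoS alpha) => // k _.
Qed.

Lemma integrable_family_pull (v : nat -> R -> R) tau : (tau <= alpha)%N ->
  sobolev_family alpha rho v ->
  leb.-integrable torus (EFin \o pull c (combination c rho v tau)).
Proof.
move=> ta [mv iv _]; apply: integrable_pull => //.
exact: (@integrable_combination _ c rho c0 rhoS alpha v (fun k _ => mv k) iv).
Qed.

Lemma transform_weak_derivs (s : R -> R[i]) (v w : nat -> R -> R) tau :
  sobolev_family alpha rho v -> sobolev_family alpha rho w ->
  {ae leb, forall x, s x = v 0%N x +i* w 0%N x} -> (tau <= alpha)%N ->
  weak_derivs_torus tau (transform s) (transform_deriv v w tau).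
Proof.
move=> fv fw svw ta; have sE := transform_deriv0 svw.
split.
- apply: (torus_integrable_cpx _ _ sE); by
    [exact: measurable_family_pull|exact: integrable_family_pull].
- apply: (@torus_integrable_cpx _ (pull c (combination c rho v tau))
    (pull c (combination c rho w tau))); by
    [exact: measurable_family_pull|exact: integrable_family_pull|exact: aeW].
- move=> p pp.
  rewrite (@ae_eq_cintegral _ _ _ leb torus (fun t => transform s t * (derive1n tau p t)%:C)
    (fun t => transform_deriv v w 0 t * (derive1n tau p t)%:C)); last first.
    by apply: ae_mono sE => t H tt; rewrite H.
  rewrite /transform_deriv !cintegral_mul_real sign_mul_complex.
  case: fv => mv iv wv; case: fw => mw iw ww.
  by rewrite !(@torus_weak_derivative _ c rho c0 rhoS alpha _ _ _ _ tau p ta pp).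
Qed.

Lemma transform_weak_deriv (s : R -> R[i]) (v w : nat -> R -> R) tau :
  sobolev_family alpha rho v -> sobolev_family alpha rho w ->
  {ae leb, forall x, s x = v 0%N x +i* w 0%N x} -> (tau <= alpha)%N ->
  {ae leb, forall t, torus t ->
    weak_deriv weak_derivs_torus tau (transform s) t = transform_deriv v w tau t}.
Proof.
move=> fv fw svw ta; have H := transform_weak_derivs fv fw svw ta.
apply: (weak_derivs_torus_unique _ H).
by apply: weak_deriv_mem; exists (transform_deriv v w tau).
Qed.

Lemma transform_deriv_bound tau : (tau <= alpha)%N -> exists2 C : R, 0 < C &
  forall v w : nat -> R -> R,
    (forall k, measurable_fun setT (v k)) -> (forall k, measurable_fun setT (w k)) ->
    (\int[leb]_(t in torus) (sqnorm (transform_deriv v w tau t))%:E <=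
     C%:E * \sum_(k < alpha.+1) \int[leb]_x (sqnorm (v k x +i* w k x) * rho x)%:E)%E.
Proof.
move=> ta; have [C C0 HC] := combination_bound c0 rhoS tau.
exists C => // v w mv mw.
have mG (u : nat -> R -> R) : (forall k, measurable_fun setT (u k)) ->
    measurable_fun setT (combination c rho u tau).
  by move=> mu; apply: (@measurable_combination _ c rho c0 rhoS alpha).
have mq : measurable_fun setT (quad c) by exact: (smooth_measurable (@smooth_quad _ c)).
pose E x := sqnorm (combination c rho v tau x +i* combination c rho w tau x) * quad c x.
have mE : measurable_fun setT E.
  exact: (measurable_funM (measurable_sqnorm (mG _ mv) (mG _ mw)) mq).
have E0 x : 0 <= E x by rewrite mulr_ge0 ?sqnorm_ge0 // ltW // quad_gt0.
have -> : (\int[leb]_(t in torus) (sqnorm (transform_deriv v w tau t))%:E =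
    \int[leb]_(t in torus) (pull c E t)%:E)%E.
  by apply: eq_integral => t _; rewrite /pull /E /transform_deriv /pull /sqnorm /=; congr EFin; ring.
rewrite -(ge0_integral_pull c0 mE E0).
pose S k x := sqnorm (v k x +i* w k x) * rho x.
have mS k : measurable_fun setT (S k).
  exact: (measurable_funM (measurable_sqnorm (mv k) (mw k)) mrho).
have S0 k x : 0 <= S k x by rewrite mulr_ge0 ?sqnorm_ge0 // ltW.
rewrite -(@ge0_integral_sum _ _ _ leb setT _ 'I_alpha.+1 (fun k x => (S k x)%:E)) //; last 2 first.
- by move=> k; apply/measurable_EFinP; exact: mS.
- by move=> k x _; rewrite lee_fin.
rewrite -ge0_integralZl //; last 3 first.
- apply: emeasurable_sum => k; apply/measurable_EFinP; exact: mS.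
- by move=> x _; apply: sume_ge0 => k _; rewrite lee_fin.
- by rewrite lee_fin ltW.
apply: ge0_le_integral => //.
- by move=> x _; rewrite lee_fin.
- exact/measurable_EFinP.
- apply: emeasurable_funM => //; apply: emeasurable_sum => k; apply/measurable_EFinP; exact: mS.
move=> x _; rewrite sumEFin -EFinM lee_fin.
have H1 := HC v x; have H2 := HC w x.
apply: (@le_trans _ _ (C * \sum_(k < tau.+1) S k x)).
  have -> : E x = combination c rho v tau x ^+ 2 * quad c x +
    combination c rho w tau x ^+ 2 * quad c x by rewrite /E /sqnorm /=; ring.
  apply: le_trans (lerD H1 H2) _; rewrite -mulrDr -big_split /=.
  rewrite le_eqVlt; apply/orP; left; apply/eqP; congr (_ * _).
  by apply: eq_bigr => k _; rewrite /S /sqnorm /=; ring.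
rewrite ler_wpM2l ?(ltW C0) //.
rewrite (big_ord_widen alpha.+1 (fun k => S k x)) //.
rewrite [leRHS](bigID (fun k : 'I_alpha.+1 => (k < tau.+1)%N)) /= lerDl.
exact: sumr_ge0.
Qed.

End TorusTransform.

(** * Positive semidefinite matrices and Hadamard products *)

Section PositiveSemidefinite.
Context {R : realType} {I : finType}.
Implicit Types P M : I -> I -> R[i].

Definition psd P : Prop := forall x : I -> R[i],
  0 <= complex.Re (\sum_i \sum_l x i * (x l)^* * P i l).

(** By the Schur product theorem every positive semidefinite hermitian matrix
    has this property; for Gram matrices of integrals it is immediate. *)
Definition schur_stable M : Prop :=
  forall P, psd P -> psd (fun i l => M i l * P i l).

Lemma psd_ext P M : (forall i l, P i l = M i l) -> psd P -> psd M.
Proof.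
move=> PM pP x; have := pP x; congr (0 <= complex.Re _).
by apply: eq_bigr => i _; apply: eq_bigr => l _; rewrite PM.
Qed.

Lemma psd_zero : psd (fun _ _ => 0).
Proof.
move=> x; rewrite big1 // => i _; rewrite big1 // => l _; exact: mulr0.
Qed.

Lemma psdD P M : psd P -> psd M -> psd (fun i l => P i l + M i l).
Proof.
move=> pP pM x; have := addr_ge0 (pP x) (pM x); rewrite -ReD -big_split /=.
congr (0 <= complex.Re _); apply: eq_bigr => i _; rewrite -big_split /=.
by apply: eq_bigr => l _; rewrite mulrDr.
Qed.

Lemma psdZ (k : R) P : 0 <= k -> psd P -> psd (fun i l => k%:C * P i l).
Proof.
move=> k0 pP x; have := mulr_ge0 k0 (pP x).
set z := \sum_i _ => H.
suff -> : \sum_i \sum_l x i * (x l)^* * (k%:C * P i l) = k%:C * z.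
  by rewrite ReM /= mul0r subr0.
rewrite mulr_sumr; apply: eq_bigr => i _; rewrite mulr_sumr.
by apply: eq_bigr => l _; rewrite mulrCA.
Qed.

Lemma schur_stable_ext P M : (forall i l, P i l = M i l) ->
  schur_stable P -> schur_stable M.
Proof. by move=> PM sP Q /sP; apply: psd_ext => i l; rewrite PM. Qed.

Lemma schur_stable_sum (n : nat) (M : 'I_n -> I -> I -> R[i]) :
  (forall k, schur_stable (M k)) -> schur_stable (fun i l => \sum_(k < n) M k i l).
Proof.
move=> sM P pP.
suff H (r : seq 'I_n) : psd (fun i l => \sum_(k <- r) M k i l * P i l).
  by apply: psd_ext (H (index_enum _)) => i l; rewrite mulr_suml.
elim: r => [|k r IH].
  by apply: psd_ext psd_zero => i l; rewrite big_nil.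
by apply: psd_ext (psdD (sM k P pP) IH) => i l; rewrite big_cons.
Qed.

Lemma schur_stable_prod (J : Type) (r : seq J) (M : J -> I -> I -> R[i]) :
  (forall j, schur_stable (M j)) -> schur_stable (fun i l => \prod_(j <- r) M j i l).
Proof.
move=> sM; elim: r => [|j r IH] P pP.
  by apply: psd_ext pP => i l; rewrite big_nil mul1r.
by apply: psd_ext (sM j _ (IH P pP)) => i l; rewrite big_cons mulrA.
Qed.

(** The tensor product of bounded operators is bounded by the product of the
    bounds, in terms of Gram matrices. The factors of the Hadamard product are
    replaced one at a time: the difference of the two products is a sum of
    products in which exactly one factor is a difference. *)
Lemma psd_prod_sub (J : Type) (r : seq J) (k : J -> R) (A B : J -> I -> I -> R[i]) :
  (forall j, 0 <= k j) -> (forall j, schur_stable (A j)) ->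
  (forall j, schur_stable (B j)) ->
  (forall j, psd (fun i l => (k j)%:C * A j i l - B j i l)) ->
  psd (fun i l => (\prod_(j <- r) k j)%:C * \prod_(j <- r) A j i l -
    \prod_(j <- r) B j i l).
Proof.
move=> k0 sA sB AB; elim: r => [|j r IH].
  by apply: psd_ext psd_zero => i l; rewrite !big_nil mulr1 subrr.
have H1 := psdZ (k0 j) (sA j _ IH).
have H2 := schur_stable_prod r sB (AB j).
apply: psd_ext (psdD H1 H2) => i l; rewrite !big_cons rmorphM /=.
by ring.
Qed.

End PositiveSemidefinite.

(** * Gram matrices of integrals *)

Section Gram.
Context d (T : measurableType d) (R : realType) (I : finType).
Variables (mu : {measure set T -> \bar R}) (A : set T).
Hypothesis mA : measurable A.

Lemma Re_sum_cintegral (y : I -> I -> R[i]) (F : I -> I -> T -> R[i]) :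
  (forall i l, mu.-integrable A (EFin \o (fun x => complex.Re (F i l x)))) ->
  (forall i l, mu.-integrable A (EFin \o (fun x => complex.Im (F i l x)))) ->
  complex.Re (\sum_i \sum_l y i l * cintegral mu A (F i l)) =
  Rintegral mu A (fun x => complex.Re (\sum_i \sum_l y i l * F i l x)).
Proof.
move=> iR iI.
pose f i l x := complex.Re (y i l) * complex.Re (F i l x) -
  complex.Im (y i l) * complex.Im (F i l x).
have i_f i l : mu.-integrable A (EFin \o f i l).
  have := integrableB mA (integrableZl mA (complex.Re (y i l)) (iR i l))
    (integrableZl mA (complex.Im (y i l)) (iI i l)).
  by [].
have -> : (fun x => complex.Re (\sum_i \sum_l y i l * F i l x)) =
    (fun x => \sum_i \sum_l f i l x).
  apply/funext => x; rewrite Re_sum; apply: eq_bigr => i _; rewrite Re_sum.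
  by apply: eq_bigr => l _; rewrite ReM.
rewrite (@Rintegral_bigsum _ _ _ mu A mA I _ (fun i x => \sum_l f i l x)); last first.
  by move=> i; apply: (@integrable_bigsum _ _ _ mu A mA I _ (f i)).
rewrite Re_sum; apply: eq_bigr => i _.
rewrite (@Rintegral_bigsum _ _ _ mu A mA I _ (f i)) //.
rewrite Re_sum; apply: eq_bigr => l _; rewrite ReM /cintegral /= /f.
rewrite RintegralB //.
- by rewrite !RintegralZl.
- exact: (integrableZl mA (complex.Re (y i l)) (iR i l)).
- exact: (integrableZl mA (complex.Im (y i l)) (iI i l)).
Qed.

Variables (a : I -> T -> R[i]) (w : T -> R).
Hypothesis mRe : forall i, measurable_fun A (fun x => complex.Re (a i x)).
Hypothesis mIm : forall i, measurable_fun A (fun x => complex.Im (a i x)).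
Hypothesis mw : measurable_fun A w.
Hypothesis w0 : forall x, 0 <= w x.
Hypothesis ia : forall i, (\int[mu]_(x in A) (sqnorm (a i x) * w x)%:E < +oo)%E.

Let F i l x : R[i] := a i x * (a l x)^* * (w x)%:C.

Let msq i : measurable_fun A (fun x => sqnorm (a i x) * w x).
Proof.
by apply: measurable_funM => //; apply: measurable_funD; apply: measurable_funX.
Qed.

Let isq i : mu.-integrable A (EFin \o (fun x => sqnorm (a i x) * w x)).
Proof.
apply/integrableP; split; first exact/measurable_EFinP.
apply: le_lt_trans (ia i); rewrite le_eqVlt; apply/orP; left; apply/eqP.
by apply: eq_integral => x _ /=; rewrite ger0_norm // mulr_ge0 ?sqnorm_ge0.
Qed.

Let FRe i l x : complex.Re (F i l x) =
  (complex.Re (a i x) * complex.Re (a l x) + complex.Im (a i x) * complex.Im (a l x)) * w x.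
Proof. by rewrite /F !ReM Re_conj Im_conj /=; ring. Qed.

Let FIm i l x : complex.Im (F i l x) =
  (complex.Im (a i x) * complex.Re (a l x) - complex.Re (a i x) * complex.Im (a l x)) * w x.
Proof. by rewrite /F !ImM !ReM Re_conj Im_conj /=; ring. Qed.

Let iF_ i l (f : T -> R) : measurable_fun A f ->
  (forall x, `|f x| <= sqnorm (a i x) * w x + sqnorm (a l x) * w x) ->
  mu.-integrable A (EFin \o f).
Proof.
move=> mf fb; have iD := integrableD mA (isq i) (isq l).
apply: (le_integrable mA _ _ iD); first exact/measurable_EFinP.
move=> x _ /=; rewrite lee_fin; apply: le_trans (fb x) _; exact: ler_norm.
Qed.

Let iRe i l : mu.-integrable A (EFin \o (fun x => complex.Re (F i l x))).
Proof.
apply: (@iF_ i l).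
  under eq_fun do rewrite FRe.
  by apply: measurable_funM => //; apply: measurable_funD; apply: measurable_funM.
move=> x; rewrite FRe normrM (ger0_norm (w0 x)) -mulrDl ler_wpM2r // /sqnorm.
set p := complex.Re _; set q := complex.Im _; set r := complex.Re _; set s := complex.Im _.
by rewrite ler_norml; apply/andP; split;
  have := sqr_ge0 (p - r); have := sqr_ge0 (q - s); have := sqr_ge0 (p + r);
  have := sqr_ge0 (q + s); nra.
Qed.

Let iIm i l : mu.-integrable A (EFin \o (fun x => complex.Im (F i l x))).
Proof.
apply: (@iF_ i l).
  under eq_fun do rewrite FIm.
  by apply: measurable_funM => //; apply: measurable_funB; apply: measurable_funM.
move=> x; rewrite FIm normrM (ger0_norm (w0 x)) -mulrDl ler_wpM2r // /sqnorm.
set p := complex.Re _; set q := complex.Im _; set r := complex.Re _; set s := complex.Im _.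
by rewrite ler_norml; apply/andP; split;
  have := sqr_ge0 (q - r); have := sqr_ge0 (p - s); have := sqr_ge0 (q + r);
  have := sqr_ge0 (p + s); nra.
Qed.

Definition gram (i l : I) : R[i] := cintegral mu A (F i l).

(** Pointwise, the entries of the Gram matrix only change the vector at which the
    form of [P] is evaluated, from [x i] to [x i * a i t]. *)
Lemma gram_schur_stable : schur_stable gram.
Proof.
move=> P pP x.
have -> : \sum_i \sum_l x i * (x l)^* * (gram i l * P i l) =
    \sum_i \sum_l (x i * (x l)^* * P i l) * gram i l.
  by apply: eq_bigr => i _; apply: eq_bigr => l _; ring.
rewrite Re_sum_cintegral //; apply: Rintegral_ge0 => t _.
have -> : \sum_i \sum_l x i * (x l)^* * P i l * F i l t =
    (w t)%:C * \sum_i \sum_l (x i * a i t) * (x l * a l t)^* * P i l.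
  rewrite mulr_sumr; apply: eq_bigr => i _; rewrite mulr_sumr.
  by apply: eq_bigr => l _; rewrite /F rmorphM /=; ring.
by rewrite ReM /= mul0r subr0 mulr_ge0 //; exact: (pP (fun i => x i * a i t)).
Qed.

Let form_pointwise (x : I -> R[i]) t :
  complex.Re (\sum_i \sum_l x i * (x l)^* * F i l t) =
  sqnorm (\sum_i x i * a i t) * w t.
Proof.
have -> : \sum_i \sum_l x i * (x l)^* * F i l t =
    (w t)%:C * ((\sum_i x i * a i t) * (\sum_i x i * a i t)^*).
  rewrite rmorph_sum /= mulr_suml mulr_sumr; apply: eq_bigr => i _.
  rewrite !mulr_sumr; apply: eq_bigr => l _; rewrite /F rmorphM /=; ring.
by rewrite ReM /= mul0r subr0 Re_mul_conj mulrC.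
Qed.

Lemma gram_form (x : I -> R[i]) :
  complex.Re (\sum_i \sum_l x i * (x l)^* * gram i l) =
  Rintegral mu A (fun t => sqnorm (\sum_i x i * a i t) * w t).
Proof.
by rewrite Re_sum_cintegral //; apply: eq_Rintegral => t _; exact: form_pointwise.
Qed.

Lemma gram_form_integrable (x : I -> R[i]) :
  mu.-integrable A (EFin \o (fun t => sqnorm (\sum_i x i * a i t) * w t)).
Proof.
pose f i l t := complex.Re (x i * (x l)^*) * complex.Re (F i l t) -
      complex.Im (x i * (x l)^*) * complex.Im (F i l t).
have -> : (fun t => sqnorm (\sum_i x i * a i t) * w t) =
    (fun t => \sum_i \sum_l f i l t).
  apply/funext => t; rewrite -form_pointwise Re_sum; apply: eq_bigr => i _.
  by rewrite Re_sum; apply: eq_bigr => l _; rewrite ReM.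
apply: (@integrable_bigsum _ _ _ mu A mA I _ (fun i t => \sum_l f i l t)) => i.
apply: (@integrable_bigsum _ _ _ mu A mA I _ (f i)) => l.
have := integrableB mA (integrableZl mA (complex.Re (x i * (x l)^*)) (iRe i l))
    (integrableZl mA (complex.Im (x i * (x l)^*)) (iIm i l)).
by [].
Qed.

End Gram.

(** * The bound for one factor *)

Section OneFactor.
Context {R : realType}.
Local Notation leb := (@lebesgue_measure R).
Local Notation mtorus := (measurable_torus : @measurable _ (measurableTypeR R) torus).
Variables (c : R) (rho : R -> R) (alpha : nat).
Hypotheses (c0 : 0 < c) (rhoS : schwartz_mon_pos rho).

Local Notation line_sobolev := (sobolev setT rho weak_derivs_line alpha).
Local Notation line_inner := (sobolev_inner setT rho weak_derivs_line alpha).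
Local Notation torus_sobolev := (sobolev torus (fun=> 1) weak_derivs_torus alpha).
Local Notation torus_inner :=
  (sobolev_inner torus (fun=> 1) weak_derivs_torus alpha).
Local Notation transf := (transform c rho).

Let rho0 x : 0 < rho x. Proof. by have [_ + _] := rhoS; exact. Qed.
Let mrho : measurable_fun setT rho.
Proof. by have [[sr _] _ _] := rhoS; exact: smooth_measurable. Qed.

Lemma line_energy_fin (s : R -> R[i]) (v w : nat -> R -> R) :
  line_sobolev s ->
  (forall k, (k <= alpha)%N ->
    {ae leb, forall x, weak_deriv weak_derivs_line k s x = v k x +i* w k x}) ->
  (\sum_(k < alpha.+1) \int[leb]_x (sqnorm (v k x +i* w k x) * rho x)%:E < +oo)%E.
Proof.
move=> [_ fin] sE; apply: le_lt_trans fin; rewrite le_eqVlt; apply/orP; left.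
apply/eqP; apply: eq_bigr => k _; apply: ae_eq_lower_integral.
by apply: ae_mono (sE k _) => [x -> //|]; rewrite -ltnS.
Qed.

Lemma transform_energy_fin (v w : nat -> R -> R) tau : (tau <= alpha)%N ->
  sobolev_family alpha rho v -> sobolev_family alpha rho w ->
  (\sum_(k < alpha.+1) \int[leb]_x (sqnorm (v k x +i* w k x) * rho x)%:E < +oo)%E ->
  (\int[leb]_(t in torus) (sqnorm (transform_deriv c rho v w tau t) * 1)%:E < +oo)%E.
Proof.
move=> ta [mv _ _] [mw _ _] fin.
have [C C0 HC] := transform_deriv_bound c0 rhoS ta.
under eq_integral do rewrite mulr1.
apply: le_lt_trans (HC v w mv mw) _.
by rewrite lte_mul_pinfty // lee_fin ltW.
Qed.

Lemma transform_sobolev s : line_sobolev s -> torus_sobolev (transf s).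
Proof.
move=> Hs; have [v [w [fv fw sE DE]]] := sobolev_line_family rho0 mrho Hs.
split.
  by move=> k ka; exists (transform_deriv c rho v w k); exact: (transform_weak_derivs c0 rhoS fv fw sE ka).
have fin := line_energy_fin Hs DE.
apply: lte_sum_pinfty => k _.
have ka : (k <= alpha)%N by rewrite -ltnS.
rewrite (@ae_eq_lower_integral _ _ _ leb torus _
  (fun t => (sqnorm (transform_deriv c rho v w k t) * 1)%:E)).
  exact: transform_energy_fin.
by apply: ae_mono (transform_weak_deriv c0 rhoS fv fw sE ka) => t H tt; rewrite H.
Qed.

(** The boundedness of the transform, stated for the Gram matrices of finitely
    many functions so that it passes to tensor products: by linearity the form
    of the second matrix at [x] is the energy of the transform of a single
    linear combination. *)
Lemma transform_gram_bound : exists2 C : R, 0 < C &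
  forall (I : finType) (s : I -> R -> R[i]), (forall i, line_sobolev (s i)) ->
  [/\ schur_stable (fun i l => line_inner (s i) (s l)),
      schur_stable (fun i l => torus_inner (transf (s i)) (transf (s l))) &
      psd (fun i l => C%:C * line_inner (s i) (s l) -
        torus_inner (transf (s i)) (transf (s l)))].
Proof.
have /choice[K HK] (tau : 'I_alpha.+1) : exists C : R, 0 < C /\
    forall v w : nat -> R -> R,
    (forall k, measurable_fun setT (v k)) -> (forall k, measurable_fun setT (w k)) ->
    (\int[leb]_(t in torus) (sqnorm (transform_deriv c rho v w tau t))%:E <=
     C%:E * \sum_(k < alpha.+1) \int[leb]_x (sqnorm (v k x +i* w k x) * rho x)%:E)%E.
  have ta : (tau <= alpha)%N by rewrite -ltnS.
  by have [C C0 HC] := transform_deriv_bound c0 rhoS ta; exists C.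
exists (\sum_tau K tau).
  rewrite big_ord_recl ltr_wpDr // ?(HK _).1 //.
  by apply: sumr_ge0 => tau _; rewrite ltW // (HK _).1.
move=> I s Hs.
have /choice[vw Hvw] i : exists vw : (nat -> R -> R) * (nat -> R -> R),
    [/\ sobolev_family alpha rho vw.1, sobolev_family alpha rho vw.2,
      {ae leb, forall x, s i x = vw.1 0%N x +i* vw.2 0%N x} &
      forall k, (k <= alpha)%N -> {ae leb, forall x,
        weak_deriv weak_derivs_line k (s i) x = vw.1 k x +i* vw.2 k x}].
  by have [v [w H]] := sobolev_line_family rho0 mrho (Hs i); exists (v, w).
pose a k i x : R[i] := (vw i).1 k x +i* (vw i).2 k x.
pose b k i t : R[i] := transform_deriv c rho (vw i).1 (vw i).2 k t.
have fv i : sobolev_family alpha rho (vw i).1 by have [] := Hvw i.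
have fw i : sobolev_family alpha rho (vw i).2 by have [] := Hvw i.
have sE i : {ae leb, forall x, s i x = (vw i).1 0%N x +i* (vw i).2 0%N x}.
  by have [] := Hvw i.
have DE i k : (k <= alpha)%N -> {ae leb, forall x, weak_deriv weak_derivs_line k (s i) x = a k i x}.
  by have [_ _ _ H] := Hvw i => /H.
have mv i k : measurable_fun setT ((vw i).1 k) by have [] := fv i.
have mw i k : measurable_fun setT ((vw i).2 k) by have [] := fw i.
have fin i := line_energy_fin (Hs i) (DE i).
have ga (k : 'I_alpha.+1) i : (\int[leb]_(x in setT) (sqnorm (a k i x) * rho x)%:E < +oo)%E.
  apply: (sum_lty _ (fin i)) => l; apply: integral_ge0 => x _.
  by rewrite lee_fin mulr_ge0 ?sqnorm_ge0 // ltW.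
have gb (k : 'I_alpha.+1) i : (\int[leb]_(t in torus) (sqnorm (b k i t) * 1)%:E < +oo)%E.
  have ka : (k <= alpha)%N by rewrite -ltnS.
  exact: (transform_energy_fin ka (fv i) (fw i) (fin i)).
have mbR (k : 'I_alpha.+1) i : measurable_fun torus (fun t => complex.Re (b k i t)).
  have ka : (k <= alpha)%N by rewrite -ltnS.
  exact: (measurable_funTS (measurable_family_pull c0 rhoS ka (fv i))).
have mbI (k : 'I_alpha.+1) i : measurable_fun torus (fun t => complex.Im (b k i t)).
  have ka : (k <= alpha)%N by rewrite -ltnS.
  exact: (measurable_funTS (measurable_family_pull c0 rhoS ka (fw i))).
have r0 x : 0 <= rho x by exact: ltW.
have lineE i l : line_inner (s i) (s l) = \sum_(k < alpha.+1) gram leb setT (a k) rho i l.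
  apply: eq_bigr => k _; have ka : (k <= alpha)%N by rewrite -ltnS.
  apply: ae_eq_cintegral; apply: ae_mono2 (DE i k ka) (DE l k ka) => x H H' _.
  by rewrite H H'.
have torusE_ i l : torus_inner (transf (s i)) (transf (s l)) =
    \sum_(k < alpha.+1) gram leb torus (b k) (fun=> 1) i l.
  apply: eq_bigr => k _; have ka : (k <= alpha)%N by rewrite -ltnS.
  apply: ae_eq_cintegral.
  apply: ae_mono2 (transform_weak_deriv c0 rhoS (fv i) (fw i) (sE i) ka)
    (transform_weak_deriv c0 rhoS (fv l) (fw l) (sE l) ka) => t H H' tt.
  by rewrite H // H'.
have ssa (k : 'I_alpha.+1) : schur_stable (gram leb setT (a k) rho).
  exact: (@gram_schur_stable _ _ R I leb setT measurableT (a k) rho (fun i => mv i k) (fun i => mw i k)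
    mrho r0 (ga k)).
have ssb (k : 'I_alpha.+1) : schur_stable (gram leb torus (b k) (fun=> 1)).
  exact: (@gram_schur_stable _ _ R I leb torus mtorus (b k) (fun=> 1) (mbR k) (mbI k) (measurable_cst _)
    (fun=> ler01) (gb k)).
split.
- by apply: schur_stable_ext (schur_stable_sum ssa) => i l; rewrite lineE.
- by apply: schur_stable_ext (schur_stable_sum ssb) => i l; rewrite torusE_.
move=> x.
(* the parts of the weak derivatives of the linear combination *)
pose V k y := complex.Re (\sum_i x i * a k i y).
pose W k y := complex.Im (\sum_i x i * a k i y).
have mV k : measurable_fun setT (V k).
  rewrite /V; under eq_fun do rewrite Re_sum.
  apply: measurable_sum => i; under eq_fun do rewrite ReM.
  by apply: measurable_funB; apply: measurable_funM => //; [exact: mv|exact: mw].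
have mW k : measurable_fun setT (W k).
  rewrite /W; under eq_fun do rewrite Im_sum.
  apply: measurable_sum => i; under eq_fun do rewrite ImM.
  by apply: measurable_funD; apply: measurable_funM => //; [exact: mw|exact: mv].
have bVW k t : \sum_i x i * b k i t = transform_deriv c rho V W k t.
  rewrite [LHS]complex_eta Re_sum Im_sum /transform_deriv /pull /combination.
  congr (_ +i* _).
    rewrite mulr_suml (eq_bigr (fun i => \sum_(l < k.+1)
      complex.Re (x i * a l i (mob c t)) * coef c rho k l (mob c t) * quad c (mob c t))).
      rewrite exchange_big; apply: eq_bigr => l _ /=.
      by rewrite /V Re_sum !mulr_suml.
    move=> i _; rewrite ReM /b /transform_deriv /= /pull /combination !mulr_suml !mulr_sumr -sumrB.
    by apply: eq_bigr => l _; rewrite ReM /a /=; ring.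
  rewrite mulr_suml (eq_bigr (fun i => \sum_(l < k.+1)
    complex.Im (x i * a l i (mob c t)) * coef c rho k l (mob c t) * quad c (mob c t))).
    rewrite exchange_big; apply: eq_bigr => l _ /=.
    by rewrite /W Im_sum !mulr_suml.
  move=> i _; rewrite ImM /b /transform_deriv /= /pull /combination !mulr_suml !mulr_sumr -big_split.
  by apply: eq_bigr => l _; rewrite ImM /a /=; ring.
pose QA (k : 'I_alpha.+1) := Rintegral leb setT (fun y => sqnorm (\sum_i x i * a k i y) * rho y).
pose QB (k : 'I_alpha.+1) := Rintegral leb torus (fun t => sqnorm (\sum_i x i * b k i t) * 1).
have formA (k : 'I_alpha.+1) : complex.Re (\sum_i \sum_l x i * (x l)^* * gram leb setT (a k) rho i l) = QA k.
  exact: (@gram_form _ _ R I leb setT measurableT (a k) rho (fun i => mv i k) (fun i => mw i k)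
    mrho r0 (ga k) x).
have formB (k : 'I_alpha.+1) : complex.Re (\sum_i \sum_l x i * (x l)^* * gram leb torus (b k) (fun=> 1) i l) = QB k.
  exact: (@gram_form _ _ R I leb torus mtorus (b k) (fun=> 1) (mbR k) (mbI k) (measurable_cst _)
    (fun=> ler01) (gb k) x).
have iA (k : 'I_alpha.+1) : leb.-integrable setT (EFin \o (fun y => sqnorm (\sum_i x i * a k i y) * rho y)).
  exact: (@gram_form_integrable _ _ R I leb setT measurableT (a k) rho (fun i => mv i k) (fun i => mw i k)
    mrho r0 (ga k) x).
have iB (k : 'I_alpha.+1) : leb.-integrable torus (EFin \o (fun t => sqnorm (\sum_i x i * b k i t) * 1)).
  exact: (@gram_form_integrable _ _ R I leb torus mtorus (b k) (fun=> 1) (mbR k) (mbI k) (measurable_cst _)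
    (fun=> ler01) (gb k) x).
have bound (tau : 'I_alpha.+1) : QB tau <= K tau * \sum_k QA k.
  rewrite -lee_fin EFinM -sumEFin /QB /QA /Rintegral fineK; last exact: (integrable_fin_num mtorus (iB tau)).
  under [X in (_ <= _ * X)%E]eq_bigr do rewrite fineK ?(integrable_fin_num measurableT (iA _)) //.
  have E1 : (\int[leb]_(t in torus) (sqnorm (\sum_i x i * b tau i t) * 1)%:E =
      \int[leb]_(t in torus) (sqnorm (transform_deriv c rho V W tau t))%:E)%E.
    by apply: eq_integral => t _; rewrite bVW mulr1.
  rewrite E1; apply: le_trans ((HK tau).2 V W mV mW) _.
  rewrite le_eqVlt; apply/orP; left; apply/eqP.
  apply: (congr1 (fun z => (K tau)%:E * z)%E).
  apply: eq_bigr => k _; apply: eq_integral => y _.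
  by rewrite [X in sqnorm X * rho y]complex_eta.
have sum3 (G : 'I_alpha.+1 -> I -> I -> R[i]) :
    \sum_k \sum_i \sum_l x i * (x l)^* * G k i l =
    \sum_i \sum_l x i * (x l)^* * \sum_k G k i l.
  rewrite exchange_big /=; apply: eq_bigr => i _; rewrite exchange_big /=.
  by apply: eq_bigr => l _; rewrite mulr_sumr.
have -> : \sum_i \sum_l x i * (x l)^* * ((\sum_tau K tau)%:C * line_inner (s i) (s l) -
      torus_inner (transf (s i)) (transf (s l))) =
    (\sum_tau K tau)%:C * (\sum_(k < alpha.+1) \sum_i \sum_l x i * (x l)^* * gram leb setT (a k) rho i l) -
    (\sum_(k < alpha.+1) \sum_i \sum_l x i * (x l)^* * gram leb torus (b k) (fun=> 1) i l).
  rewrite !sum3 mulr_sumr -sumrB; apply: eq_bigr => i _.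
  rewrite mulr_sumr -sumrB; apply: eq_bigr => l _.
  by rewrite lineE torusE_; ring.
rewrite ReD ReN ReM /= mul0r subr0 !Re_sum.
rewrite (eq_bigr _ (fun k _ => formA k)) (eq_bigr _ (fun k _ => formB k)).
by rewrite subr_ge0 mulr_suml; apply: ler_sum => tau _; exact: bound.
Qed.

End OneFactor.

(** * Tensor products *)

Section TensorForms.
Context {R : realType} (d : nat).
Local Notation cfun := (R -> R[i]).
Implicit Types (ip : 'I_d -> cfun -> cfun -> R[i]) (F G : @tensor_sum R d).

(** The Hermitian form of a linear combination of elementary tensors, given by
    the list of its coefficients and tensors. *)
Definition tensor_form ip (L : seq (R[i] * ('I_d -> cfun))) : R[i] :=
  \sum_(p <- L) \sum_(q <- L) p.1 * q.1^* * \prod_(j < d) ip j (p.2 j) (q.2 j).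

Definition signed_diff F G : seq (R[i] * ('I_d -> cfun)) :=
  [seq (1, s) | s <- F] ++ [seq (-1, t) | t <- G].

Lemma tensor_dist2E ip F G :
  tensor_dist2 ip F G = complex.Re (tensor_form ip (signed_diff F G)).
Proof.
rewrite /tensor_dist2 /tensor_form /signed_diff big_cat !big_map /=.
congr complex.Re.
under [X in _ = X + _]eq_bigr do rewrite big_cat !big_map /=.
under [X in _ = _ + X]eq_bigr do rewrite big_cat !big_map /=.
rewrite !big_split /= /tensor_inner.
have pp (x y : seq ('I_d -> cfun)) (a b : R[i]) :
    \sum_(s <- x) \sum_(t <- y) a * b^* * \prod_(j < d) ip j (s j) (t j) =
    a * b^* * \sum_(s <- x) \sum_(t <- y) \prod_(j < d) ip j (s j) (t j).
  by rewrite mulr_sumr; apply: eq_bigr => s _; rewrite mulr_sumr.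
by rewrite !pp !rmorphN !rmorph1; ring.
Qed.

Lemma tensor_form_ord ip L : tensor_form ip L =
  \sum_(i < size L) \sum_(l < size L)
    (tnth (in_tuple L) i).1 * (tnth (in_tuple L) l).1^* *
    \prod_(j < d) ip j ((tnth (in_tuple L) i).2 j) ((tnth (in_tuple L) l).2 j).
Proof.
rewrite /tensor_form big_tnth; apply: eq_bigr => i _; rewrite big_tnth.
by apply: eq_bigr => l _.
Qed.

End TensorForms.

Section TensorTransform.
Context {R : realType} (d alpha : nat).
Local Notation cfun := (R -> R[i]).
Local Notation leb := (@lebesgue_measure R).
Variables (c : 'I_d -> R) (rho : 'I_d -> R -> R).
Hypotheses (c0 : forall k, 0 < c k) (rhoS : forall k, schwartz_mon_pos (rho k)).

Let rho0 k x : 0 < rho k x. Proof. by have [_ + _] := rhoS k; exact. Qed.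
Let mrho k : measurable_fun setT (rho k).
Proof. by have [[sr _] _ _] := rhoS k; exact: smooth_measurable. Qed.

Local Notation lineH := (fun j => sobolev setT (rho j) weak_derivs_line alpha).
Local Notation lineip := (fun j => sobolev_inner setT (rho j) weak_derivs_line alpha).
Local Notation torusH :=
  (fun _ : 'I_d => sobolev torus (fun=> 1) weak_derivs_torus alpha).
Local Notation torusip :=
  (fun _ : 'I_d => sobolev_inner torus (fun=> 1) weak_derivs_torus alpha).

Definition tensor_transform (F : tensor_sum d) : tensor_sum d :=
  [seq (fun j => transform (c j) (rho j) (s j)) | s <- F].

Lemma tensor_transform_in (F : tensor_sum d) :
  in_alg_tensor lineH F -> in_alg_tensor torusH (tensor_transform F).
Proof.
move=> HF _ /mapP[s sF ->] j; apply: transform_sobolev => //; exact: HF.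
Qed.

(** The squared distance of two sums of elementary tensors is the form of a
    Hadamard product of Gram matrices at the vector of their signs. *)
Lemma tensor_transform_bound : exists2 C : R, 0 < C & forall F G : @tensor_sum R d,
  in_alg_tensor lineH F -> in_alg_tensor lineH G ->
  tensor_dist2 torusip (tensor_transform F) (tensor_transform G) <=
  C * tensor_dist2 lineip F G.
Proof.
have /choice[K HK] j : exists C : R, 0 < C /\
    forall (I : finType) (s : I -> cfun), (forall i, lineH j (s i)) ->
    [/\ schur_stable (fun i l => lineip j (s i) (s l)),
      schur_stable (fun i l => torusip j (transform (c j) (rho j) (s i)) (transform (c j) (rho j) (s l))) &
      psd (fun i l => C%:C * lineip j (s i) (s l) -
        torusip j (transform (c j) (rho j) (s i)) (transform (c j) (rho j) (s l)))].
  by have [C C0 HC] := transform_gram_bound alpha (c0 j) (rhoS j); exists C.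
have K0 j : 0 < K j by have [] := HK j.
exists (\prod_(j < d) K j); first exact: prodr_gt0.
move=> F G HF HG; rewrite !tensor_dist2E.
set L := signed_diff F G.
pose sL (i : 'I_(size L)) := (tnth (in_tuple L) i).2.
have HL i j : lineH j (sL i j).
  rewrite /sL; have := mem_tnth i (in_tuple L); rewrite /= mem_cat => /orP[] /mapP[s sF ->].
    exact: HF.
  exact: HG.
have E : complex.Re (tensor_form torusip (signed_diff (tensor_transform F) (tensor_transform G))) =
  complex.Re (\sum_(i < size L) \sum_(l < size L)
    (tnth (in_tuple L) i).1 * (tnth (in_tuple L) l).1^* *
    \prod_(j < d) torusip j (transform (c j) (rho j) (sL i j)) (transform (c j) (rho j) (sL l j))).
  have -> : signed_diff (tensor_transform F) (tensor_transform G) =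
      [seq (p.1, fun j => transform (c j) (rho j) (p.2 j)) | p <- L].
    by rewrite /L /signed_diff map_cat -!map_comp.
  rewrite /tensor_form big_map big_tnth; congr complex.Re; apply: eq_bigr => i _.
  by rewrite big_map big_tnth; apply: eq_bigr => l _.
rewrite E tensor_form_ord -subr_ge0.
have P : psd (fun i l => (\prod_(j < d) K j)%:C * \prod_(j < d) lineip j (sL i j) (sL l j) -
   \prod_(j < d) torusip j (transform (c j) (rho j) (sL i j)) (transform (c j) (rho j) (sL l j))).
  apply: psd_prod_sub => j; first exact: ltW.
  - by have [] := (HK j).2 _ (fun i => sL i j) (fun i => HL i j).
  - by have [] := (HK j).2 _ (fun i => sL i j) (fun i => HL i j).
  - by have [] := (HK j).2 _ (fun i => sL i j) (fun i => HL i j).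
have := P (fun i => (tnth (in_tuple L) i).1).
congr (0 <= _).
set k := \prod_(j < d) K j.
have -> : \sum_i \sum_l (tnth (in_tuple L) i).1 * (tnth (in_tuple L) l).1^* *
   (k%:C * \prod_(j < d) lineip j (sL i j) (sL l j) -
    \prod_(j < d) torusip j (transform (c j) (rho j) (sL i j)) (transform (c j) (rho j) (sL l j))) =
  k%:C * (\sum_i \sum_l (tnth (in_tuple L) i).1 * (tnth (in_tuple L) l).1^* *
   \prod_(j < d) lineip j (sL i j) (sL l j)) -
  \sum_i \sum_l (tnth (in_tuple L) i).1 * (tnth (in_tuple L) l).1^* *
   \prod_(j < d) torusip j (transform (c j) (rho j) (sL i j)) (transform (c j) (rho j) (sL l j)).
  rewrite mulr_sumr -sumrB; apply: eq_bigr => i _.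
  by rewrite mulr_sumr -sumrB; apply: eq_bigr => l _; ring.
by rewrite ReD ReN ReM /= mul0r subr0.
Qed.

(** The factor that does not involve [f], sorted by variables. *)
Definition multiplier (t : d.-tuple R) : R :=
  \prod_(k < d) (rho k (mob (c k) (tnth t k)) * (c k * dphi (tnth t k))).

Lemma moebius_tnth (t : d.-tuple R) k : tnth (moebius c t) k = mob (c k) (tnth t k).
Proof. by rewrite tnth_mktuple. Qed.

Lemma tensor_fun_transform (F : tensor_sum d) (t : d.-tuple R) :
  tensor_fun (tensor_transform F) t = tensor_fun F (moebius c t) * (multiplier t)%:C.
Proof.
rewrite /tensor_fun /tensor_transform big_map mulr_suml; apply: eq_bigr => s _.
rewrite /multiplier rmorph_prod -big_split; apply: eq_bigr => k _ /=.
by rewrite /transform moebius_tnth.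
Qed.

Lemma multiplierE (t : d.-tuple R) : torus_box t ->
  multiplier t = prod_weight rho (moebius c t) * tuple_dens c t.
Proof.
move=> tb; rewrite /multiplier /prod_weight /tuple_dens -big_split.
by apply: eq_bigr => k _ /=; rewrite moebius_tnth mobdensE.
Qed.

(** In each variable [rho * quad] is bounded. *)
Lemma multiplier_bound : exists2 C : R, 0 < C & forall t, torus_box t ->
  multiplier t ^+ 2 <= C * (prod_weight rho (moebius c t) * tuple_dens c t).
Proof.
have /choice[K HK] k : exists M : R, 0 < M /\ forall x, rho k x * quad (c k) x <= M.
  have [M M0 HM] := admissible_bound (c0 k) (rhoS k) (admissible_weight (rhoS k)).
  exists M; split => // x; have := HM x.
  by rewrite expr2 -mulrA mulrC ler_pM2r.
exists (\prod_(k < d) K k); first by apply: prodr_gt0 => k _; exact: (HK k).1.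
move=> t tb; rewrite multiplierE // expr2.
have w0 : 0 <= prod_weight rho (moebius c t) * tuple_dens c t.
  by rewrite mulr_ge0 ?tuple_dens_ge0 //; apply: prodr_ge0 => k _; exact: ltW.
apply: ler_wpM2r => //.
rewrite /prod_weight /tuple_dens -big_split /=; apply: ler_prod => k _.
rewrite moebius_tnth; apply/andP; split.
  by rewrite mulr_ge0 ?mobdens_ge0 // ltW.
by rewrite mobdensE // -quad_mob //; exact: (HK k).2.
Qed.

Definition inv_moebius (x : d.-tuple R) : d.-tuple R :=
  [tuple ang (c k) (tnth x k) | k < d].

Lemma measurable_inv_moebius : measurable_fun setT inv_moebius.
Proof.
apply/measurable_fun_tnthP => i.
rewrite (_ : _ \o _ = fun t => ang (c i) (tnth t i)).
  have ma : measurable_fun [set: R] (ang (c i)) by exact: (smooth_measurable (@smooth_ang _ (c i))).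
  exact: (measurableT_comp ma (measurable_tnth i)).
by apply/funext => t /=; rewrite tnth_mktuple.
Qed.

Lemma inv_moebiusK x : moebius c (inv_moebius x) = x.
Proof.
by apply: eq_from_tnth => k; rewrite moebius_tnth tnth_mktuple angK.
Qed.

Lemma moebiusK t : torus_box t -> inv_moebius (moebius c t) = t.
Proof.
by move=> tb; apply: eq_from_tnth => k; rewrite tnth_mktuple moebius_tnth mobK.
Qed.

Lemma inv_moebius_box x : torus_box (inv_moebius x).
Proof. by move=> k; rewrite tnth_mktuple; exact: ang_torus. Qed.

Lemma tuple_dens_gt0 t : torus_box t -> 0 < tuple_dens c t.
Proof. by move=> tb; apply: prodr_gt0 => k _; exact: mobdens_gt0. Qed.

Lemma tuple_dens_out t : ~ torus_box t -> tuple_dens c t = 0.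
Proof.
move=> ntb; have [k nk] : exists k, ~ torus (tnth t k) by exact/existsNP.
by rewrite /tuple_dens (bigD1 k) //= mobdens_out // mul0r.
Qed.

Lemma measurable_prod_weight : measurable_fun setT (prod_weight rho).
Proof.
apply: measurable_prod => k _.
exact: (measurableT_comp (mrho k) (measurable_tnth k)).
Qed.

Lemma transport_tuple (Phi : d.-tuple R -> \bar R) : (forall x, 0 <= Phi x)%E ->
  (\int[lebesgue_tuple d]_t (Phi (moebius c t) * (tuple_dens c t)%:E) <=
   \int[lebesgue_tuple d]_x Phi x)%E.
Proof.
move=> Phi0.
apply: (transport_lower_integral (measurable_tuple_dens c) (fun t => tuple_dens_ge0 t c0)
  (fun F mF F0 => ge0_integral_moebius c0 mF F0) measurable_inv_moebius moebiusK
  inv_moebiusK tuple_dens_gt0 tuple_dens_out inv_moebius_box Phi0).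
Qed.

Lemma tensor_transform_ae_measurable (f : d.-tuple R -> R[i]) :
  ae_measurable (lebesgue_tuple d) setT f ->
  ae_measurable (lebesgue_tuple d) (@torus_box R d)
    (fun t => f (moebius c t) * (multiplier t)%:C).
Proof.
move=> af; have [v [w [mv mw fE]]] := ae_measurable_rep measurableT af.
have {}fE : {ae lebesgue_tuple d, forall x, f x = v x +i* w x} by apply: ae_mono fE => x; exact.
pose r t := prod_weight rho (moebius c t) * tuple_dens c t.
have mr : measurable_fun setT r.
  apply: measurable_funM; last exact: measurable_tuple_dens.
  exact: (measurableT_comp measurable_prod_weight (measurable_moebius c)).
apply: (@ae_measurable_ae _ _ _ _ _ _ (fun t => (v (moebius c t) * r t) +i* (w (moebius c t) * r t))).
  have := @transport_ae _ _ _ _ R (lebesgue_tuple d) (lebesgue_tuple d) (moebius c) (tuple_dens c)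
    (measurable_moebius c) (measurable_tuple_dens c) (fun t => tuple_dens_ge0 t c0)
    (fun F mF F0 => ge0_integral_moebius c0 mF F0) (@torus_box R d) _ tuple_dens_gt0 fE.
  apply: ae_mono => t H tb; rewrite H // multiplierE // -/(r t).
  by apply/eqP; rewrite eq_complex /=; apply/andP; split; apply/eqP; ring.
apply: ae_measurable_cpx; apply: measurable_funTS; apply: measurable_funM => //.
  exact: (measurableT_comp mv (measurable_moebius c)).
exact: (measurableT_comp mw (measurable_moebius c)).
Qed.

(** The approximations of [f] in the weighted [L^2] space become approximations
    of the transformed function in the unweighted one. *)
Lemma tensor_transform_cvg (f : d.-tuple R -> R[i]) (F : nat -> tensor_sum d) :
  (fun n => \int[lebesgue_tuple d]_x
     (sqnorm (f x - tensor_fun (F n) x) * prod_weight rho x)%:E)%E @ \oo --> (0 : \bar R) ->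
  (fun n => \int[lebesgue_tuple d]_(t in @torus_box R d)
     (sqnorm (f (moebius c t) * (multiplier t)%:C -
        tensor_fun (tensor_transform (F n)) t) * 1)%:E)%E @ \oo --> (0 : \bar R).
Proof.
move=> Fcvg; have [C C0 HC] := multiplier_bound.
pose S n x := sqnorm (f x - tensor_fun (F n) x) * prod_weight rho x.
have w0 x : 0 <= prod_weight rho x by apply: prodr_ge0 => k _; exact: ltW.
have S0 n x : 0 <= S n x by rewrite mulr_ge0 ?sqnorm_ge0.
have CF : (fun n => C%:E * \int[lebesgue_tuple d]_x (S n x)%:E)%E @ \oo --> (0 : \bar R).
  by rewrite -[X in _ --> X](mule0 C%:E); apply: cvgeZl.
apply: (squeeze_cvge _ (cvg_cst (0 : \bar R)) CF); apply: nearW => n.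
apply/andP; split.
  by apply: integral_ge0 => t _; rewrite lee_fin mulr1 sqnorm_ge0.
apply: (@le_trans _ _ (\int[lebesgue_tuple d]_x (C%:E * (S n x)%:E))%E); last first.
  by apply: lower_integralZl => // x; rewrite lee_fin.
apply: le_trans (transport_tuple _); last first.
  by move=> x; rewrite mule_ge0 // lee_fin // ltW.
rewrite [leLHS]integral_mkcond; apply: le_lower_integral => t.
  by rewrite patchE; case: ifP => // _; rewrite lee_fin mulr1 sqnorm_ge0.
rewrite patchE; case: ifPn => [/set_mem tb|_]; last first.
  by rewrite !mule_ge0 ?lee_fin ?tuple_dens_ge0 // ltW.
rewrite -!EFinM lee_fin mulr1 tensor_fun_transform -mulrBl sqnormM sqnorm_real /S.
have := ler_wpM2l (sqnorm_ge0 (f (moebius c t) - tensor_fun (F n) (moebius c t))) (HC t tb).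
by move=> H; apply: le_trans H _; rewrite le_eqVlt; apply/orP; left; apply/eqP; ring.
Qed.

End TensorTransform.

Theorem proposition6p1 (R : realType) (d alpha : nat)
    (d_gt0 : (0 < d)%N) (alpha_gt0 : (0 < alpha)%N)
    (c : 'I_d -> R) (c_gt0 : forall k, 0 < c k)
    (rho : 'I_d -> R -> R) (rhoS : forall k, schwartz_mon_pos (rho k))
    (f : d.-tuple R -> R[i]) (fW : sobolev_tensor_line alpha rho f) :
  sobolev_tensor_torus alpha
    (fun t : d.-tuple R =>
       f (moebius c t) *
       (prod_weight rho (moebius c t) * \prod_(k < d) (c k * dphi (tnth t k)))%:C).
Proof.
have gE : (fun t : d.-tuple R => f (moebius c t) *
      (prod_weight rho (moebius c t) * \prod_(k < d) (c k * dphi (tnth t k)))%:C) =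
    (fun t => f (moebius c t) * (multiplier c rho t)%:C).
  apply/funext => t; rewrite /multiplier [in RHS]big_split /= /prod_weight.
  by congr (_ * (_ * _)%:C); apply: eq_bigr => k _; rewrite moebius_tnth.
rewrite gE; case: fW => af [F [inF cF Fcvg]].
split; first exact: tensor_transform_ae_measurable.
exists (fun n => tensor_transform c rho (F n)); split.
- by move=> n; exact: tensor_transform_in.
- have [C C0 HC] := tensor_transform_bound alpha c_gt0 rhoS.
  move=> e e0; have [N HN] := cF (e / C) (divr_gt0 e0 C0).
  exists N => m n Nm Nn; apply: le_lt_trans (HC _ _ (inF m) (inF n)) _.
  by rewrite mulrC -ltr_pdivlMr //; exact: HN.
- exact: tensor_transform_cvg.
Qed.
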